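(* Let the type be one of $A,A^{*},B,C,D$, let $q$ be an odd prime power and $d=q-1$. Let $\mathbb K$ be a finite Galois extension of $\mathbb C(u)$, containing $v,w$ with $v^2=u$ and $w^2=1-2u$, such that $\mathbb K Y_{d,n}$ and $\mathbb K Z_{d,n}$ are split, and let the specializations be normalized by $\phi_q(v)=\sqrt{q^{-1}}$, $\phi_1(v)=1$, $\tau_1(w)=-i$, $\tau_0(w)=1$. Then for every irreducible character $\chi_\Lambda^0$ of $S_{d,n}$, the associated irreducible character $\chi_\Lambda^q$ of $\mathcal H(G,U)$ satisfies $$\chi_\Lambda^q(T_{w_0})=\chi_\Lambda^0(\widetilde{w_0})\,(-i)^{g_\Lambda}\,\sqrt{q^{-f_\Lambda}}.$$
   Context: Type data ($n\ge 2$). The Weyl group $W$ acts on the lattice $\bigoplus_{j=1}^n\mathbb Z H_j$; to each simple root $a_i$ ($i=1,\dots,l$) is attached a simple reflection $s_{a_i}\in W$ and a distinguished lattice element $H_{a_i}$. - Types $A$, $A^{*}$ (groups $GL_n$, $SL_n$): $W=\mathbb S_n$ permutes the $H_j$; $l=n-1$; the simple reflections are the transpositions $(i,i+1)$, with distinguished element $H_i-H_{i+1}$. - Types $B$, $C$: $W=W_n$ is the group of $n\times n$ signed permutation matrices acting on the $H_j$ by signed permutations; $l=n$; the reflection of $a_1$ is $\mathrm{Diag}(-1,1,\dots,1)$, with $H_{a_1}=2H_1$ in type $B$ and $H_{a_1}=H_1$ in type $C$; the other simple reflections are the $(i,i+1)$, $1\le i\le n-1$, with distinguished element $\pm(H_i-H_{i+1})$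 (the sign is irrelevant). - Type $D$: $W=W_n'\subset W_n$, the signed permutation matrices with an even number of entries $-1$; $l=n$; the reflection of $a_1$ is $\mathrm{Diag}(-1,1,\dots,1)(1,2)\mathrm{Diag}(-1,1,\dots,1)$ with $H_{a_1}=H_1+H_2$; the others are the $(i,i+1)$ as in type $B$. Let $m_{ij}$ be the order of $s_{a_i}s_{a_j}$. For $H=\sum c_jH_j$ put $t_H=\prod t_j^{c_j}$, $h_i=t_{H_{a_i}}^{d/2}$, $e_i=\frac1d\sum_{j=1}^d t_{H_{a_i}}^j$. All objects below have generators $t_j$ ($1\le j\le n$), $\xi_i$ ($1\le i\le l$) and the common relations: (1) $t_jt_k=t_kt_j$; (2) $t_j^d=1$; (3) $\xi_it_j=t_{s_{a_i}(H_j)}\xi_i$; (5) braid relations $\xi_i\xi_j\cdots=\xi_j\xi_i\cdots$ ($m_{ij}$ factors each side). In addition: $Y_{d,n}$ is the $\mathbb C[u^{\pm1}]$-algebra with $\xi_i^2=u h_i+(1-u)e_i\xi_i$; $Z_{d,n}$ is the $\mathbb C[u]$-algebra with $\xi_i^2=u h_i+(1-u)$; $N_{d,n}$ is the group with $\xi_i^2=h_i$; $S_{d,n}$ is the group with $\xi_i^2=1$. In type $A^{*}$ the torus generated by the $t_j$ (isomorphic to $C_d^n$) is replaced by the subgroup of diagonal matrices of determinant one with entries in $C_d$ (the $d$-th roots of unity), on which the $\xi_i$ act by the corresponding permutations. $\mathcal H(G,U)$ is the Yokonuma–Hecke algebra of the Chevalley group $G$ of the given type over $\mathbb F_q$, identified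 through its presentation with $\mathbb C\otimes_{u\mapsto q^{-1}}Y_{q-1,n}$. $w_0=s_{a_{i_1}}\cdots s_{a_{i_k}}$ is a reduced expression of the longest element of $W$; $T_{w_0}=\xi_{i_1}\cdots\xi_{i_k}\in\mathcal H(G,U)$ and $\widetilde{w_0}=\xi_{i_1}\cdots\xi_{i_k}\in S_{d,n}$. Specializations: $\phi_q,\phi_1$ are ring homomorphisms to $\mathbb C$ from the integral closure of $\mathbb C[u^{\pm1}]$ in $\mathbb K$ extending $u\mapsto q^{-1}$, $u\mapsto 1$; $\tau_1,\tau_0$ are ring homomorphisms to $\mathbb C$ from the integral closure of $\mathbb C[u]$ in $\mathbb K$ extending $u\mapsto1$, $u\mapsto 0$. For such $\theta$, $d_\theta(\chi)=\theta\circ\chi$; the maps $d_{\phi_q}:\mathrm{Irr}(\mathbb KY_{q-1,n})\to\mathrm{Irr}(\mathcal H(G,U))$, $d_{\phi_1}:\mathrm{Irr}(\mathbb KY_{d,n})\to\mathrm{Irr}(N_{d,n})$, $d_{\tau_1}:\mathrm{Irr}(\mathbb KZ_{d,n})\to\mathrm{Irr}(N_{d,n})$, $d_{\tau_0}:\mathrm{Irr}(\mathbb KZ_{d,n})\to\mathrm{Irr}(S_{d,n})$ are bijections. The irreducible characters of $S_{d,n}$ are indexed by labels $\Lambda$ and written $\chi_\Lambda^0$; the associated characters are $\chi_\Lambda'\in\mathrm{Irr}(\mathbb KZ_{d,n})$ with $d_{\tau_0}(\chi'_\Lambda)=\chi^0_\Lambda$, $\chi_\Lambda\in\mathrm{Irr}(\mathbb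 KY_{d,n})$ with $d_{\phi_1}(\chi_\Lambda)=d_{\tau_1}(\chi'_\Lambda)$, and $\chi^q_\Lambda=d_{\phi_q}(\chi_\Lambda)$. With sums over the simple roots in the reduced expression of $w_0$, counted with multiplicity, $$f_\Lambda=\sum_{a_i}\Bigl(1-\frac{\chi^0_\Lambda(e_i\xi_i)}{\chi^0_\Lambda(1)}\Bigr),\qquad g_\Lambda=\sum_{a_i}\frac{\chi^0_\Lambda(1)-\chi^0_\Lambda(t_{H_{a_i}}^{d/2})}{2\chi^0_\Lambda(1)}.$$ Square roots of positive reals are the positive ones. *)

(* Defs.v *)
From HB Require Import structures.
From mathcomp Require Import all_boot all_order all_algebra all_field.
From mathcomp Require Import perm.
From mathcomp Require Import boolp reals exp.
From mathcomp Require Import complex.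
From mathcomp.multinomials Require Import monalg.

Set Implicit Arguments.
Unset Strict Implicit.
Unset Printing Implicit Defensive.

Import Order.TTheory GRing.Theory Num.Theory.

Local Open Scope ring_scope.
Local Open Scope quotient_scope.

Local Notation repr := generic_quotient.repr.

(** [{malg F[{fmonom X}]}] is the free associative unital [F]-algebra on [X].
    [presented rel] is its quotient by the two-sided ideal generated by the
    elements [l - r] with [rel l r].  MathComp's [lalgType] only covers nonzero
    rings, and a presented algebra may be zero, so [presented rel] carries a
    [pzRingType] and an [lmodType] structure. *)

Notation freealg_on F X := {malg F[{fmonom X}]}.

Section Presented.
Variables (F : fieldType) (X : choiceType).

Local Notation freealg := (freealg_on F X).

Definition fgen (x : X) : freealg := mkmalgU (fmu x) 1.
Definition fword (s : seq X) : freealg := \prod_(x <- s) fgen x.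

Variable rel : freealg -> freealg -> Prop.

Inductive in_ideal : freealg -> Prop :=
| in_ideal_rel l r of rel l r : in_ideal (l - r)
| in_ideal0 : in_ideal 0
| in_idealB x y of in_ideal x & in_ideal y : in_ideal (x - y)
| in_idealMl a x of in_ideal x : in_ideal (a * x)
| in_idealMr a x of in_ideal x : in_ideal (x * a).

Definition ideal_pred : {pred freealg} := fun x => `[< in_ideal x >].

Lemma idealP x : reflect (in_ideal x) (x \in ideal_pred).
Proof. exact: asboolP. Qed.

Fact ideal_zmod_closed : zmod_closed ideal_pred.
Proof.
split=> [|x y /idealP xI /idealP yI]; apply/idealP; first exact: in_ideal0.
exact: in_idealB.
Qed.
HB.instance Definition _ :=
  GRing.isZmodClosed.Build freealg ideal_pred ideal_zmod_closed.

Definition presented : Type := Quotient.quot ideal_pred.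
HB.instance Definition _ := Choice.on presented.
HB.instance Definition _ := GRing.Zmodule.on presented.
HB.instance Definition _ : EqQuotient freealg (Quotient.equiv ideal_pred)
  presented := EqQuotient.on presented.

Definition cls (x : freealg) : presented := \pi_presented x.

Lemma cls_eq x y : cls x = cls y <-> in_ideal (x - y).
Proof.
rewrite /cls; split=> [/eqP|xy]; last apply/eqP.
  by rewrite -Quotient.idealrBE => /idealP.
by rewrite -Quotient.idealrBE; apply/idealP.
Qed.

Lemma cls_rel l r : rel l r -> cls l = cls r.
Proof. by move=> lr; apply/cls_eq/in_ideal_rel. Qed.

Lemma cls_repr (x : presented) : cls (repr x) = x.
Proof. exact: reprK. Qed.

Lemma clsD x y : cls (x + y) = cls x + cls y.
Proof. exact: (Quotient.pi_add _ x y). Qed.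

Definition presented_one : presented := cls 1.
Definition presented_mul (x y : presented) : presented := cls (repr x * repr y).
Definition presented_scale (c : F) (x : presented) : presented :=
  cls (c *: repr x).

Lemma presented_mulE x y : presented_mul (cls x) (cls y) = cls (x * y).
Proof.
apply/cls_eq; set x' := repr _; set y' := repr _.
have xI : in_ideal (x' - x) by apply/cls_eq/cls_repr.
have yI : in_ideal (y' - y) by apply/cls_eq/cls_repr.
have -> : x' * y' - x * y = (x' - x) * y' - x * (y - y').
  by rewrite mulrBl mulrBr opprB addrA subrK.
by apply: in_idealB; [exact: in_idealMr|rewrite -opprB mulrN -mulNr; exact: in_idealMl].
Qed.

Lemma presented_scaleE c x : presented_scale c (cls x) = cls (c *: x).
Proof.
apply/cls_eq; set x' := repr _; rewrite -scalerBr -mulr_algl.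
by apply/in_idealMl/cls_eq/cls_repr.
Qed.

Fact presented_mulA : associative presented_mul.
Proof.
move=> x y z; rewrite -[x]cls_repr -[y]cls_repr -[z]cls_repr.
by rewrite !presented_mulE mulrA.
Qed.

Fact presented_mul1 : left_id presented_one presented_mul.
Proof. by move=> x; rewrite -[x]cls_repr presented_mulE mul1r. Qed.

Fact presented_mulr1 : right_id presented_one presented_mul.
Proof. by move=> x; rewrite -[x]cls_repr presented_mulE mulr1. Qed.

Fact presented_mulDl : left_distributive presented_mul +%R.
Proof.
move=> x y z; rewrite -[x]cls_repr -[y]cls_repr -[z]cls_repr.
by rewrite -clsD !presented_mulE mulrDl clsD.
Qed.

Fact presented_mulDr : right_distributive presented_mul +%R.
Proof.
move=> x y z; rewrite -[x]cls_repr -[y]cls_repr -[z]cls_repr.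
by rewrite -clsD !presented_mulE mulrDr clsD.
Qed.

HB.instance Definition _ := GRing.Zmodule_isPzRing.Build presented
  presented_mulA presented_mul1 presented_mulr1 presented_mulDl presented_mulDr.

Fact presented_scaleA a b (x : presented) :
  presented_scale a (presented_scale b x) = presented_scale (a * b) x.
Proof. by rewrite -[x]cls_repr !presented_scaleE scalerA. Qed.

Fact presented_scale1 : left_id 1 presented_scale.
Proof. by move=> x; rewrite -[x]cls_repr presented_scaleE scale1r. Qed.

Fact presented_scaleDr : right_distributive presented_scale +%R.
Proof.
move=> a x y; rewrite -[x]cls_repr -[y]cls_repr.
by rewrite -clsD !presented_scaleE scalerDr clsD.
Qed.

Fact presented_scaleDl (x : presented) :
  {morph presented_scale^~ x : a b / a + b}.
Proof. by move=> a b; rewrite -[x]cls_repr !presented_scaleE scalerDl clsD. Qed.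

HB.instance Definition _ := GRing.Zmodule_isLmodule.Build F presented
  presented_scaleA presented_scale1 presented_scaleDr presented_scaleDl.

Lemma clsM x y : cls (x * y) = cls x * cls y.
Proof. by rewrite -presented_mulE. Qed.

Lemma clsZ c x : cls (c *: x) = c *: cls x.
Proof. by rewrite -presented_scaleE. Qed.

Definition is_rep m (rho : presented -> 'M[F]_m) : Prop :=
  linear rho /\ monoid_morphism rho.

(** Subspaces of [F^m] are encoded as row spaces of square matrices. *)
Definition irreducible_rep m (rho : presented -> 'M[F]_m) : Prop :=
  [/\ is_rep rho, (0 < m)%N &
      forall U : 'M[F]_m, (forall a, stablemx U (rho a)) -> U = 0 \/ row_full U].

Definition irr_char (chi : presented -> F) : Prop :=
  exists (m : nat) (rho : presented -> 'M[F]_m),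
    irreducible_rep rho /\ forall a, chi a = \tr (rho a).

Definition split_alg : Prop :=
  forall (m : nat) (rho : presented -> 'M[F]_m), irreducible_rep rho ->
    forall B : 'M[F]_m, (forall a, comm_mx B (rho a)) -> is_scalar_mx B.

End Presented.

Variant chevalley_type := TypeA | TypeAstar | TypeB | TypeC | TypeD.

Definition nroots (ty : chevalley_type) (n : nat) : nat :=
  match ty with TypeA | TypeAstar => n.-1 | _ => n end.

(** Elements of the lattice are columns of integers and [W] acts on the left;
    indices start from 0: [Hb n k] is H_(k+1), [adjmx n k] is the transposition
    (k+1, k+2) and the simple root a_(i+1) has index [i]. *)
Definition Hb (n k : nat) : 'cV[int]_n := \col_(j < n) (j == k :> nat)%:R.

Definition adjmx (n k : nat) : 'M[int]_n :=
  \matrix_(a < n, b < n)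
    (a == (if b == k :> nat then k.+1 else if b == k.+1 :> nat then k else b)
       :> nat)%:R.

Definition neg1mx (n : nat) : 'M[int]_n :=
  diag_mx (\row_(j < n) if j == 0%N :> nat then -1 else 1).

Definition srefl (ty : chevalley_type) (n i : nat) : 'M[int]_n :=
  match ty, i with
  | (TypeA | TypeAstar), _ => adjmx n i
  | (TypeB | TypeC), 0 => neg1mx n
  | TypeD, 0 => neg1mx n *m adjmx n 0 *m neg1mx n
  | (TypeB | TypeC | TypeD), k.+1 => adjmx n k
  end.

Definition Hroot (ty : chevalley_type) (n i : nat) : 'cV[int]_n :=
  match ty, i with
  | (TypeA | TypeAstar), _ => Hb n i - Hb n i.+1
  | TypeB, 0 => Hb n 0 *+ 2
  | TypeC, 0 => Hb n 0
  | TypeD, 0 => Hb n 0 + Hb n 1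
  | (TypeB | TypeC | TypeD), k.+1 => Hb n k - Hb n k.+1
  end.

Definition signed_perm_mx n (eps : 'I_n -> bool) (s : 'S_n) : 'M[int]_n :=
  diag_mx (\row_(j < n) (-1) ^+ eps j) *m perm_mx s.

Definition weyl (ty : chevalley_type) (n : nat) (M : 'M[int]_n) : Prop :=
  match ty with
  | TypeA | TypeAstar => exists s : 'S_n, M = perm_mx s
  | TypeB | TypeC =>
      exists (eps : 'I_n -> bool) (s : 'S_n), M = signed_perm_mx eps s
  | TypeD => exists (eps : 'I_n -> bool) (s : 'S_n),
      ~~ odd #|[set j | eps j]| /\ M = signed_perm_mx eps s
  end.

Definition mx_order n (M : 'M[int]_n) (m : nat) : Prop :=
  [/\ (0 < m)%N, M ^+ m = 1 & forall k, (0 < k < m)%N -> M ^+ k != 1].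

Definition wprod ty n (s : seq 'I_(nroots ty n)) : 'M[int]_n :=
  \big[mulmx/1%:M]_(i <- s) srefl ty n i.

Definition reduced_word ty n (s : seq 'I_(nroots ty n)) : Prop :=
  forall s' : seq 'I_(nroots ty n), wprod s' = wprod s -> (size s <= size s')%N.

(** [s] is a reduced expression of the longest element of [W]: no element of [W]
    needs more than [size s] simple reflections. *)
Definition longest_word ty n (s : seq 'I_(nroots ty n)) : Prop :=
  [/\ weyl ty (wprod s), reduced_word s &
      forall M : 'M[int]_n, weyl ty M ->
        exists s' : seq 'I_(nroots ty n),
          wprod s' = M /\ (size s' <= size s)%N].

(** The torus C_d^n is written additively: the column [c] over ['Z_d] stands for
    prod_j t_j^(c_j).  This requires [2 <= d], as ['Z_1] is Z/2Z.  The torus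
    generators are the t_j, except in type A^*, where they are the elements of
    the subgroup { c | sum_j c_j = 0 }, with the relations of its group law. *)

Definition tgen (ty : chevalley_type) (n d : nat) : choiceType :=
  match ty with
  | TypeAstar => {c : 'cV['Z_d]_n | \sum_j c j 0 == 0} : choiceType
  | _ => 'I_n : choiceType
  end.

Definition letter (ty : chevalley_type) (n d : nat) : choiceType :=
  (tgen ty n d + 'I_(nroots ty n))%type : choiceType.

Definition texp ty n d : tgen ty n d -> 'cV['Z_d]_n :=
  match ty return tgen ty n d -> 'cV['Z_d]_n with
  | TypeAstar => fun c => val c
  | _ => fun j => delta_mx j 0
  end.

(** The monomial in the torus generators [T] with exponents [c].  In type A^* it
    is only meaningful when the entries of [c] sum to 0. *)
Definition tmonom (A : pzRingType) ty n d :
    (tgen ty n d -> A) -> 'cV['Z_d]_n -> A :=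
  match ty return (tgen ty n d -> A) -> 'cV['Z_d]_n -> A with
  | TypeAstar => fun T c => oapp T 1 (insub c)
  | _ => fun T c => \prod_(j < n) T j ^+ (c j 0)
  end.

Variant full_torus_rel (A : pzRingType) (n d : nat) (T : 'I_n -> A) :
    A -> A -> Prop :=
| full_torus_comm j k : full_torus_rel d T (T j * T k) (T k * T j)
| full_torus_pow j : full_torus_rel d T (T j ^+ d) 1.

Variant sl_torus_rel (A : pzRingType) (n d : nat)
    (T : {c : 'cV['Z_d]_n | \sum_j c j 0 == 0} -> A) : A -> A -> Prop :=
| sl_torus_one c of val c = 0 : sl_torus_rel T (T c) 1
| sl_torus_mul c c' c'' of val c'' = val c + val c' :
    sl_torus_rel T (T c * T c') (T c'').

Definition torus_rel (A : pzRingType) ty n d :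
    (tgen ty n d -> A) -> A -> A -> Prop :=
  match ty return (tgen ty n d -> A) -> A -> A -> Prop with
  | TypeAstar => fun T => sl_torus_rel T
  | _ => fun T => full_torus_rel d T
  end.

(** Over a field [F], the algebra with quadratic relation [QuadY u] is F (x) Y for
    the base change C[u^(+-1)] -> F sending the indeterminate to [u], and likewise
    [QuadZ u] for Z.  In N and S every generator has finite order, so [QuadN] and
    [QuadS] give the group algebras over [F] of the groups N and S; a character of
    one of these groups is identified with its linear extension. *)
Variant quadratic (F : Type) := QuadY of F | QuadZ of F | QuadN | QuadS.
Arguments QuadN {F}.
Arguments QuadS {F}.

Definition modd n d (c : 'cV[int]_n) : 'cV['Z_d]_n :=
  map_mx (fun z : int => z%:~R) c.

Section Algebras.
Variables (F : fieldType) (ty : chevalley_type) (n d : nat).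

Local Notation FA := (freealg_on F (letter ty n d)).
Local Notation I := 'I_(nroots ty n).

Definition tor (g : tgen ty n d) : FA := fgen F (inl g).
Definition xi (i : I) : FA := fgen F (inr i).
Definition tH (H : 'cV[int]_n) : FA := tmonom tor (modd d H).
Definition hh (i : I) : FA := tH (Hroot ty n i) ^+ d./2.
Definition ee (i : I) : FA :=
  (d%:R)^-1 *: \sum_(1 <= j < d.+1) tH (Hroot ty n i) ^+ j.
Definition xiword (s : seq I) : FA := \prod_(i <- s) xi i.

Definition quad_rhs (Q : quadratic F) (i : I) : FA :=
  match Q with
  | QuadY u => u *: hh i + (1 - u) *: (ee i * xi i)
  | QuadZ u => u *: hh i + (1 - u) *: 1
  | QuadN => hh i
  | QuadS => 1
  end.

Definition alternating (x y : FA) (m : nat) : FA :=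
  \prod_(k < m) (if odd k then y else x).

Variant yoko_rel (Q : quadratic F) : FA -> FA -> Prop :=
| yoko_torus l r of torus_rel tor l r : yoko_rel Q l r
| yoko_conj (i : I) g : yoko_rel Q (xi i * tor g)
    (tmonom tor (map_mx (fun z : int => z%:~R) (srefl ty n i) *m texp g) * xi i)
| yoko_braid (i j : I) m of mx_order (srefl ty n i *m srefl ty n j) m :
    yoko_rel Q (alternating (xi i) (xi j) m) (alternating (xi j) (xi i) m)
| yoko_quad (i : I) : yoko_rel Q (xi i ^+ 2) (quad_rhs Q i).

Definition yoko (Q : quadratic F) : Type := presented (yoko_rel Q).

End Algebras.

Arguments tor {F ty n d}.
Arguments xi {F ty n d}.
Arguments hh {F ty n d}.
Arguments ee {F ty n d}.
Arguments xiword {F ty n d}.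

Section Specialization.
Variables (C : fieldType) (K : fieldExtType {fraction {poly C}}).

Definition polyK (p : {poly C}) : K := (tofrac p)%:A.
Definition uK : K := polyK 'X.

Definition poly_ring (x : K) : Prop := exists p, x = polyK p.
Definition laurent_ring (x : K) : Prop := exists p k, x = polyK p / uK ^+ k.

Definition integral_closure (S : K -> Prop) (x : K) : Prop :=
  exists p : {poly K}, [/\ p \is monic, forall i, S p`_i & root p x].

(** Ring homomorphisms from the integral closure of [S] (which contains C[u]) to
    [C] that extend u |-> a; the values of [theta] elsewhere are irrelevant. *)
Definition specialization (S : K -> Prop) (a : C) (theta : K -> C) : Prop :=
  [/\ forall x y, integral_closure S x -> integral_closure S y ->
        theta (x + y) = theta x + theta y,
      forall x y, integral_closure S x -> integral_closure S y ->
        theta (x * y) = theta x * theta y &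
      forall p : {poly C}, theta (polyK p) = p.[a]].

(** d_theta(chi) = psi, i.e. psi = theta o chi on the integral form.  The integral
    form and its specialization are spanned by the words in the generators, and
    both sides are theta-semilinear. *)
Definition dspec (ty : chevalley_type) (n d : nat) (Q : quadratic K)
    (Q0 : quadratic C) (theta : K -> C)
    (chi : yoko ty n d Q -> K) (psi : yoko ty n d Q0 -> C) : Prop :=
  forall s : seq (letter ty n d),
    psi (cls _ (fword C s)) = theta (chi (cls _ (fword K s))).

End Specialization.

Section Exponents.
Variables (C : fieldType) (ty : chevalley_type) (n d : nat).
Variable chi0 : yoko ty n d (@QuadS C) -> C.
Variable w : seq 'I_(nroots ty n).

Definition fexp : C :=
  \sum_(i <- w) (1 - chi0 (cls _ (ee i * xi i)) / chi0 1).

Definition gexp : C :=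
  \sum_(i <- w) (chi0 1 - chi0 (cls _ (hh i))) / (2 * chi0 1).

End Exponents.

(* Main.v *)
Require Import Defs.
From HB Require Import structures.
From mathcomp Require Import all_boot all_order all_algebra all_field.
From mathcomp Require Import perm zify ring.
From mathcomp Require Import boolp reals exp.
From mathcomp Require Import complex.
From mathcomp.multinomials Require Import monalg.

(** The value of an irreducible character at [T_{w0}] is controlled by the fact
    that [T_{w0}^2] is central: it acts by a scalar [z], so the trace of
    [T_{w0}] is an integer times a square root of [z], and [z] can be read off
    from the determinant of [T_{w0}], the product of the determinants of the
    [xi_i].

    The quadratic relations determine these determinants.  On a representation
    of [KY] the commuting operators [e_i], [h_i], [xi_i] are diagonalizable
    ([Y_eigenvalues]); where [e_i = 1] the eigenvalues of [xi_i] are [1] and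
    [-u], where [e_i = 0] they are [v] times a fourth root of unity.  So
    [det xi_i] is a constant times [v ^ p_i], where [p_i] adds up the exponents
    0, 2 and 1 of these eigenvalues, and at [u = 1] the trace of [e_i xi_i] is
    the dimension [m] minus [p_i] ([Y_root]).  On a representation of [KZ] the
    eigenvalues of [xi_i] are signs where [h_i = 1] and [w] up to sign where
    [h_i = -1]; so [det xi_i] is a sign times [w ^ g_i] and the trace of [h_i]
    is [m - 2 g_i] ([Z_root]).  Traces of [e_i xi_i] and [h_i] can be carried
    through the specializations, and summing over the letters of [w0] gives
    [det T_{w0} = c v ^ (m f)] in [KY] and [det T_{w0} = c' w ^ (m g)] in [KZ],
    with the [f] and [g] of the theorem.

    If [f] and [g] are integers, the constants can be separated: the scalar
    [z / v ^ (2 f)] has a constant [m]-th power, hence is constant because the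
    base field is algebraically closed, and the trace of [T_{w0}] is a constant
    times [v ^ f], respectively [w ^ g] ([central_trace]).  The specializations
    only see [v] and [w], and comparing the four of them gives the formula.
    Integrality cannot be skipped, since [K] may contain roots of [u] on which
    the specializations are not normalized.

    Integrality is a statement about the group where [xi_i ^ 2 = 1].  The sum
    over the letters of [w0] of the traces of [e_i xi_i] is the trace of the
    sum [X] over all reflections [s] of [e_s s], which is central, hence a
    scalar.  This scalar is rational; it is an algebraic integer because [X]
    maps the lattice spanned by the Weyl group translates of a common
    eigenvector of the torus into itself ([avg_xi_class_int]).  For [g] the same
    sum, made with the [h_s], acts on such an eigenvector by a sum of signs
    ([half_class_nat]).

    The combinatorial input is that [T_{w0}^2] and [X] are central.  Both follow
    from the geometry of the roots: the exchange condition ([exchange]), Tits'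
    argument for Matsumoto's theorem ([matsumoto]), the fact that [- w0]
    permutes the simple roots ([longest_star]) and the fact that the inversions
    of [w0] are all the positive roots ([Dsum_longest]). *)

Set Implicit Arguments.
Unset Strict Implicit.
Unset Printing Implicit Defensive.

Import Order.TTheory GRing.Theory Num.Theory.
Local Open Scope ring_scope.

(** * Roots as differences of signed basis vectors *)

(** Signed indices let the four families of roots be treated at once: the vector
    of index [- z] is the opposite of the vector of index [z], and every root is
    a difference of two such vectors (with [2 H_k] as the difference of the
    vectors of indices [k] and [- k]).  Indices start from 1 here. *)
Definition signed_basis (n : nat) (z : int) : 'cV[int]_n :=
  \col_(j < n) ((j.+1%:Z == z)%:R - (j.+1%:Z == - z)%:R).

(** The signed permutation exchanging [a] and [b]; every simple reflection acts
    on signed indices in this way. *)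
Definition zswap (a b z : int) : int :=
  if z == a then b else if z == b then a else
  if z == - a then - b else if z == - b then - a else z.

Definition root_lo (ty : chevalley_type) (i : nat) : int :=
  match ty, i with
  | (TypeA | TypeAstar), _ => i.+1%:Z
  | _, 0 => -1
  | _, k.+1 => k.+1%:Z
  end.

Definition root_hi (ty : chevalley_type) (i : nat) : int :=
  match ty, i with
  | (TypeA | TypeAstar), _ => i.+2%:Z
  | TypeD, 0 => 2
  | _, 0 => 1
  | _, k.+1 => k.+2%:Z
  end.

(** Differences of signed basis vectors that are roots: in type A both indices
    have the same sign, in type D the vectors [2 H_k] are left out.  Types B
    and C share the same pairs: only the multiples of the roots that occur as
    the [H_a] differ, and those are handled by [rscale]. *)
Definition is_rootpair (ty : chevalley_type) (n : nat) (x y : int) : bool :=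
  [&& 0 < `|x| <= n%:Z, 0 < `|y| <= n%:Z, x != y &
      match ty with
      | TypeA | TypeAstar => (0 < x) == (0 < y)
      | TypeD => x != - y
      | _ => true
      end].

Section Roots.
Variables (ty : chevalley_type) (n : nat).

Local Notation I := 'I_(nroots ty n).
Local Notation s := (srefl ty n).
Local Notation lo := (root_lo ty).
Local Notation hi := (root_hi ty).

Definition sroot (i : nat) : 'cV[int]_n := signed_basis n (hi i) - signed_basis n (lo i).

(** A root is positive when its larger signed index comes last; this is well
    defined because negating both indices and exchanging them preserves the
    order. *)
Definition posroot (b : 'cV[int]_n) : Prop :=
  exists x y : int, [/\ is_rootpair ty n x y, x < y & b = signed_basis n y - signed_basis n x].

Lemma signed_basisN z : signed_basis n (- z) = - signed_basis n z.
Proof. by apply/colP=> j; rewrite !mxE opprK opprB. Qed.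

Lemma neg1mxE (v : 'cV[int]_n) j :
  (neg1mx n *m v) j 0 = (if j == 0%N :> nat then -1 else 1) * v j 0.
Proof. by rewrite mul_diag_mx !mxE. Qed.

Lemma adjmx_perm (k : nat) (lt1 : (k < n)%N) (lt2 : (k.+1 < n)%N) :
  adjmx n k = perm_mx (tperm (Ordinal lt1) (Ordinal lt2)).
Proof.
apply/matrixP=> a b; rewrite !mxE permE /= -!val_eqE /=.
congr (nat_of_bool _)%:R.
do ![case: ifP] => /=; lia.
Qed.

Lemma adjmxE k (v : 'cV[int]_n) (lt2 : (k.+1 < n)%N) j :
  (adjmx n k *m v) j 0 =
  v (tperm (Ordinal (ltnW lt2)) (Ordinal lt2) j) 0.
Proof. by rewrite (adjmx_perm (ltnW lt2) lt2) -row_permE mxE. Qed.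

Lemma adjmx_signed_basis k z : (k.+1 < n)%N ->
  adjmx n k *m signed_basis n z = signed_basis n (zswap k.+1 k.+2 z).
Proof.
move=> lt2; apply/colP=> j; rewrite adjmxE !mxE permE /= -!val_eqE /= /zswap.
by do ![case: ifP => /=]; lia.
Qed.

Lemma neg1mx_signed_basis z : neg1mx n *m signed_basis n z = signed_basis n (zswap (-1) 1 z).
Proof.
apply/colP=> j; rewrite neg1mxE !mxE /zswap.
by do ![case: ifP => /=]; lia.
Qed.

Hypothesis n_ge2 : (2 <= n)%N.

Lemma srefl_signed_basis (i : I) z : s i *m signed_basis n z = signed_basis n (zswap (lo i) (hi i) z).
Proof.
case: i => i; rewrite /srefl; case: ty => /=; try by move=> ?; apply: adjmx_signed_basis; lia.
- by case: i => [|k] ? /=; [exact: neg1mx_signed_basis|exact: adjmx_signed_basis].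
- by case: i => [|k] ? /=; [exact: neg1mx_signed_basis|exact: adjmx_signed_basis].
case: i => [|k] ? /=; last exact: adjmx_signed_basis.
rewrite -!mulmxA neg1mx_signed_basis adjmx_signed_basis; last by lia.
rewrite neg1mx_signed_basis; congr signed_basis; rewrite /zswap.
by do ![case: ifP => /=]; lia.
Qed.

Lemma rootpairP (i : I) : is_rootpair ty n (lo i) (hi i) && (lo i < hi i).
Proof.
case: i => i; rewrite /is_rootpair.
by case: ty => /= lti; try (case: i lti => [|k] /= lti); lia.
Qed.

Lemma posroot_simple (i : I) : posroot (sroot i).
Proof. by exists (lo i), (hi i); have /andP[? ?] := rootpairP i. Qed.

Lemma srefl_sroot (i : I) : s i *m sroot i = - sroot i.
Proof.
rewrite mulmxBr !srefl_signed_basis opprB; congr (signed_basis n _ - signed_basis n _); rewrite /zswap;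
by do ![case: ifP => /=]; lia.
Qed.

(** The only inversions of the exchange of [lo] and [hi] among pairs of indices of
    roots are the two pairs that represent the simple root: in type A, B and C
    the two indices are adjacent, and in type D the pairs in between, such as
    [(-1, 1)], are not roots. *)
Lemma zswap_lt (i : I) x y : is_rootpair ty n x y -> x < y ->
  [|| (x == lo i) && (y == hi i), (x == - hi i) && (y == - lo i)
    | zswap (lo i) (hi i) x < zswap (lo i) (hi i) y].
Proof.
case: i => i lti; rewrite /is_rootpair /zswap; move: lti.
by case: ty => /= lti; try (case: i lti => [|k] /= lti); do ![case: ifP => /=]; lia.
Qed.

Lemma zswap_pair (i : I) x y : is_rootpair ty n x y ->
  is_rootpair ty n (zswap (lo i) (hi i) x) (zswap (lo i) (hi i) y).
Proof.
case: i => i lti; rewrite /is_rootpair /zswap; move: lti.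
by case: ty => /= lti; try (case: i lti => [|k] /= lti); do ![case: ifP => /=]; lia.
Qed.

End Roots.

(** * Heights, coroots and the rank one form of a simple reflection *)

Lemma intmx_scaleI m n (a : int) (A B : 'M[int]_(m, n)) :
  a != 0 -> a *: A = a *: B -> A = B.
Proof.
move=> a0 /matrixP eAB; apply/matrixP => i j.
by have := eAB i j; rewrite !mxE; apply: mulfI.
Qed.

Section Roots.
Variables (ty : chevalley_type) (n : nat).
Local Notation I := 'I_(nroots ty n).
Local Notation s := (srefl ty n).
Local Notation lo := (root_lo ty).
Local Notation hi := (root_hi ty).
Local Notation sroot := (sroot ty n).
Local Notation posroot := (posroot ty (n:=n)).

(** The linear form sending the signed basis vector of index [z] to [z]; it
    separates positive from negative roots. *)
Definition height (b : 'cV[int]_n) : int := \sum_(j < n) j.+1%:Z * b j 0.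

Lemma height_signed_basis z : 0 < `|z| <= n%:Z -> height (signed_basis n z) = z.
Proof.
move=> hz; have lt_n : (`|z|.-1 < n)%N by lia.
rewrite /height (bigD1 (Ordinal lt_n)) //= big1 ?mxE /=; last first.
  move=> j; rewrite -val_eqE /= !mxE => ne.
  have -> : (j.+1%:Z == z) = false by lia.
  have -> : (j.+1%:Z == - z) = false by lia.
  by rewrite subrr mulr0.
by do ![case: eqP => /=]; lia.
Qed.

Lemma posroot_height b : posroot b -> 0 < height b.
Proof.
case=> x [y [/and4P[hx hy _ _] ltxy ->]].
suff -> : height (signed_basis n y - signed_basis n x) = y - x by lia.
rewrite -[in RHS](height_signed_basis hx) -[in RHS](height_signed_basis hy) /height -sumrB.
by apply: eq_bigr => j _; rewrite !mxE mulrBr.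
Qed.

Lemma posrootN b : posroot b -> ~ posroot (- b).
Proof.
move=> /posroot_height h1 /posroot_height.
suff -> : height (- b) = - height b by lia.
by rewrite /height -sumrN; apply: eq_bigr => j _; rewrite mxE mulrN.
Qed.

Definition coroot (i : nat) : 'rV[int]_n :=
  match ty, i with
  | (TypeB | TypeC), 0 => (signed_basis n 1)^T
  | _, _ => (sroot i)^T
  end.

(** Half of the squared length of the simple root; it is the factor between the
    root and the coroot. *)
Definition hnorm (i : nat) : int :=
  match ty, i with (TypeB | TypeC), 0 => 2 | _, _ => 1 end.

(** The simple root as a multiple of the distinguished lattice element.  The
    factor is 2 only for the short element [H_1] of type C, and it is negative
    where the two choices have opposite signs. *)
Definition rscale (i : nat) : int :=
  match ty, i with
  | TypeB, 0 => 1 | TypeC, 0 => 2 | TypeD, 0 => 1 | _, _ => -1 end.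

Lemma signed_basis_Hb k : signed_basis n k.+1 = Hb n k.
Proof. by apply/colP=> j; rewrite !mxE; do ![case: eqP => /=]; lia. Qed.

Lemma signed_basis_N1 : signed_basis n (Negz 0) = - Hb n 0.
Proof. by rewrite (_ : Negz 0 = - 1%:Z) // signed_basisN signed_basis_Hb. Qed.

Lemma sroot_Hroot (i : I) : sroot i = rscale i *: Hroot ty n i.
Proof.
rewrite /sroot; case: i => i; rewrite /rscale /Hroot; case: ty => /= lti;
 try (case: i lti => [|k] /= lti);
 rewrite ?signed_basis_N1 ?signed_basis_Hb ?(signed_basis_Hb 0) ?(signed_basis_Hb 1) ?scaleN1r ?scale1r ?opprB ?opprK //.
- by rewrite scaler_nat mulr2n.
by rewrite addrC.
Qed.

Lemma coroot_sroot (i : nat) : (sroot i)^T = hnorm i *: coroot i.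
Proof.
rewrite /sroot /hnorm /coroot; case: ty; case: i => [|k] /=; rewrite ?scale1r //.
  by rewrite signed_basis_N1 (signed_basis_Hb 0) opprK -mulr2n scaler_nat raddfMn.
by rewrite signed_basis_N1 (signed_basis_Hb 0) opprK -mulr2n scaler_nat raddfMn.
Qed.

Lemma adjmx_rank1 k : (k.+1 < n)%N ->
  adjmx n k = 1%:M - (signed_basis n k.+2 - signed_basis n k.+1) *m (signed_basis n k.+2 - signed_basis n k.+1)^T.
Proof.
move=> lt2; apply/matrixP=> a b; rewrite mxE !mxE big_ord1 !mxE -val_eqE /=.
by do ![case: eqP => /=]; lia.
Qed.

Lemma neg1mx_rank1 : neg1mx n = 1%:M - (signed_basis n 1 *+ 2) *m (signed_basis n 1)^T.
Proof.
rewrite mulr2n; apply/matrixP=> a b; rewrite !mxE big_ord1 !mxE -val_eqE /=.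
by do ![case: eqP => /=]; lia.
Qed.

Lemma neg1mx_sq : neg1mx n *m neg1mx n = 1%:M.
Proof.
apply/matrixP=> a b; rewrite mul_diag_mx !mxE -val_eqE /=.
by do ![case: eqP => /=]; lia.
Qed.

Lemma neg1mx_tr : (neg1mx n)^T = neg1mx n.
Proof. exact: tr_diag_mx. Qed.

Hypothesis n_ge2 : (2 <= n)%N.
Local Notation srefl_signed_basis := (srefl_signed_basis n_ge2).
Local Notation zswap_lt := (zswap_lt n_ge2).
Local Notation zswap_pair := (zswap_pair n_ge2).
Local Notation posroot_simple := (posroot_simple n_ge2).
Local Notation srefl_sroot := (srefl_sroot n_ge2).

Lemma posroot_srefl (i : I) b : posroot b -> b != sroot i -> posroot (s i *m b).
Proof.
case=> x [y [xyP ltxy ->]] ne.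
have /or3P[/andP[/eqP ex /eqP ey]|/andP[/eqP ex /eqP ey]|lt'] := zswap_lt i xyP ltxy.
- by rewrite /sroot ex ey eqxx in ne.
- by rewrite /sroot ex ey !signed_basisN opprK addrC eqxx in ne.
exists (zswap (lo i) (hi i) x), (zswap (lo i) (hi i) y); split => //.
  exact: zswap_pair.
by rewrite mulmxBr !srefl_signed_basis.
Qed.

Lemma srefl_rank1 (i : I) : s i = 1%:M - sroot i *m coroot i.
Proof.
rewrite /sroot; case: i => i; rewrite /srefl /coroot /sroot; case: ty => /= lti.
- by rewrite adjmx_rank1 //; lia.
- by rewrite adjmx_rank1 //; lia.
- case: i lti => [|k] lti /=; last by rewrite adjmx_rank1 //; lia.
  by rewrite neg1mx_rank1 (signed_basis_Hb 0) signed_basis_N1 opprK.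
- case: i lti => [|k] lti /=; last by rewrite adjmx_rank1 //; lia.
  by rewrite neg1mx_rank1 (signed_basis_Hb 0) signed_basis_N1 opprK.
case: i lti => [|k] lti /=; last by rewrite adjmx_rank1 //; lia.
rewrite adjmx_rank1 // mulmxBr mulmxBl mulmx1 neg1mx_sq; congr (_ - _).
rewrite -{2}neg1mx_tr -!mulmxA -trmx_mul mulmxA.
have -> : neg1mx n *m (signed_basis n 2 - signed_basis n 1) = signed_basis n 2 - signed_basis n (-1).
  by rewrite mulmxBr !neg1mx_signed_basis.
by [].
Qed.

Lemma srefl_sq (i : I) : s i *m s i = 1%:M.
Proof.
rewrite {2}srefl_rank1 mulmxBr mulmx1 mulmxA srefl_sroot mulNmx opprK.
by rewrite srefl_rank1 subrK.
Qed.

Lemma hnorm_neq0 i : hnorm i != 0.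
Proof. by rewrite /hnorm; case: ty; case: i. Qed.

Lemma srefl_tr (i : I) : (s i)^T = s i.
Proof.
apply: (intmx_scaleI (hnorm_neq0 i)); rewrite -linearZ /= srefl_rank1.
rewrite scalerBr scalemxAr -coroot_sroot linearB /= trmx_mul trmxK.
by rewrite linearZ /= trmx1.
Qed.

(** Read off from [s a = - a] and the rank one form of [s]; the root is nonzero
    because its height is positive. *)
Lemma coroot_sroot2 (i : I) : (coroot i *m sroot i) 0 0 = 2.
Proof.
set x := (_ *m _) 0 0.
have exj j : (2 - x) * sroot i j 0 = 0.
  have := congr1 (fun v : 'cV[int]_n => v j 0) (srefl_sroot i).
  rewrite srefl_rank1 mulmxBl mul1mx -mulmxA [coroot i *m _]mx11_scalar.
  rewrite mul_mx_scalar -/x.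
  move: (sroot i) => a; rewrite !mxE => e.
  by rewrite mulrBl mulr_natl mulr2n -addrA e addrN.
apply/eqP/negPn/negP => x2; have := posroot_height (posroot_simple i).
rewrite /height big1 // => j _; have /eqP := exj j.
by rewrite mulf_eq0 subr_eq0 eq_sym (negbTE x2) => /eqP ->; rewrite mulr0.
Qed.

Lemma sroot_norm (i : I) : ((sroot i)^T *m sroot i) 0 0 = 2 * hnorm i.
Proof. by rewrite coroot_sroot -scalemxAl mxE coroot_sroot2 mulrC. Qed.

End Roots.

(** * Exchange condition and Matsumoto's theorem *)

Lemma mul_exp_swap (A : pzRingType) (x y : A) k : x * (y * x) ^+ k = (x * y) ^+ k * x.
Proof.
elim: k => [|k IH]; first by rewrite !expr0 mulr1 mul1r.
by rewrite exprSr mulrA IH [in RHS]exprSr !mulrA.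
Qed.

Section Words.
Variables (ty : chevalley_type) (n : nat).
Hypothesis n_ge2 : (2 <= n)%N.

Local Notation I := 'I_(nroots ty n).
Local Notation s_ := (srefl ty n).
Local Notation W := (@wprod ty n).
Local Notation alpha := (sroot ty n).
Local Notation posroot := (posroot ty (n := n)).
Local Notation reduced := (@reduced_word ty n).
Implicit Types (i j : I) (s t u : seq I) (b : 'cV[int]_n).

Lemma wprod_nil : W [::] = 1%:M. Proof. exact: big_nil. Qed.

Lemma wprod_cons i s : W (i :: s) = s_ i *m W s.
Proof. exact: big_cons. Qed.

Lemma wprod1 i : W [:: i] = s_ i.
Proof. by rewrite wprod_cons wprod_nil mulmx1. Qed.

Lemma wprod_cat s t : W (s ++ t) = W s *m W t.
Proof.
elim: s => [|i s IH]; first by rewrite wprod_nil mul1mx.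
by rewrite cat_cons !wprod_cons IH mulmxA.
Qed.

Lemma wprod_rev s : W (rev s) = (W s)^T.
Proof.
elim: s => [|i s IH]; first by rewrite wprod_nil trmx1.
by rewrite rev_cons -cats1 wprod_cat wprod1 wprod_cons trmx_mul srefl_tr // IH.
Qed.

Lemma wprodV s : W s *m W (rev s) = 1%:M.
Proof.
elim: s => [|i s IH]; first by rewrite wprod_nil mul1mx.
rewrite rev_cons -cats1 wprod_cat wprod1 wprod_cons.
by rewrite -mulmxA [W s *m _]mulmxA IH mul1mx srefl_sq.
Qed.

Lemma wprodVr s : W (rev s) *m W s = 1%:M.
Proof. by rewrite -{2}[s]revK wprodV. Qed.

Lemma wprod_inj s p (x y : 'M_(n, p)) : W s *m x = W s *m y -> x = y.
Proof. by move=> /(congr1 (mulmx (W (rev s)))); rewrite !mulmxA wprodVr !mul1mx. Qed.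

Definition isroot b := exists t i, b = W t *m alpha i.

Lemma isroot_simple i : isroot (alpha i).
Proof. by exists [::], i; rewrite wprod_nil mul1mx. Qed.

Lemma isroot_wprod s b : isroot b -> isroot (W s *m b).
Proof. by case=> t [i ->]; exists (s ++ t), i; rewrite wprod_cat mulmxA. Qed.

Lemma isroot_srefl i b : isroot b -> isroot (s_ i *m b).
Proof. by move=> /(isroot_wprod [:: i]); rewrite wprod1. Qed.

Lemma isrootN b : isroot b -> isroot (- b).
Proof.
case=> t [i ->]; exists (t ++ [:: i]), i.
by rewrite wprod_cat wprod1 -mulmxA srefl_sroot // mulmxN.
Qed.

Lemma posroot_srefl_or i b : posroot b -> posroot (s_ i *m b) \/ b = alpha i.
Proof.
by move=> b0; have [->|ne] := eqVneq b (alpha i); [right|left; exact: posroot_srefl].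
Qed.

Lemma isroot_sign b : isroot b -> posroot b \/ posroot (- b).
Proof.
case=> t [i ->]; elim: t => [|j t IH].
  by left; rewrite wprod_nil mul1mx; apply: posroot_simple.
rewrite wprod_cons -mulmxA; case: IH => pos.
  case: (posroot_srefl_or j pos) => [|->]; first by left.
  by right; rewrite srefl_sroot // opprK; apply: posroot_simple.
case: (posroot_srefl_or j pos) => [|e]; first by rewrite mulmxN; right.
left; rewrite -[W t *m _]opprK e mulmxN srefl_sroot // opprK.
exact: posroot_simple.
Qed.

(** Words act by orthogonal matrices, so a conjugate of a simple reflection is
    again [1] minus a rank one matrix built from the image of the root.  It
    depends on this image up to sign only, whence [root_refl]. *)
Lemma conj_srefl t i :
  hnorm ty i *: (W t *m s_ i *m W (rev t)) =
  hnorm ty i *: 1%:M - (W t *m alpha i) *m (W t *m alpha i)^T.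
Proof.
rewrite srefl_rank1 // mulmxBr mulmx1 mulmxBl wprodV scalerBr; congr (_ - _).
rewrite trmx_mul -wprod_rev coroot_sroot // -!mulmxA.
by rewrite -scalemxAl !scalemxAr.
Qed.

Lemma wprod_norm t i :
  ((W t *m alpha i)^T *m (W t *m alpha i)) 0 0 = 2 * hnorm ty i.
Proof. by rewrite trmx_mul -wprod_rev -mulmxA [W (rev t) *m _]mulmxA wprodVr mul1mx sroot_norm. Qed.

Lemma root_hnorm t i u j :
  W t *m alpha i = W u *m alpha j \/ W t *m alpha i = - (W u *m alpha j) ->
  hnorm ty i = hnorm ty j.
Proof.
move=> e; suff : 2 * hnorm ty i = 2 * hnorm ty j by lia.
rewrite -(wprod_norm t) -(wprod_norm u).
by case: e => ->; rewrite // [(- _)^T]linearN /= mulNmx mulmxN opprK.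
Qed.

(** A reflection is determined by its root up to sign. *)
Lemma root_refl t i u j :
  W t *m alpha i = W u *m alpha j \/ W t *m alpha i = - (W u *m alpha j) ->
  W t *m s_ i *m W (rev t) = W u *m s_ j *m W (rev u).
Proof.
move=> e; have h := root_hnorm e.
apply: (intmx_scaleI (hnorm_neq0 ty i)); rewrite {2}h !conj_srefl h.
by case: e => ->; rewrite // [(- _)^T]linearN /= mulNmx mulmxN opprK.
Qed.

(** Following the images of [b] under the successive letters, the sign changes
    at some letter; a simple reflection changes the sign of its own root
    only, which identifies [b] at that point. *)
Lemma descent s b : posroot b -> posroot (- (W (rev s) *m b)) ->
  exists s1 i s2, s = s1 ++ i :: s2 /\ b = W s1 *m alpha i.
Proof.
elim: s b => [|i s IH] b pos neg.
  by case: (posrootN pos); rewrite wprod_nil mul1mx in neg.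
case: (posroot_srefl_or i pos) => [pos'|->]; last first.
  by exists [::], i, s; rewrite wprod_nil mul1mx.
have [|s1 [j [s2 [-> e]]]] := IH _ pos'.
  by move: neg; rewrite rev_cons -cats1 wprod_cat wprod1 -mulmxA.
exists (i :: s1), j, s2; split=> //.
by rewrite wprod_cons -mulmxA -e mulmxA srefl_sq // mul1mx.
Qed.

(** Multiplying by the reflection of an inversion deletes a letter. *)
Lemma wprod_del t j s1 i s2 : W t *m alpha j = W s1 *m alpha i ->
  W (t ++ j :: rev t) *m W (s1 ++ i :: s2) = W (s1 ++ s2).
Proof.
move=> e; rewrite !wprod_cat !wprod_cons !mulmxA (root_refl (or_introl e)).
rewrite -!mulmxA [W (rev s1) *m _]mulmxA wprodVr mul1mx [s_ i *m _]mulmxA.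
by rewrite srefl_sq // mul1mx.
Qed.

Lemma reduced_exists s : exists t, reduced t /\ W t = W s.
Proof.
have ex : exists k, `[< exists t, W t = W s /\ size t = k >].
  by exists (size s); apply/asboolP; exists s.
case: (ex_minnP ex) => k /asboolP[t [et st]] kmin.
exists t; split=> // t' et'; rewrite st; apply: kmin; apply/asboolP.
by exists t'; rewrite et' et.
Qed.

Lemma reduced_size s t : reduced s -> reduced t -> W s = W t -> size s = size t.
Proof.
move=> rs rt e; apply/eqP; rewrite eqn_leq.
by rewrite (rs t) ?(rt s) // e.
Qed.

Lemma reduced_le s t : reduced s -> W t = W s -> (size t <= size s)%N -> reduced t.
Proof. by move=> rs e le u eu; apply: leq_trans le _; apply: rs; rewrite eu. Qed.

Lemma reduced_catl s t : reduced (s ++ t) -> reduced s.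
Proof.
move=> r u e; have := r (u ++ t).
by rewrite !size_cat leq_add2r !wprod_cat e => ->.
Qed.

Lemma reduced_catr s t : reduced (s ++ t) -> reduced t.
Proof.
move=> r u e; have := r (s ++ u).
by rewrite !size_cat leq_add2l !wprod_cat e => ->.
Qed.

(** If [b] is not an inversion of [s], it becomes one after multiplication by its
    reflection, and [wprod_del] applied to the longer element shows that [s] was
    shorter. *)
Lemma asc_length s t j : reduced s ->
  let b := W t *m alpha j in posroot b -> posroot (W (rev s) *m b) ->
  exists s', [/\ reduced s', W s' = W (t ++ j :: rev t) *m W s & (size s < size s')%N].
Proof.
move=> rs b pos pos'.
have [s' [rs' es']] := reduced_exists ((t ++ j :: rev t) ++ s).
rewrite wprod_cat in es'; exists s'; split=> //.
have sq : W (t ++ j :: rev t) *m W (t ++ j :: rev t) = 1%:M.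
  rewrite {2}(_ : W _ = W (rev (t ++ j :: rev t))) ?wprodV //.
  by rewrite rev_cat rev_cons revK -cats1 -catA.
have neg : W (t ++ j :: rev t) *m b = - b.
  rewrite wprod_cat wprod_cons -!mulmxA (mulmxA (W (rev t))) wprodVr mul1mx.
  by rewrite srefl_sroot // mulmxN.
have [|s1 [i [s2 [e1 e2]]]] := @descent s' b pos.
  rewrite wprod_rev es' trmx_mul -!wprod_rev.
  rewrite (_ : rev (t ++ j :: rev t) = t ++ j :: rev t); last first.
    by rewrite rev_cat rev_cons revK -cats1 -catA.
  by rewrite -mulmxA neg mulmxN opprK.
have e3 := wprod_del s2 e2.
have : W (s1 ++ s2) = W s by rewrite -e3 -e1 es' mulmxA sq mul1mx.
by move/rs; rewrite e1 !size_cat /= addnS ltnS.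
Qed.

Lemma srefl_neq1 (i : I) : s_ i != 1%:M.
Proof.
apply/eqP => e; have := srefl_sroot n_ge2 i; rewrite e mul1mx => e'.
by have := posrootN (posroot_simple n_ge2 i); rewrite -e'; case; apply: posroot_simple.
Qed.

Lemma reduced1 i : reduced [:: i].
Proof.
move=> [|//]; rewrite wprod1 wprod_nil => /esym/eqP.
by rewrite (negbTE (srefl_neq1 i)).
Qed.


Lemma reduced_last s i : reduced (rcons s i) -> posroot (W s *m alpha i).
Proof.
move=> r; case: (isroot_sign (isroot_wprod s (isroot_simple i))) => // neg.
have [|s1 [k [s2 [e1 e2]]]] := @descent (rev s) (alpha i) (posroot_simple n_ge2 i).
  by rewrite revK.
have := @wprod_del [::] i s1 k s2; rewrite wprod_nil mul1mx -e1 => /(_ e2).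
rewrite -wprod_cat /= -[i :: rev s]rev_rcons wprod_rev => e3.
have : W (rev (s1 ++ s2)) = W (rcons s i) by rewrite wprod_rev -e3 trmxK.
move/r; rewrite size_rev size_rcons -[size s]size_rev e1 !size_cat /= addnS.
by rewrite ltnNge leqnSn.
Qed.

(** The exchange condition, in the case where the element already has a reduced
    word starting with [i]. *)
Lemma exchange s i u : reduced s -> reduced (i :: u) -> W s = W (i :: u) ->
  exists s1 k s2, s = s1 ++ k :: s2 /\ W (i :: s1 ++ s2) = W s.
Proof.
move=> rs ru e.
have neg : posroot (- (W (rev s) *m alpha i)).
  rewrite wprod_rev e -wprod_rev rev_cons -cats1 wprod_cat wprod1 -mulmxA.
  rewrite srefl_sroot // mulmxN opprK.
  case: (isroot_sign (isroot_wprod (rev u) (isroot_simple i))) => // neg.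
  have [s1 [k [s2 [e1 e2]]]] := descent (posroot_simple n_ge2 i) neg.
  have := @wprod_del [::] i s1 k s2; rewrite wprod_nil mul1mx -e1 => /(_ e2).
  rewrite -wprod_cat /= => /esym /ru.
  by rewrite e1 /= !size_cat /= addnS ltnNge leqnSn.
have [s1 [k [s2 [e1 e2]]]] := descent (posroot_simple n_ge2 i) neg.
exists s1, k, s2; split=> //.
have := @wprod_del [::] i s1 k s2; rewrite wprod_nil mul1mx -e1 => /(_ e2).
rewrite -wprod_cat /= => e3.
by rewrite wprod_cons -e3 wprod_cons mulmxA srefl_sq // mul1mx.
Qed.

Fixpoint alt (i j : I) (k : nat) : seq I :=
  if k is k'.+1 then i :: alt j i k' else [::].

Lemma size_alt i j k : size (alt i j k) = k.
Proof. by elim: k i j => //= k IH i j; rewrite IH. Qed.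

Lemma take_alt i j p k : (p <= k)%N -> take p (alt i j k) = alt i j p.
Proof. by elim: k p i j => [|k IH] [|p] i j //= le; rewrite IH. Qed.

Lemma wprod_alt i j k :
  W (alt i j k) = (s_ i *m s_ j) ^+ k *m W (alt j i k).
Proof.
elim: k i j => [|k IH] i j; first by rewrite expr0 mul1mx.
rewrite /= !wprod_cons exprSr -!mulmxA (mulmxA (s_ j)) srefl_sq // mul1mx.
rewrite (IH j i) !mulmxA; congr (_ *m _).
exact: (mul_exp_swap (s_ i : 'M[int]_n)).
Qed.

(** Two equal reduced alternating words have the length prescribed by the order
    of the product of the two reflections: a smaller order would shorten the
    alternating word. *)
Lemma braid_order i j k : (0 < k)%N -> reduced (alt i j k) ->
  W (alt i j k) = W (alt j i k) -> mx_order (s_ i *m s_ j) k.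
Proof.
move=> k0 r e.
have eq1 p : (s_ i *m s_ j) ^+ p = 1 -> W (alt i j p) = W (alt j i p).
  by rewrite wprod_alt => ->; rewrite mul1mx.
split=> //.
  have := wprod_alt i j k; rewrite e => e'.
  have := congr1 (mulmx^~ (W (rev (alt j i k)))) e'.
  by rewrite /= -mulmxA wprodV mulmx1 => <-.
case=> [//|p] /andP[_ lt]; apply/eqP => /eq1 /esym ep.
have : reduced (alt i j p.+2).
  by apply: (@reduced_catl _ (drop p.+2 (alt i j k))); rewrite -(take_alt i j lt) cat_take_drop.
move/(_ (alt j i p)); rewrite !size_alt => h.
suff /h : W (alt j i p) = W (alt i j p.+2) by rewrite ltnNge leqnSn.
rewrite [alt i j p.+2]/= wprod_cons -/(alt j i p.+1) ep [alt i j p.+1]/= wprod_cons.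
by rewrite mulmxA srefl_sq // mul1mx.
Qed.

Section Matsumoto.
Variables (A : pzRingType) (x : I -> A).
Hypothesis braid : forall i j m, mx_order (s_ i *m s_ j) m ->
  \prod_(k < m) (if odd k then x j else x i) =
  \prod_(k < m) (if odd k then x i else x j).

Definition xprod s : A := \prod_(i <- s) x i.

Lemma xprod_cons i s : xprod (i :: s) = x i * xprod s.
Proof. exact: big_cons. Qed.

Lemma xprod_nil : xprod [::] = 1.
Proof. exact: big_nil. Qed.

Lemma xprod1 i : xprod [:: i] = x i.
Proof. exact: big_seq1. Qed.

Lemma xprod_cat s t : xprod (s ++ t) = xprod s * xprod t.
Proof. exact: big_cat. Qed.

Lemma xprod_alt i j k :
  xprod (alt i j k) = \prod_(p < k) (if odd p then x j else x i).
Proof.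
elim: k i j => [|k IH] i j; first by rewrite /xprod big_nil big_ord0.
rewrite /= xprod_cons IH big_ord_recl /=; congr (_ * _).
by apply: eq_bigr => p _; rewrite /bump /=; case: odd.
Qed.

(** Tits' argument, by induction on the length.  Two reduced words with a common
    first or last letter agree by induction.  Otherwise the exchange condition
    replaces one of the two words by one with a longer alternating beginning
    in the two first letters, unless it produces a word that has its first
    letter in common with one and its last letter in common with the other.
    In the end both words are alternating, and the braid relation applies. *)
Lemma matsumoto s t : reduced s -> reduced t -> W s = W t -> xprod s = xprod t.
Proof.
move: {2}(size s) (leqnn (size s)) => m.
elim: m s t => [|m IH] s t.
  by case: s => // _ rs rt e; have := rt _ e; case: t {rt e}.
move=> szs rs rt e; have sz := reduced_size rs rt e.
have {}sz : size s = m.+1 -> size t = m.+1 by rewrite sz.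
have [lt|gt|szE] := ltngtP (size s) m.+1; [exact: IH| by rewrite leqNgt gt in szs|].
have samehead a u v : (size u <= m)%N -> reduced (a :: u) -> reduced (a :: v) ->
    W (a :: u) = W (a :: v) -> xprod (a :: u) = xprod (a :: v).
  move=> le ru rv; rewrite !xprod_cons !wprod_cons -wprod1 => /wprod_inj ee.
  congr (_ * _); apply: IH => //; first exact: (@reduced_catr [:: a] u).
  exact: (@reduced_catr [:: a] v).
have samelast a u v : (size u <= m)%N -> reduced (rcons u a) -> reduced (rcons v a) ->
    W (rcons u a) = W (rcons v a) -> xprod (rcons u a) = xprod (rcons v a).
  rewrite -!cats1 => le ru rv; rewrite !xprod_cat !wprod_cat !wprod1 => ee.
  congr (_ * _); apply: IH => //; [exact: reduced_catl ru|exact: reduced_catl rv|].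
  by have := congr1 (mulmx^~ (s_ a)) ee; rewrite /= -!mulmxA srefl_sq // !mulmx1.
case: (pselect (xprod s = xprod t)) => // ne; exfalso.
have step u (b : I) v' : reduced u -> reduced (b :: v') -> W u = W (b :: v') ->
    xprod u <> xprod (b :: v') -> size u = m.+1 ->
  [/\ reduced (b :: take m u), W (b :: take m u) = W u &
      xprod (b :: take m u) = xprod (b :: v')].
  move=> ru rv ee nee szu.
  have [s1 [k [s2 [e1 e2]]]] := exchange ru rv ee.
  have r' : reduced (b :: s1 ++ s2).
    by apply: (reduced_le ru e2); rewrite e1 /= !size_cat /= addnS.
  have szv : (size v' <= m)%N.
    by have /= := reduced_size ru rv ee; rewrite szu => -[<-].
  have xe : xprod (b :: s1 ++ s2) = xprod (b :: v').
    apply: samehead => //; last by rewrite e2.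
    by move: szu; rewrite e1 !size_cat /= addnS => -[<-].
  case/lastP: s2 e1 e2 r' xe => [|s2 l] e1 e2 r' xe.
    rewrite cats0 in e2 r' xe; have sz1 : size s1 = m.
      by move: szu; rewrite e1 size_cat addn1 => -[].
    have -> : take m u = s1 by rewrite e1 take_size_cat.
    by split.
  case: nee; rewrite -xe e1 -rcons_cons -!rcons_cat -rcons_cons.
  apply: samelast.
  - by move: szu; rewrite e1 -rcons_cons -rcons_cat size_rcons => -[->].
  - by rewrite rcons_cat rcons_cons -e1.
  - by rewrite rcons_cons rcons_cat.
  by rewrite rcons_cat rcons_cons -e1 rcons_cons rcons_cat e2.
(* After p steps the first word begins with p + 1 alternating letters. *)
have inv p : (p <= m)%N -> exists (a b : I) u v', [/\ reduced u /\ reduced (b :: v'),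
    W u = W s, W (b :: v') = W s, xprod u <> xprod (b :: v') &
    take p.+1 u = alt a b p.+1].
  elim: p => [|p IHp] le.
    case: s t rs rt e szE sz ne {szs} => [|a s] [|b t] rs rt e szE sz ne //; first by have := sz szE.
    by exists a, b, (a :: s), t; split=> //; rewrite /= take0.
  have [a [b [u [v' [[ru rv] eu ev nee tk]]]]] := IHp (ltnW le).
  have szu : size u = m.+1 by rewrite (reduced_size ru rs).
  have [|r' e' xe] := step u b v' ru rv _ nee szu; first by rewrite eu.
  case: u ru eu nee tk szu r' e' xe => [//|a' u] ru eu nee [ea tk] szu r' e' xe.
  exists b, a', (b :: take m (a' :: u)), u; split=> //.
  - by rewrite e'.
  - by rewrite xe => /esym.
  rewrite -ea in tk *.
  case: m le szu {IH szs sz szE samehead samelast step IHp r' e' xe} => // m le szu.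
  rewrite [RHS]/= -tk /= take_takel //.
have [a [b [u [v' [[ru rv] eu ev nee tk]]]]] := inv m (leqnn m).
have szu : size u = m.+1 by rewrite (reduced_size ru rs).
rewrite take_oversize ?szu // in tk.
have [|r' e' xe] := step u b v' ru rv _ nee szu; first by rewrite eu.
have tk' : take m u = alt a b m by rewrite tk take_alt.
case: nee; rewrite -xe tk' tk -/(alt b a m.+1) !xprod_alt.
apply: braid; apply: braid_order => //; first by rewrite -tk.
by rewrite -tk -e' tk'.
Qed.
End Matsumoto.

End Words.

(** * The longest element and sums over all reflections *)

Section SignedPerm.
Variable n : nat.

Lemma signed_perm_mxE (eps : 'I_n -> bool) (p : 'S_n) a b :
  signed_perm_mx eps p a b = (-1) ^+ eps a * (p a == b)%:R.
Proof. by rewrite /signed_perm_mx mul_diag_mx !mxE. Qed.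

Lemma signed_perm_mxM (eps eps' : 'I_n -> bool) (p p' : 'S_n) :
  signed_perm_mx eps p *m signed_perm_mx eps' p' =
  signed_perm_mx (fun j => eps j (+) eps' (p j)) (p * p')%g.
Proof.
apply/matrixP=> a b; rewrite mxE (bigD1 (p a)) //= !signed_perm_mxE eqxx mulr1 big1 => [|c ca].
  by rewrite addr0 permM mulrA signr_addb.
by rewrite signed_perm_mxE eq_sym (negbTE ca) mulr0 mul0r.
Qed.

Lemma odd_card_addb (eps : 'I_n -> bool) :
  odd #|[set j | eps j]| = \big[addb/false]_j eps j.
Proof.
rewrite -sum1dep_card big_mkcond /= (big_morph odd oddD erefl).
by apply: eq_bigr => j _; case: (eps j).
Qed.

(** Parity of the number of signs is additive, so that the even signed
    permutations of type D form a group. *)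
Lemma odd_signed_perm_mul (eps eps' : 'I_n -> bool) (p : 'S_n) :
  odd #|[set j | eps j (+) eps' (p j)]| =
  odd #|[set j | eps j]| (+) odd #|[set j | eps' j]|.
Proof.
rewrite !odd_card_addb big_split /=; congr (_ (+) _).
by rewrite [RHS](reindex_inj (@perm_inj _ p)).
Qed.

Lemma signed_perm_id : signed_perm_mx (fun _ : 'I_n => false) 1%g = 1%:M.
Proof.
by apply/matrixP=> a b; rewrite signed_perm_mxE perm1 mul1r !mxE.
Qed.

Lemma perm_signed_perm (p : 'S_n) : perm_mx p = signed_perm_mx (fun _ => false) p.
Proof. by apply/matrixP=> a b; rewrite signed_perm_mxE mul1r !mxE. Qed.

Lemma neg1mx_signed_perm :
  neg1mx n = signed_perm_mx (fun j => j == 0%N :> nat) 1%g.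
Proof.
apply/matrixP=> a b; rewrite signed_perm_mxE perm1 !mxE.
by case: (nat_of_ord a == 0%N); case: (a == b); rewrite ?mulr1n ?mulr0n ?expr1 ?expr0 ?mulr1 ?mulr0.
Qed.
End SignedPerm.

Section Longest.
Variables (ty : chevalley_type) (n : nat).
Hypothesis n_ge2 : (2 <= n)%N.

Local Notation I := 'I_(nroots ty n).
Local Notation s_ := (srefl ty n).
Local Notation W := (@wprod ty n).
Local Notation alpha := (sroot ty n).
Local Notation posroot := (posroot ty (n := n)).
Local Notation reduced := (@reduced_word ty n).
Local Notation isroot := (@isroot ty n).
Implicit Types (i j : I) (s t u : seq I) (b : 'cV[int]_n).

Lemma srefl_weyl i (M : 'M[int]_n) : weyl ty M -> weyl ty (s_ i *m M).
Proof.
have adj k : (k.+1 < n)%N -> exists p : 'S_n, adjmx n k = perm_mx p.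
  by move=> lt2; rewrite (adjmx_perm (ltnW lt2) lt2); eexists.
case: i => i; rewrite /weyl /srefl; case: ty => /= lti.
- have [|p ->] := adj i; first by lia.
  by case=> q ->; exists (p * q)%g; rewrite perm_mxM.
- have [|p ->] := adj i; first by lia.
  by case=> q ->; exists (p * q)%g; rewrite perm_mxM.
- case=> eps [q ->]; case: i lti => [|k] lti; last have [|p ->] := adj k; first last.
  + by rewrite perm_signed_perm signed_perm_mxM; do 2!eexists.
  + by [].
  by rewrite neg1mx_signed_perm signed_perm_mxM; do 2!eexists.
- case=> eps [q ->]; case: i lti => [|k] lti; last have [|p ->] := adj k; first last.
  + by rewrite perm_signed_perm signed_perm_mxM; do 2!eexists.
  + by [].
  by rewrite neg1mx_signed_perm signed_perm_mxM; do 2!eexists.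
case=> eps [q [ev ->]]; case: i lti => [|k] lti; last first.
  have [|p ->] := adj k; first by [].
  rewrite perm_signed_perm signed_perm_mxM; do 2!eexists; split; last by [].
  by rewrite odd_signed_perm_mul negb_add (negbTE ev) odd_card_addb big1.
have [|p ->] := adj 0%N; first by [].
rewrite perm_signed_perm neg1mx_signed_perm !signed_perm_mxM.
do 2!eexists; split; last by [].
rewrite odd_signed_perm_mul (negbTE ev) addbF.
have := odd_signed_perm_mul (fun a : 'I_n => (a == 0%N :> nat) (+) false)
  (fun a : 'I_n => a == 0%N :> nat) (1 * p)%g.
cbv beta => ->.
have -> : [set j : 'I_n | (j == 0%N :> nat) (+) false] = [set j : 'I_n | j == 0%N :> nat].
  by apply/setP => j; rewrite !inE addbF.
by rewrite addbb.
Qed.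

Lemma weyl_wprod s : weyl ty (W s).
Proof.
elim: s => [|i s IH]; last by rewrite wprod_cons; apply: srefl_weyl.
rewrite wprod_nil /weyl; case: ty.
- by exists 1%g; rewrite perm_mx1.
- by exists 1%g; rewrite perm_mx1.
- by exists (fun=> false), 1%g; rewrite signed_perm_id.
- by exists (fun=> false), 1%g; rewrite signed_perm_id.
- by exists (fun=> false), 1%g; rewrite signed_perm_id odd_card_addb big1.
Qed.

(** Maximal length among all reduced words; this is the form in which the
    hypothesis on [w0] is used. *)
Definition is_longest s :=
  reduced s /\ forall t, reduced t -> (size t <= size s)%N.

Lemma longest_wordP s : longest_word s -> is_longest s.
Proof.
case=> _ rs lg; split=> // t rt.
have [t' [et le]] := lg _ (weyl_wprod t).
exact: leq_trans (rt _ et) le.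
Qed.

Lemma reduced_rev s : reduced s -> reduced (rev s).
Proof.
move=> rs t e; rewrite size_rev -(size_rev t); apply: rs.
by rewrite wprod_rev // e wprod_rev // trmxK.
Qed.

Lemma is_longest_rev s : is_longest s -> is_longest (rev s).
Proof.
by case=> rs lg; split=> [|t rt]; rewrite ?size_rev; [exact: reduced_rev|exact: lg].
Qed.

(** Otherwise the reflection of [b] would give a longer element. *)
Lemma longest_neg_rev s b : is_longest s -> isroot b -> posroot b ->
  posroot (- (W (rev s) *m b)).
Proof.
case=> rs lg [t [j e]] pos.
have [] // := isroot_sign n_ge2 (isroot_wprod (rev s) (ex_intro _ t (ex_intro _ j e))).
move=> pos'; exfalso.
have [||s' [rs' es']] := @asc_length _ _ n_ge2 s t j rs.
- by rewrite -e.
- by rewrite -e.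
by rewrite ltnNge lg.
Qed.

Lemma longest_neg s b : is_longest s -> isroot b -> posroot b -> posroot (- (W s *m b)).
Proof. by move=> /is_longest_rev/longest_neg_rev; rewrite revK; apply. Qed.

(** The last letter of a reduced word sends its own simple root to a negative
    root. *)
Lemma wprod_pos_eq1 s : (forall b, isroot b -> posroot b -> posroot (W s *m b)) -> W s = 1%:M.
Proof.
have [t [rt <-]] := reduced_exists s => pos.
case/lastP: t rt pos => [|t i] rt pos; first exact: wprod_nil.
have := pos _ (isroot_simple i) (posroot_simple n_ge2 i).
rewrite -cats1 wprod_cat wprod1 -mulmxA srefl_sroot // mulmxN.
by move/(posrootN (reduced_last n_ge2 rt)).
Qed.

Lemma longest_invol s : is_longest s -> W s *m W s = 1%:M.
Proof.
move=> lg; rewrite -wprod_cat; apply: wprod_pos_eq1 => b rb pb.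
rewrite wprod_cat -mulmxA -[X in posroot X]opprK -mulmxN -mulmxN.
rewrite mulmxN; apply: longest_neg => //.
  by rewrite -mulmxN; apply/isroot_wprod/isrootN.
exact: longest_neg.
Qed.

(** The reflection [w0^-1 s_i w0] makes exactly one positive root negative, namely
    [- w0^-1 a_i].  The last letter of a reduced word of this reflection is
    therefore the simple root that [- w0] sends to [a_i]. *)
Lemma longest_star s i : is_longest s -> exists j, W s *m alpha j = - alpha i.
Proof.
move=> lg; have [t [rt et]] := reduced_exists (rev s ++ i :: s).
case/lastP: t rt et => [|t j] rt et.
  move: et; rewrite wprod_nil wprod_cat wprod_cons mulmxA => e.
  have := congr1 (fun M => W s *m M *m W (rev s)) e.
  rewrite /= mulmx1 -!mulmxA !wprodV // mulmx1 mulmxA wprodV // mul1mx.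
  by move/esym/eqP; rewrite (negbTE (srefl_neq1 n_ge2 i)).
exists j; (* The root of the last letter j is made negative by the reflection. *)
have neg : posroot (- (W (rcons t j) *m alpha j)).
  rewrite -cats1 wprod_cat wprod1 -mulmxA srefl_sroot // mulmxN opprK.
  exact: (reduced_last n_ge2).
have pc := longest_neg lg (isroot_simple j) (posroot_simple n_ge2 j).
have [pos'|<-] := posroot_srefl_or n_ge2 i pc; last by rewrite opprK.
have rc : isroot (s_ i *m - (W s *m alpha j)).
  by apply: isroot_srefl; apply: (isrootN n_ge2); apply: isroot_wprod; apply: isroot_simple.
have := longest_neg_rev lg rc pos'; rewrite !mulmxN opprK.
rewrite et wprod_cat wprod_cons -!mulmxA in neg.
move/posrootN. case; exact: neg.
Qed.

Section Values.
Variables (A : pzRingType) (x : I -> A).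
Hypothesis braid : forall i j m, mx_order (s_ i *m s_ j) m ->
  \prod_(k < m) (if odd k then x j else x i) =
  \prod_(k < m) (if odd k then x i else x j).
Local Notation xp := (xprod x).

Lemma longest_head s i : is_longest s ->
  exists u, [/\ reduced (i :: u), W (i :: u) = W s & size (i :: u) = size s].
Proof.
move=> lg; have neg := longest_neg_rev lg (isroot_simple i) (posroot_simple n_ge2 i).
have [s1 [k [s2 [e1 e2]]]] := descent n_ge2 (posroot_simple n_ge2 i) neg.
have := @wprod_del _ _ n_ge2 [::] i s1 k s2; rewrite wprod_nil mul1mx -e1 => /(_ e2).
rewrite -wprod_cat /= => e3.
have e4 : W (i :: s1 ++ s2) = W s.
  by rewrite wprod_cons -e3 wprod_cons mulmxA srefl_sq // mul1mx.
have sz : size (i :: s1 ++ s2) = size s by rewrite e1 /= !size_cat /= addnS.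
by exists (s1 ++ s2); split => //; apply: (reduced_le lg.1 e4); rewrite sz.
Qed.

(** Both [i :: u] and [rcons u j] are reduced words of the longest element, so
    they have the same value. *)
Lemma longest_swap s i j : is_longest s -> W s *m alpha j = - alpha i ->
  x i * xp s = xp s * x j.
Proof.
move=> lg ej; have [u [ru eu szu]] := longest_head i lg.
have eV : W s *m s_ j *m W (rev s) = s_ i.
  have -> := @root_refl _ _ n_ge2 s j [::] i; last by right; rewrite wprod_nil mul1mx.
  by rewrite wprod_nil mul1mx mulmx1.
have e : W (rcons u j) = W s.
  rewrite -cats1 wprod_cat wprod1.
  have -> : W u = s_ i *m W s by rewrite -eu wprod_cons mulmxA srefl_sq // mul1mx.
  by rewrite -eV -!mulmxA (mulmxA (W (rev s))) wprodVr // mul1mx (srefl_sq n_ge2 j) mulmx1.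
have r' : reduced (rcons u j).
  by apply: (reduced_le lg.1 e); rewrite size_rcons -szu.
have M := matsumoto n_ge2 braid.
rewrite -{1}(M _ _ r' lg.1 e) -(M _ _ ru lg.1 eu).
by rewrite -cats1 xprod_cat xprod1 xprod_cons mulrA.
Qed.

Lemma longest_sq_central s i : is_longest s -> GRing.comm (x i) (xp s * xp s).
Proof.
move=> lg; have [j ej] := longest_star i lg; have [k ek] := longest_star j lg.
have ea : alpha k = alpha i.
  have := congr1 (mulmx^~ (alpha k)) (longest_invol lg).
  by rewrite /= mul1mx -mulmxA ek mulmxN ej opprK.
have eW : W [:: k] = W [:: i].
  have := @root_refl _ _ n_ge2 [::] k [::] i; rewrite wprod_nil !mul1mx.
  by rewrite ea !mulmx1 !wprod1 => -> //; left.
have := matsumoto n_ge2 braid (reduced1 n_ge2 (i := k)) (reduced1 n_ge2 (i := i)) eW.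
rewrite !xprod1 => ex.
by rewrite /GRing.comm mulrA (longest_swap lg ej) -!mulrA (longest_swap lg ek) ex.
Qed.


Section Involutions.
Hypothesis x_sq : forall i, x i * x i = 1.

(** If the generators also square to 1, every word can be shortened to a reduced
    one without changing its value: when a letter lowers the length, the rest
    of the word may be rewritten to start with the same letter. *)
Lemma xprod_reduce s : exists t, [/\ reduced t, W t = W s & xp t = xp s].
Proof.
elim: s => [|i s [t [rt et xt]]]; first by exists [::].
have [r|nr] := pselect (reduced (i :: t)).
  by exists (i :: t); rewrite !wprod_cons et !xprod_cons xt.
have neg : posroot (- (W (rev t) *m alpha i)).
  have [] // := isroot_sign n_ge2 (isroot_wprod (rev t) (isroot_simple i)).
  move=> pos; case: nr.
  have [||s' [rs' es' lt]] := @asc_length _ _ n_ge2 t [::] i rt.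
  - by rewrite wprod_nil mul1mx; apply: posroot_simple.
  - by rewrite wprod_nil mul1mx.
  by apply: (reduced_le rs') => //; rewrite es' -wprod_cat.
have [s1 [k [s2 [e1 e2]]]] := descent n_ge2 (posroot_simple n_ge2 i) neg.
have := @wprod_del _ _ n_ge2 [::] i s1 k s2; rewrite wprod_nil mul1mx -e1 => /(_ e2).
rewrite -wprod_cat /= => e3.
have e4 : W (i :: s1 ++ s2) = W t.
  by rewrite wprod_cons -e3 wprod_cons mulmxA srefl_sq // mul1mx.
have r4 : reduced (i :: s1 ++ s2).
  by apply: (reduced_le rt e4); rewrite e1 /= !size_cat /= addnS.
exists (s1 ++ s2); split.
- exact: (@reduced_catr _ _ [:: i]).
- by rewrite -e3 !wprod_cons et.
rewrite xprod_cons -xt -(matsumoto n_ge2 braid r4 rt e4) xprod_cons.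
by rewrite mulrA x_sq mul1r.
Qed.

Lemma xprod_wprod s t : W s = W t -> xp s = xp t.
Proof.
have [s' [rs es <-]] := xprod_reduce s; have [t' [rt et <-]] := xprod_reduce t.
by rewrite -es -et; apply: matsumoto.
Qed.

Lemma xprodV s : xp s * xp (rev s) = 1.
Proof.
by rewrite -xprod_cat -(xprod_nil x); apply: xprod_wprod; rewrite wprod_cat wprodV // wprod_nil.
Qed.

Variable D : I -> A.
Hypothesis D_conj : forall t i j,
  W t *m alpha i = alpha j \/ W t *m alpha i = - alpha j ->
  xp t * D i * xp (rev t) = D j.

Lemma D_root t i u j :
  W t *m alpha i = W u *m alpha j \/ W t *m alpha i = - (W u *m alpha j) ->
  xp t * D i * xp (rev t) = xp u * D j * xp (rev u).
Proof.
move=> e; rewrite -(@D_conj (rev u ++ t) i j); last first.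
  rewrite wprod_cat -mulmxA; case: e => ->; [left|right].
    by rewrite mulmxA wprodVr // mul1mx.
  by rewrite mulmxN mulmxA wprodVr // mul1mx.
rewrite rev_cat revK !xprod_cat !mulrA xprodV mul1r.
by rewrite -[_ * xp u * _]mulrA xprodV mulr1.
Qed.

(** The value attached to a root of the orbit, by transport from a simple root;
    [D_conj] makes it independent of the choice. *)
Definition Dval b : A :=
  if pselect (exists p : seq I * I, b = W p.1 *m alpha p.2) is left e then
    let p := projT1 (cid e) in xp p.1 * D p.2 * xp (rev p.1) else 0.

Lemma Dval_root t j : Dval (W t *m alpha j) = xp t * D j * xp (rev t).
Proof.
rewrite /Dval; case: pselect => [e|[]]; last by exists (t, j).
by case: (cid e) => p /= ep; apply: D_root; left.
Qed.

Lemma DvalN b : isroot b -> Dval (- b) = Dval b.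
Proof.
move=> rb; have [t' [j' e']] := isrootN n_ge2 rb; case: rb e' => t [j ->] e'.
by rewrite e' !Dval_root; apply: D_root; right; rewrite e'.
Qed.

Lemma Dval_srefl i b : isroot b -> Dval (s_ i *m b) = x i * Dval b * x i.
Proof.
case=> t [j ->]; rewrite mulmxA -wprod_cons !Dval_root rev_cons -cats1.
by rewrite xprod_cat xprod1 xprod_cons !mulrA.
Qed.

Fixpoint betas s : seq 'cV[int]_n :=
  if s is i :: s' then alpha i :: [seq s_ i *m b | b <- betas s'] else [::].

(** The sum over the letters of [s] of the conjugate of [D] by the preceding
    prefix; for a reduced word it is the sum over the inversions [betas s]
    ([DsumE]). *)
Fixpoint Dsum s : A :=
  if s is i :: s' then D i + x i * Dsum s' * x i else 0.

Lemma mem_betas s b : b \in betas s ->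
  exists s1 i s2, s = s1 ++ i :: s2 /\ b = W s1 *m alpha i.
Proof.
elim: s b => [//|i s IH] b; rewrite inE => /orP[/eqP->|/mapP[c /IH[s1 [k [s2 [-> ->]]]] ->]].
  by exists [::], i, s; rewrite wprod_nil mul1mx.
by exists (i :: s1), k, s2; rewrite wprod_cons mulmxA.
Qed.

Lemma betas_mem s1 i s2 : W s1 *m alpha i \in betas (s1 ++ i :: s2).
Proof.
elim: s1 => [|k s1 IH] /=; first by rewrite wprod_nil mul1mx mem_head.
by rewrite inE wprod_cons -mulmxA map_f // orbT.
Qed.

Lemma betas_root s b : b \in betas s -> isroot b.
Proof. by case/mem_betas => s1 [i [s2 [_ ->]]]; exists s1, i. Qed.

Lemma betas_pos s b : reduced s -> b \in betas s -> posroot b.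
Proof.
move=> rs /mem_betas[s1 [i [s2 [e ->]]]]; apply: reduced_last => //.
by apply: (@reduced_catl _ _ _ s2); rewrite cat_rcons -e.
Qed.

Lemma betas_uniq s : reduced s -> uniq (betas s).
Proof.
elim: s => [//|i s IH] rs /=; apply/andP; split; last first.
  rewrite map_inj_uniq; first by apply: IH; apply: (@reduced_catr _ _ [:: i]).
  by move=> b c; rewrite -wprod1; apply: wprod_inj.
apply/mapP => -[b /mem_betas[s1 [k [s2 [es ->]]]] e].
have := @wprod_del _ _ n_ge2 [::] i (i :: s1) k s2; rewrite wprod_nil mul1mx.
rewrite {1}wprod_cons -mulmxA -e => /(_ erefl).
rewrite cat_cons -es /= [W [:: i]]wprod1 wprod_cons mulmxA srefl_sq // mul1mx => e3.
have : W (s1 ++ s2) = W (i :: s).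
  by rewrite wprod_cons e3 wprod_cons mulmxA srefl_sq // mul1mx.
by move/rs; rewrite es /= !size_cat /= addnS ltnNge leqW.
Qed.

Lemma DsumE s : Dsum s = \sum_(b <- betas s) Dval b.
Proof.
elim: s => [|i s IH] /=; first by rewrite big_nil.
rewrite big_cons big_map IH mulr_sumr mulr_suml; congr (_ + _).
  by have := Dval_root [::] i; rewrite wprod_nil mul1mx xprod_nil mul1r mulr1.
rewrite big_seq [RHS]big_seq; apply: eq_bigr => b bs.
by rewrite Dval_srefl //; apply: betas_root bs.
Qed.

(** For the longest element the inversions are all the positive roots, which a
    reflection permutes up to sign; and the value [Dval] ignores signs. *)
Lemma Dsum_longest s i : is_longest s -> GRing.comm (x i) (Dsum s).
Proof.
(* The positive one of b and - b. *)
move=> lg; pose ab b := if `[< posroot b >] then b else - b.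
have absgn b : ab b = b \/ ab b = - b by rewrite /ab; case: asboolP; [left|right].
have abpos b : isroot b -> posroot (ab b).
  by move=> /(isroot_sign n_ge2)[p|p]; rewrite /ab; case: asboolP => // /(_ p).
have abroot b : isroot b -> isroot (ab b).
  by move=> rb; case: (absgn b) => ->; rewrite //; apply: isrootN.
have pe : perm_eq [seq ab (s_ i *m b) | b <- betas s] (betas s).
  have sub : {subset [seq ab (s_ i *m b) | b <- betas s] <= betas s}.
    move=> _ /mapP[b bs ->]; have rb := isroot_srefl i (betas_root bs).
    have neg := longest_neg_rev lg (abroot _ rb) (abpos _ rb).
    have [s1 [k [s2 [-> ->]]]] := descent n_ge2 (abpos _ rb) neg.
    exact: betas_mem.
  have un : uniq [seq ab (s_ i *m b) | b <- betas s].
    rewrite map_inj_in_uniq; first exact: (betas_uniq lg.1).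
    move=> b c bs cs e.
    have pb := betas_pos lg.1 bs; have pc := betas_pos lg.1 cs.
    have : s_ i *m b = s_ i *m c \/ s_ i *m b = s_ i *m - c.
      rewrite mulmxN.
      case: (absgn (s_ i *m b)) e => ->; case: (absgn (s_ i *m c)) => -> e.
      - by left. - by right.
      - by right; rewrite -e opprK.
      by left; apply: oppr_inj.
    rewrite -wprod1 => -[] /(wprod_inj n_ge2) e' //.
    by move: pb; rewrite e' => /posrootN; rewrite opprK.
  apply: uniq_perm => //; first exact: (betas_uniq lg.1).
  by apply: (uniq_min_size un sub _).2; rewrite size_map.
have : x i * Dsum s * x i = Dsum s.
  rewrite DsumE mulr_sumr mulr_suml -[RHS](perm_big _ pe) big_map /=.
  rewrite big_seq [RHS]big_seq; apply: eq_bigr => b bs.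
  rewrite -Dval_srefl; last exact: betas_root bs.
  case: (absgn (s_ i *m b)) => -> //; rewrite DvalN //.
  by apply: isroot_srefl; apply: betas_root bs.
by move=> e; rewrite /GRing.comm -{2}e -!mulrA x_sq mulr1.
Qed.

End Involutions.
End Values.
End Longest.

(** * Simultaneous diagonalization, Schur's lemma, rational eigenvalues *)

Section Simdiag.
Variables (F : fieldType) (m : nat) (P : 'M[F]_m).
Implicit Types (A B : 'M[F]_m) (a b : 'rV[F]_m).

(** The rows of [P] are simultaneous eigenvectors.  For an invertible [P] the
    relation between [A] and its eigenvalues [a] is functional, additive and
    multiplicative, so polynomial relations between matrices descend to their
    eigenvalues. *)
Definition simdiag A a : Prop := P *m A = diag_mx a *m P.

Lemma simdiagM A B a b : simdiag A a -> simdiag B b ->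
  simdiag (A *m B) (\row_k (a 0 k * b 0 k)).
Proof.
rewrite /simdiag => eA eB; rewrite mulmxA eA -mulmxA eB mulmxA; congr (_ *m _).
apply/matrixP=> i j; rewrite mul_diag_mx !mxE; case: eqP => [->|]; rewrite ?mulr0 //.
Qed.

Lemma simdiagD A B a b : simdiag A a -> simdiag B b -> simdiag (A + B) (a + b).
Proof. by rewrite /simdiag mulmxDr linearD mulmxDl /= => -> ->. Qed.

Lemma simdiagZ c A a : simdiag A a -> simdiag (c *: A) (c *: a).
Proof. by rewrite /simdiag -scalemxAr linearZ /= -scalemxAl => ->. Qed.

Lemma simdiag1 : simdiag 1%:M (const_mx 1).
Proof. by rewrite /simdiag diag_const_mx mulmx1 mul1mx. Qed.

Hypothesis Pu : P \in unitmx.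

Lemma simdiag_inj A a b : simdiag A a -> simdiag A b -> a = b.
Proof.
rewrite /simdiag => -> /(can_inj (mulmxK Pu)) /matrixP e.
by apply/rowP => k; have := e k k; rewrite !mxE eqxx.
Qed.

Lemma simdiag_tr A a : simdiag A a -> \tr A = \sum_k a 0 k.
Proof.
move=> e; have -> : A = invmx P *m (diag_mx a *m P) by rewrite -e mulKmx.
by rewrite mxtrace_mulC mulmxK // mxtrace_diag.
Qed.

Lemma simdiag_det A a : simdiag A a -> \det A = \prod_k a 0 k.
Proof.
move=> e; have -> : A = invmx P *m (diag_mx a *m P) by rewrite -e mulKmx.
rewrite det_mulmx mulrC det_mulmx -mulrA -det_mulmx mulmxV // det1 mulr1.
exact: det_diag.
Qed.

End Simdiag.

Section Diag.
Variable F : fieldType.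

Lemma diagonalizable_of_roots m (A : 'M[F]_m.+1) (rs : seq F) : uniq rs ->
  \prod_(r <- rs) (A - r%:M) = 0 -> diagonalizable A.
Proof.
move=> urs e; apply/diagonalizableP; exists rs => //; apply: mxminpoly_min.
rewrite rmorph_prod /= -[RHS]e; apply: eq_bigr => r _.
by rewrite rmorphB /= horner_mx_X horner_mx_C.
Qed.

Lemma codiag_exists m (As : seq 'M[F]_m) :
  {in As &, forall A B, comm_mx A B} -> {in As, forall A, diagonalizable A} ->
  exists2 P : 'M[F]_m, P \in unitmx &
    forall A, A \in As -> exists a, simdiag P A a.
Proof.
move=> cA dA; have [P Pu /allP AP] := (codiagonalizableP As).1 (conj cA dA).
exists P => // A /AP /= /diagonalizable_forPex[a] /(simmxPp (stablemx_unit _ Pu)).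
by exists a.
Qed.

Hypothesis F2 : 2 != 0 :> F.

Lemma diagonalizable0 (A : 'M[F]_0) : diagonalizable A.
Proof. by exists 1%:M; [exact: unitmx1|apply/is_diag_mxP => -[]]. Qed.

Lemma diagonalizable_idem m (A : 'M[F]_m) : A *m A = A -> diagonalizable A.
Proof.
case: m A => [|m] A e; first exact: diagonalizable0.
apply: (@diagonalizable_of_roots _ _ [:: 0; 1]).
  by rewrite /= inE eq_sym oner_eq0.
rewrite !big_cons big_nil mulr1 raddf0 subr0 mulrBr mulr1.
by rewrite [A * A]e subrr.
Qed.

Lemma diagonalizable_invol m (A : 'M[F]_m) : A *m A = 1%:M -> diagonalizable A.
Proof.
case: m A => [|m] A e; first exact: diagonalizable0.
apply: (@diagonalizable_of_roots _ _ [:: 1; -1]).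
  by rewrite /= inE -subr_eq0 opprK -mulr2n F2.
rewrite !big_cons big_nil mulr1 raddfN /= opprK mulrDr mulr1 mulrBl mul1r.
by rewrite [A * A]e addrC addrA subrK subrr.
Qed.

Lemma invol_tr m (A : 'M[F]_m) : A *m A = 1%:M -> exists z : int, \tr A = z%:~R.
Proof.
move=> e.
have [||P Pu h] := @codiag_exists _ [:: A].
- by move=> B C; rewrite !inE => /eqP-> /eqP->.
- by move=> B; rewrite inE => /eqP->; apply: diagonalizable_invol.
have [a sa] := h A (mem_head _ _); have s2 := simdiagM sa sa; rewrite e in s2.
have /rowP ea := simdiag_inj Pu s2 (simdiag1 P).
exists (\sum_k (if a 0 k == 1 then 1 else -1)).
rewrite (simdiag_tr Pu sa) rmorph_sum /=; apply: eq_bigr => k _.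
have := ea k; rewrite !mxE -expr2 => /eqP; rewrite sqrf_eq1.
by case: eqP => [-> //|_ /= /eqP->]; rewrite rmorphN1.
Qed.

(** The operators [e], [h] and [xi] of a root commute; only the eigenvalues of
    [xi] depend on the algebra under consideration. *)
Lemma codiag_triple m (E H X : 'M[F]_m) : E * E = E -> H * H = 1 -> H * E = E ->
  E * H = H * E -> X * E = E * X -> X * H = H * X -> diagonalizable X ->
  exists P (e h x : 'rV[F]_m), [/\ P \in unitmx,
    [/\ simdiag P E e, simdiag P H h & simdiag P X x] &
    forall k, (h 0 k = 1 \/ h 0 k = -1) /\ (e 0 k = 0 \/ e 0 k = 1 /\ h 0 k = 1)].
Proof.
move=> EE HH HE EH XE XH dX.
have [||P Pu hP] := @codiag_exists _ [:: E; H; X].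
- by move=> A B; rewrite !inE => /or3P[]/eqP-> /or3P[]/eqP->; rewrite /comm_mx ?mulmxE.
- move=> A; rewrite !inE => /or3P[]/eqP-> //; first exact: diagonalizable_idem.
  exact: diagonalizable_invol.
have [|e se] := hP E; first by rewrite mem_head.
have [|h sh] := hP H; first by rewrite !inE eqxx orbT.
have [|x sx] := hP X; first by rewrite !inE eqxx !orbT.
exists P, e, h, x; split => // k.
have := simdiagM se se; rewrite mulmxE EE => /(simdiag_inj Pu se)/rowP/(_ k).
rewrite !mxE => ek.
have := simdiagM sh sh; rewrite mulmxE HH => /(simdiag_inj Pu (simdiag1 P))/rowP/(_ k).
rewrite !mxE => hk.
have := simdiagM sh se; rewrite mulmxE HE => /(simdiag_inj Pu se)/rowP/(_ k).
rewrite !mxE => hek.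
split.
  by move/eqP: hk; rewrite -expr2 eq_sym sqrf_eq1 => /orP[]/eqP; [left|right].
have [e0|e0] := eqVneq (e 0 k) 0; first by left.
right; split; apply: (mulIf e0); first by rewrite mul1r -ek.
by rewrite -hek mul1r.
Qed.
End Diag.

Lemma schur_closed (C : closedFieldType) m (S : 'M[C]_m -> Prop) (B : 'M[C]_m) :
  (0 < m)%N ->
  (forall U : 'M[C]_m, (forall A, S A -> stablemx U A) -> U = 0 \/ row_full U) ->
  (forall A, S A -> comm_mx B A) -> is_scalar_mx B.
Proof.
move=> m0 irr cB.
have [a ra] : exists a, root (char_poly B) a.
  by apply/closed_rootP; rewrite size_char_poly eqSS -lt0n.
rewrite -eigenvalue_root_char in ra.
have stab A : S A -> stablemx (eigenspace B a) A.
  by move=> /cB cBA; apply/comm_mx_stable_eigenspace.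
have [e|full] := irr _ stab.
  by have : eigenspace B a != 0 := ra; rewrite e eqxx.
apply/is_scalar_mxP; exists a.
have : ((1%:M : 'M_m) <= eigenspace B a)%MS by rewrite submx_full.
by move/eigenspaceP; rewrite mul1mx scalemx1.
Qed.

(** A rational root of the monic integral characteristic polynomial of [B] is an
    integer. *)
Lemma rat_eigen_int (C : numFieldType) N m (B : 'M[int]_N) (Q : 'M[C]_(N, m))
    (om : C) (k : nat) (z : int) :
  (0 < k)%N -> om * k%:R = z%:~R -> Q != 0 ->
  map_mx intr B *m Q = om *: Q -> exists z' : int, om = z'%:~R.
Proof.
move=> k0 eom Q0 eQ.
have om_eig : root (char_poly (map_mx intr B^T)) om.
  rewrite -eigenvalue_root_char; apply/eigenvalueP.
  have [j rj] : exists j, row j Q^T != 0.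
    apply/existsP; apply: contraNT Q0; rewrite negb_exists => /forallP h.
    apply/eqP/trmx_inj/row_matrixP => j; rewrite trmx0 row0.
    by apply/eqP; have := h j; rewrite negbK.
  exists (row j Q^T) => //.
  by rewrite -matrix.map_trmx -row_mul -trmx_mul eQ linearZ /= linearZ.
pose r : rat := z%:~R / k%:R.
have kC : k%:R != 0 :> C by rewrite pnatr_eq0 -lt0n.
have er : om = ratr r.
  by rewrite /r fmorph_div /= ratr_int ratr_nat -eom mulfK.
have rr : root (map_poly intr (char_poly B^T) : {poly rat}) r.
  rewrite -(fmorph_root (ratr : {rmorphism rat -> C})) /= -er -map_poly_comp.
  rewrite (eq_map_poly (g := intr)); last by move=> x /=; rewrite ratr_int.
  by rewrite map_char_poly.
have : ratr r \in (Num.int : {pred algC}).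
  apply: Cint_rat_Aint; first exact: Crat_rat.
  apply: (@root_monic_Aint (map_poly intr (char_poly B^T))).
  - rewrite -(fmorph_root (ratr : {rmorphism rat -> algC})) /= -map_poly_comp in rr.
    rewrite (eq_map_poly (g := intr)) // in rr.
    by move=> x /=; rewrite ratr_int.
  - exact: monic_map (char_poly_monic _).
  by apply/polyOverP => i; rewrite coef_map /= intr_int.
move=> /intrP[z' ez]; exists z'.
have : ratr r = ratr z'%:~R :> algC by rewrite ratr_int.
by move/(fmorph_inj (ratr : {rmorphism rat -> algC})) => e; rewrite er e ratr_int.
Qed.

(** * Monomials in the torus generators *)

Section TorusMonomials.
Variables (A : pzRingType) (ty : chevalley_type) (n d : nat).
Hypothesis d_gt1 : (1 < d)%N.

(** The exponents for which [tmonom] is meaningful. *)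
Definition torus_ok (c : 'cV['Z_d]_n) : bool :=
  match ty with TypeAstar => \sum_j c j 0 == 0 | _ => true end.

Lemma torus_okD c c' : torus_ok c -> torus_ok c' -> torus_ok (c + c').
Proof.
rewrite /torus_ok; case: ty => // /eqP e /eqP e'; apply/eqP.
by under eq_bigr do rewrite mxE; rewrite big_split /= e e' addr0.
Qed.

Lemma torus_ok0 : torus_ok 0.
Proof. by rewrite /torus_ok; case: ty => //; rewrite big1 // => j _; rewrite mxE. Qed.

Lemma torus_okN c : torus_ok c -> torus_ok (- c).
Proof.
rewrite /torus_ok; case: ty => // /eqP e; apply/eqP.
by under eq_bigr do rewrite mxE; rewrite sumrN e oppr0.
Qed.

Lemma torus_okMn c k : torus_ok c -> torus_ok (c *+ k).
Proof.
move=> h; elim: k => [|k IH]; first by rewrite mulr0n torus_ok0.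
by rewrite mulrSr torus_okD.
Qed.

Lemma texp_ok (g : tgen ty n d) : torus_ok (texp g).
Proof. by move: g; rewrite /torus_ok /texp; case: ty => //= -[]. Qed.

Lemma cV_Zp_sum (c : 'cV['Z_d]_n) : c = \sum_j (delta_mx j 0 *+ (c j 0 : nat)).
Proof.
apply/colP => i; rewrite summxE (bigD1 i) //= big1 => [|j ji].
  by rewrite mulmxnE mxE !eqxx addr0 /= natr_Zp.
by rewrite mulmxnE mxE eq_sym (negbTE ji) mul0rn.
Qed.

(** Every meaningful exponent is a sum of exponents of generators. *)
Lemma torus_ok_ind (P : 'cV['Z_d]_n -> Prop) :
  P 0 -> (forall c c', torus_ok c -> torus_ok c' -> P c -> P c' -> P (c + c')) ->
  (forall g : tgen ty n d, P (texp g)) -> forall c, torus_ok c -> P c.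
Proof.
rewrite /torus_ok /texp; case: ty => P0 PD Pg c /= okc;
  try by rewrite [c]cV_Zp_sum; apply: big_ind => [//|x y|j _];
    [exact: PD|elim: (nat_of_ord _) => [|k IH]; rewrite ?mulr0n // mulrS; exact: PD].
exact: (Pg (exist _ c okc)).
Qed.

Variable T : tgen ty n d -> A.
Hypothesis T_rel : forall l r, torus_rel T l r -> l = r.

Lemma exp_Zp (a : A) (x y : 'Z_d) : a ^+ d = 1 ->
  a ^+ ((x + y)%R : 'Z_d) = a ^+ x * a ^+ y.
Proof.
move=> ad; rewrite -exprD /=.
rewrite [in RHS](divn_eq (nat_of_ord x + nat_of_ord y)%N d) exprD mulnC exprM ad expr1n mul1r.
by rewrite {3}(Zp_cast d_gt1).
Qed.

Lemma tmonom0 : tmonom T 0 = 1.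
Proof.
move: T T_rel; rewrite /tmonom; case: ty => //= U hU;
  try by rewrite big1 // => j _; rewrite mxE.
pose P := fun c : 'cV['Z_d]_n => \sum_j c j 0 == 0.
have ok0 : P 0 by rewrite /P big1 // => j _; rewrite mxE.
by rewrite (insubT P ok0) /=; apply: hU; apply: sl_torus_one.
Qed.

Lemma full_tmonomD (U : 'I_n -> A) (c c' : 'cV['Z_d]_n) :
  (forall l r, full_torus_rel d U l r -> l = r) ->
  \prod_(j < n) U j ^+ ((c + c')%R j 0) =
  (\prod_(j < n) U j ^+ (c j 0)) * \prod_(j < n) U j ^+ (c' j 0).
Proof.
move=> hU; have cU j k : GRing.comm (U j) (U k) by apply: hU; apply: full_torus_comm.
rewrite -prodrM_comm => [|i j _ _]; last by apply/commrX/commr_sym/commrX.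
by apply: eq_bigr => j _; rewrite mxE exp_Zp //; apply: hU; apply: full_torus_pow.
Qed.

Lemma tmonomD c c' : torus_ok c -> torus_ok c' ->
  tmonom T (c + c') = tmonom T c * tmonom T c'.
Proof.
move=> okc okc'; have okD := torus_okD okc okc'.
move: T T_rel okc okc' okD; rewrite /tmonom /torus_ok.
case: ty => /= U hU okc okc' okD; try exact: full_tmonomD.
pose P := fun c : 'cV['Z_d]_n => \sum_j c j 0 == 0.
rewrite (insubT P okc) (insubT P okc') (insubT P okD) /=.
by symmetry; apply: hU; apply: sl_torus_mul.
Qed.

Lemma tmonom_gen g : tmonom T (texp g) = T g.
Proof.
move: g T; rewrite /tmonom /texp; case: ty => /= g U; first
  [ rewrite (@big_only1 _ _ _ _ g) // => [|j jg _];
    [by rewrite mxE !eqxx expr1|by rewrite mxE (negbTE jg)]|by rewrite valK].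
Qed.
End TorusMonomials.

(** * Words in a free algebra *)

Section Morph.
Variables (A B : pzRingType) (f : A -> B).
Hypothesis f_morph : monoid_morphism f.
Variables (ty : chevalley_type) (n d : nat) (T : tgen ty n d -> A).

Lemma monoid_morph_prod I (r : seq I) (F : I -> A) :
  f (\prod_(i <- r) F i) = \prod_(i <- r) f (F i).
Proof. by apply: (big_morph f f_morph.2 f_morph.1). Qed.

Lemma monoid_morph_exp a k : f (a ^+ k) = f a ^+ k.
Proof.
elim: k => [|k IH]; first by rewrite !expr0 f_morph.1.
by rewrite !exprS f_morph.2 IH.
Qed.

Lemma tmonom_morph c : f (tmonom T c) = tmonom (fun g => f (T g)) c.
Proof.
move: T; rewrite /tmonom; case: ty => U;
 try by rewrite monoid_morph_prod; apply: eq_bigr => j _; apply: monoid_morph_exp.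
by case: insub => [g|] //=; apply: f_morph.1.
Qed.

(** The relations of the torus can be transported along a multiplicative map, so
    that [tmonom0] and [tmonomD] apply to the images of the generators. *)
Lemma torus_rel_morph : (forall l r, torus_rel T l r -> f l = f r) ->
  forall l r, torus_rel (fun g => f (T g)) l r -> l = r.
Proof.
move: T; rewrite /torus_rel; case: ty => U hU l r [];
 try by move=> j k; rewrite -!f_morph.2; apply: hU; apply: full_torus_comm.
all: try by move=> j; rewrite -monoid_morph_exp -f_morph.1; apply: hU; apply: full_torus_pow.
  by move=> c c0; rewrite -f_morph.1; apply: hU; apply: sl_torus_one.
by move=> c c' c'' e; rewrite -f_morph.2; apply: hU; apply: sl_torus_mul.
Qed.
End Morph.

Section Words.
Variables (F : fieldType) (X : choiceType).

Lemma fword_cat (s t : seq X) : fword F (s ++ t) = fword F s * fword F t.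
Proof. exact: big_cat. Qed.

Lemma fword_exp (s : seq X) k : fword F (flatten (nseq k s)) = fword F s ^+ k.
Proof.
elim: k => [|k IH]; first by rewrite expr0 /fword big_nil.
by rewrite /= fword_cat IH exprS.
Qed.

Lemma fwordE (s : seq X) : fword F s = mkmalgU (FMonom s) 1.
Proof.
elim: s => [|x s IH].
  rewrite /fword big_nil; apply/malgP => k.
  by rewrite mcoeff1 mcoeffU; congr (_ *+ (_ : bool)); rewrite eq_sym -fmoneE.
rewrite /fword big_cons -/(fword F s) IH /fgen.
rewrite malgM_def fgmulUU mulr1; congr mkmalgU.
by rewrite fmuE [LHS]fmmulE.
Qed.

(** A free algebra is spanned by its words. *)
Lemma freealg_ind (P : freealg_on F X -> Prop) : P 0 ->
  (forall f g, P f -> P g -> P (f + g)) -> (forall c s, P (c *: fword F s)) ->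
  forall f, P f.
Proof.
move=> P0 PD Pw f; rewrite [f]monalgE; apply: big_ind => // k _.
suff -> : mkmalgU k (mcoeff k f) = mcoeff k f *: fword F k by apply: Pw.
rewrite fwordE; apply/malgP => k'; rewrite mcoeffZ !mcoeffU fmK.
by case: eqP; rewrite ?mulr1 ?mulr0.
Qed.
End Words.

(** The word does not depend on the field; this is what allows characters over
    [K] and over its constants to be compared on torus elements. *)
Lemma tmonom_word ty n d (c : 'cV['Z_d]_n) :
  exists s : seq (letter ty n d), forall F : fieldType,
    tmonom (tor (F := F)) c = fword F s.
Proof.
rewrite /tmonom /tor /letter; case: ty => /=;
  try by exists (flatten [seq nseq (c j 0) (inl j) | j <- index_enum 'I_n]) => F;
  elim: (index_enum _) => [|j r IH]; [rewrite /fword !big_nil|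
   rewrite big_cons /= fword_cat IH; congr (_ * _);
   elim: (nat_of_ord _) => [|k IHk]; [rewrite /fword big_nil|
     rewrite exprS IHk /fword big_cons]].
case: insub => [g|]; last by exists [::] => F; rewrite /fword big_nil.
by exists [:: inl g] => F; rewrite /fword big_seq1.
Qed.

(** * Representations of the presented algebras *)

Section Rep.
Variables (F : fieldType) (ty : chevalley_type) (n d : nat) (Q : quadratic F).
Variables (m : nat) (rho : yoko ty n d Q -> 'M[F]_m).
Hypotheses (n_ge2 : (2 <= n)%N) (d_gt1 : (1 < d)%N) (d_even : ~~ odd d).
Hypotheses (dF : d%:R != 0 :> F) (rhoP : is_rep rho).

Local Notation FA := (freealg_on F (letter ty n d)).
Local Notation I := 'I_(nroots ty n).
Local Notation W := (@wprod ty n).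
Local Notation alpha := (sroot ty n).

(** Everything is evaluated on representatives in the free algebra, where the
    generators and their relations live. *)
Definition rep_eval (f : FA) : 'M[F]_m := rho (cls (yoko_rel Q) f).

Lemma rep_eval_morph : monoid_morphism rep_eval.
Proof.
split=> [|f g]; first exact: rhoP.2.1.
by rewrite /rep_eval clsM rhoP.2.2.
Qed.

Lemma rep_evalZD c f g : rep_eval (c *: f + g) = c *: rep_eval f + rep_eval g.
Proof. by rewrite /rep_eval clsD clsZ rhoP.1. Qed.

Lemma rep_eval0 : rep_eval 0 = 0.
Proof.
have := rep_evalZD 1 0 0; rewrite !scale1r addr0 => /eqP.
by rewrite -subr_eq0 opprD addrA subrr sub0r oppr_eq0 => /eqP.
Qed.

Lemma rep_evalZ c f : rep_eval (c *: f) = c *: rep_eval f.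
Proof. by rewrite -[c *: f]addr0 rep_evalZD rep_eval0 addr0. Qed.

Lemma rep_evalD f g : rep_eval (f + g) = rep_eval f + rep_eval g.
Proof. by rewrite -{1}[f]scale1r rep_evalZD scale1r. Qed.

Lemma rep_eval_sum J (r : seq J) (G : J -> FA) :
  rep_eval (\sum_(j <- r) G j) = \sum_(j <- r) rep_eval (G j).
Proof. exact: (big_morph rep_eval rep_evalD rep_eval0). Qed.

Lemma rep_eval_rel f g : yoko_rel Q f g -> rep_eval f = rep_eval g.
Proof. by move=> /cls_rel; rewrite /rep_eval => ->. Qed.

Definition rep_xi (i : I) : 'M[F]_m := rep_eval (xi i).
Definition rep_torus (c : 'cV['Z_d]_n) : 'M[F]_m := rep_eval (tmonom tor c).

Local Notation ok := (torus_ok ty (n := n) (d := d)).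

Lemma rep_torus_tmonom c : rep_torus c = tmonom (fun g : tgen ty n d => rep_eval (tor g)) c.
Proof. exact: (tmonom_morph rep_eval_morph). Qed.

Lemma rep_eval_torus_rel l r :
  torus_rel (fun g : tgen ty n d => rep_eval (tor g)) l r -> l = r.
Proof.
apply: (torus_rel_morph rep_eval_morph) => {}l {}r lr.
by apply: rep_eval_rel; apply: yoko_torus.
Qed.

Lemma rep_torus0 : rep_torus 0 = 1.
Proof. by rewrite rep_torus_tmonom tmonom0 //; apply: rep_eval_torus_rel. Qed.

Lemma rep_torusD c c' : ok c -> ok c' -> rep_torus (c + c') = rep_torus c * rep_torus c'.
Proof. by move=> okc okc'; rewrite !rep_torus_tmonom tmonomD //; apply: rep_eval_torus_rel. Qed.

Lemma rep_torus_gen g : rep_torus (texp g) = rep_eval (tor g).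
Proof. by rewrite rep_torus_tmonom tmonom_gen //. Qed.

Lemma rep_torus_comm c c' : ok c -> ok c' -> GRing.comm (rep_torus c) (rep_torus c').
Proof. by move=> ? ?; rewrite /GRing.comm -!rep_torusD // addrC. Qed.

Lemma rep_torusMn c k : ok c -> rep_torus (c *+ k) = rep_torus c ^+ k.
Proof.
move=> okc; elim: k => [|k IH]; first by rewrite mulr0n rep_torus0 expr0.
by rewrite mulrS exprS rep_torusD ?torus_okMn // IH.
Qed.

Lemma rep_torus_order c : ok c -> rep_torus c ^+ d = 1.
Proof.
move=> okc; rewrite -rep_torusMn // -rep_torus0; congr rep_torus; apply/colP => j.
by rewrite mulmxnE mxE -mulr_natr (pchar_Zp d_gt1) mulr0.
Qed.

Lemma rep_torusN c : ok c -> rep_torus (- c) * rep_torus c = 1.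
Proof. by move=> okc; rewrite -rep_torusD ?torus_okN // addNr rep_torus0. Qed.

Definition srefl_mod (i : I) : 'M['Z_d]_n := map_mx (fun z : int => z%:~R) (srefl ty n i).

Lemma srefl_mod_ok i c : ok c -> ok (srefl_mod i *m c).
Proof.
rewrite /torus_ok /srefl_mod; move: i; case: ty => //= i /eqP c0; apply/eqP.
have lt2 : (i.+1 < n)%N by rewrite -ltn_predRL; case: i.
rewrite (adjmx_perm (ltnW lt2) lt2) map_perm_mx -row_permE -[RHS]c0.
rewrite [RHS](reindex_inj (@perm_inj _ (tperm (Ordinal (ltnW lt2)) (Ordinal lt2)))).
by apply: eq_bigr => j _; rewrite mxE.
Qed.

Lemma rep_xi_torus i c : ok c -> rep_xi i * rep_torus c = rep_torus (srefl_mod i *m c) * rep_xi i.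
Proof.
move: c; apply: torus_ok_ind => [|c c' okc okc' IH IH'|g].
- by rewrite mulmx0 rep_torus0 mulr1 mul1r.
- by rewrite mulmxDr !rep_torusD ?srefl_mod_ok // mulrA IH -!mulrA IH'.
rewrite rep_torus_gen -!rep_eval_morph.2; apply: rep_eval_rel; exact: yoko_conj.
Qed.

Lemma rep_xi_braid (i j : I) k : mx_order (srefl ty n i *m srefl ty n j) k ->
  \prod_(p < k) (if odd p then rep_xi j else rep_xi i) =
  \prod_(p < k) (if odd p then rep_xi i else rep_xi j).
Proof.
move=> /(@yoko_braid F ty n d Q i j k) /rep_eval_rel; rewrite /alternating !(monoid_morph_prod rep_eval_morph).
by under eq_bigr do rewrite (fun_if rep_eval); under [in RHS]eq_bigr do rewrite (fun_if rep_eval).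
Qed.

Lemma rep_eval_xiword (s : seq I) : rep_eval (xiword s) = xprod rep_xi s.
Proof. exact: (monoid_morph_prod rep_eval_morph). Qed.

(** Commutation with the generators suffices. *)
Lemma comm_rep_eval (B : 'M[F]_m) : (forall i, GRing.comm B (rep_xi i)) ->
  (forall c, ok c -> GRing.comm B (rep_torus c)) -> forall f, GRing.comm B (rep_eval f).
Proof.
move=> cx ct; apply: freealg_ind => [|f g cf cg|c s].
- by rewrite rep_eval0; apply: commr0.
- by rewrite rep_evalD; apply: commrD.
suff e : GRing.comm B (rep_eval (fword F s)).
  by rewrite rep_evalZ /GRing.comm -!mulmxE -scalemxAr -scalemxAl [B *m _]e.
rewrite /fword (monoid_morph_prod rep_eval_morph).
apply: commr_prod => -[g|i] _; last exact: cx.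
by rewrite -[rep_eval _]/(rep_eval (tor g)) -rep_torus_gen; apply: ct; apply: texp_ok.
Qed.

Definition Hroot_mod (i : I) : 'cV['Z_d]_n := modd d (Hroot ty n i).

Lemma modd_mul (M : 'M[int]_n) c : modd d (M *m c) = map_mx (fun z : int => z%:~R) M *m modd d c.
Proof. exact: (map_mxM (intr : {rmorphism int -> 'Z_d})). Qed.

Lemma moddN (c : 'cV[int]_n) : modd d (- c) = - modd d c.
Proof. exact: (map_mxN (intr : {rmorphism int -> 'Z_d})). Qed.

Lemma Hroot_ok i : ok (Hroot_mod i).
Proof.
rewrite /torus_ok /Hroot_mod /modd; move: i; case: ty => //= i; apply/eqP.
have lt2 : (i.+1 < n)%N by rewrite -ltn_predRL; case: i.
under eq_bigr do rewrite !mxE rmorphB /= !rmorph_nat.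
rewrite sumrB.
rewrite (big_only1 (Ordinal (ltnW lt2))) //= => [|j ne _]; last first.
  by rewrite (_ : (j == i :> nat) = false) //; apply: contraNF ne.
rewrite (big_only1 (Ordinal lt2)) //= => [|j ne _]; last first.
  by rewrite (_ : (j == i.+1 :> nat) = false) //; apply: contraNF ne.
by rewrite !eqxx subrr.
Qed.

End Rep.

(** * The idempotent and the involution attached to a root *)

Section RootScale.
Variables (ty : chevalley_type) (n : nat).
Hypothesis n_ge2 : (2 <= n)%N.
Local Notation I := 'I_(nroots ty n).
Local Notation W := (@wprod ty n).
Local Notation alpha := (sroot ty n).
Local Notation H_ := (Hroot ty n).

Lemma rscale_neq0 i : rscale ty i != 0.
Proof. by rewrite /rscale; case: ty; case: i. Qed.

Lemma rscale_hnorm (i j : I) : hnorm ty i = hnorm ty j ->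
  rscale ty i = rscale ty j \/ rscale ty i = - rscale ty j.
Proof.
by rewrite /hnorm /rscale; case: ty i j => -[[|i] ?] [[|j] ?] //=; by [left|right].
Qed.

Lemma srefl_Hroot (i : I) : srefl ty n i *m H_ i = - H_ i.
Proof.
apply: (intmx_scaleI (rscale_neq0 i)).
by rewrite scalemxAr scalerN -sroot_Hroot srefl_sroot.
Qed.

(** The images of the distinguished elements follow those of the roots, since
    roots of equal length are scaled by the same factor up to sign. *)
Lemma wprod_Hroot t (i j : I) :
  W t *m alpha i = alpha j \/ W t *m alpha i = - alpha j ->
  W t *m H_ i = H_ j \/ W t *m H_ i = - H_ j.
Proof.
move=> e; have hn : hnorm ty i = hnorm ty j.
  by apply: (@root_hnorm _ _ n_ge2 t i [::] j); rewrite wprod_nil mul1mx.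
have main : forall eps : int, W t *m alpha i = eps *: alpha j -> eps = 1 \/ eps = -1 ->
    W t *m H_ i = H_ j \/ W t *m H_ i = - H_ j.
  move=> eps; rewrite !sroot_Hroot -scalemxAr.
  have r0 := rscale_neq0 i; case: (rscale_hnorm hn) => er e1 [] e2;
    subst eps; rewrite ?scale1r ?scaleN1r in e1.
  - by left; apply: (intmx_scaleI r0); rewrite e1 er.
  - by right; apply: (intmx_scaleI r0); rewrite e1 er scalerN.
  - by right; apply: (intmx_scaleI r0); rewrite e1 er scalerN scaleNr opprK.
  by left; apply: (intmx_scaleI r0); rewrite e1 er scaleNr.
by case: e => e; [apply: (main 1); rewrite ?scale1r|apply: (main (-1)); rewrite ?scaleN1r]; auto.
Qed.
End RootScale.

Section RepElts.
Variables (F : fieldType) (ty : chevalley_type) (n d : nat) (Q : quadratic F).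
Variables (m : nat) (rho : yoko ty n d Q -> 'M[F]_m).
Hypotheses (n_ge2 : (2 <= n)%N) (d_gt1 : (1 < d)%N) (d_even : ~~ odd d).
Hypotheses (dF : d%:R != 0 :> F) (rhoP : is_rep rho).

Local Notation I := 'I_(nroots ty n).
Local Notation W := (@wprod ty n).
Local Notation alpha := (sroot ty n).
Local Notation ok := (torus_ok ty (n := n) (d := d)).
Local Notation rep_xi := (rep_xi rho).
Local Notation rep_torus := (rep_torus rho).
Local Notation Hroot_mod := (@Hroot_mod ty n d).
Local Notation srefl_mod := (@srefl_mod ty n d).

(** The projection onto the fixed space of the torus element of exponent [c]; it
    is the operator [e_i] when [c] is the exponent of a root. *)
Definition torus_avg c : 'M[F]_m := (d%:R)^-1 *: \sum_(1 <= j < d.+1) rep_torus c ^+ j.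
Definition torus_half c : 'M[F]_m := rep_torus c ^+ d./2.

Lemma rep_eval_ee i : rep_eval rho (ee i) = torus_avg (Hroot_mod i).
Proof.
rewrite /ee /torus_avg rep_evalZ // rep_eval_sum //; congr (_ *: _); apply: eq_bigr => j _.
exact: (monoid_morph_exp (rep_eval_morph rhoP)).
Qed.

Lemma rep_eval_hh i : rep_eval rho (hh i) = torus_half (Hroot_mod i).
Proof. exact: (monoid_morph_exp (rep_eval_morph rhoP)). Qed.

Lemma torus_mul_avg c : ok c -> rep_torus c * torus_avg c = torus_avg c.
Proof.
move=> okc; rewrite /torus_avg -mulmxE -scalemxAr mulmxE; congr (_ *: _).
rewrite mulr_sumr (big_nat_recr d) ?(ltnW d_gt1) //= [RHS]big_ltn ?ltnS ?(ltnW d_gt1) //.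
rewrite [RHS]addrC [in RHS]big_add1 /= rep_torus_order // mulr1 expr1; congr (_ + _).
by apply: eq_bigr => j _; rewrite exprS.
Qed.

Lemma torus_avg_comm c (B : 'M[F]_m) : GRing.comm B (rep_torus c) -> GRing.comm B (torus_avg c).
Proof.
move=> cB; rewrite /GRing.comm /torus_avg -mulmxE -scalemxAr -scalemxAl mulmxE; congr (_ *: _).
by apply: commr_sum => j _; apply: commrX.
Qed.

Lemma torusX_mul_avg c k : ok c -> rep_torus c ^+ k * torus_avg c = torus_avg c.
Proof.
move=> okc; elim: k => [|k IH]; first by rewrite expr0 mul1r.
by rewrite exprSr -mulrA torus_mul_avg.
Qed.

Lemma torus_avg_fix p c (B : 'M[F]_(m, p)) : rep_torus c *m B = B -> torus_avg c *m B = B.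
Proof.
move=> eB; rewrite /torus_avg -scalemxAl mulmx_suml.
rewrite (eq_bigr (fun => B)) => [|j _]; last first.
  by elim: j => [|j IH]; rewrite ?expr0 ?mul1mx // exprSr -mulmxE -mulmxA eB.
by rewrite big_const_nat iter_addr addr0 subSS subn0 -scaler_nat scalerA mulVf // scale1r.
Qed.

Lemma torus_avg_idem c : ok c -> torus_avg c * torus_avg c = torus_avg c.
Proof. by move=> okc; apply: torus_avg_fix; apply: torus_mul_avg. Qed.

(** The projections for an element and for its inverse have the same image. *)
Lemma torus_avgN c : ok c -> torus_avg (- c) = torus_avg c.
Proof.
have half c' : ok c' -> torus_avg (- c') * torus_avg c' = torus_avg c'.
  by move=> okc; apply: torus_avg_fix; rewrite mulmxE -{1}(torus_mul_avg okc) mulrA rep_torusN ?mul1r.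
move=> okc; have e1 := half _ okc; have := half _ (torus_okN okc).
rewrite opprK => e2; rewrite -e1 -{1}e2.
have ct : GRing.comm (torus_avg c) (torus_avg (- c)).
  apply: torus_avg_comm; apply/commr_sym/torus_avg_comm/rep_torus_comm => //; exact: torus_okN.
by rewrite ct.
Qed.

Lemma torus_half_sq c : ok c -> torus_half c * torus_half c = 1.
Proof.
move=> okc; rewrite /torus_half -exprD addnn -(rep_torus_order d_gt1 rhoP okc).
by congr (_ ^+ _); have := odd_double_half d; rewrite (negbTE d_even).
Qed.

Lemma torus_halfN c : ok c -> torus_half (- c) = torus_half c.
Proof.
move=> okc; have e : torus_half (- c) * torus_half c = 1.
  rewrite /torus_half -exprMn_comm ?rep_torusN ?expr1n //.
  by apply: rep_torus_comm => //; apply: torus_okN.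
by rewrite -[LHS]mulr1 -(torus_half_sq okc) mulrA e mul1r.
Qed.

Lemma torus_half_avg c : ok c -> torus_half c * torus_avg c = torus_avg c.
Proof. exact: torusX_mul_avg. Qed.

Lemma conj_torus_avg (B : 'M[F]_m) c c' : B * rep_torus c = rep_torus c' * B -> B * torus_avg c = torus_avg c' * B.
Proof.
move=> e; rewrite /torus_avg -mulmxE -scalemxAr -scalemxAl mulmxE; congr (_ *: _).
rewrite mulr_sumr mulr_suml; apply: eq_bigr => j _.
by elim: j => [|j IH]; rewrite ?expr0 ?mulr1 ?mul1r // !exprS mulrA e -!mulrA IH.
Qed.

Lemma conj_torus_half (B : 'M[F]_m) c c' : B * rep_torus c = rep_torus c' * B -> B * torus_half c = torus_half c' * B.
Proof.
move=> e; rewrite /torus_half; elim: (d./2) => [|j IH]; rewrite ?expr0 ?mulr1 ?mul1r //.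
by rewrite !exprS mulrA e -!mulrA IH.
Qed.

Lemma srefl_mod_Hroot i : srefl_mod i *m Hroot_mod i = - Hroot_mod i.
Proof. by rewrite /Hroot_mod /srefl_mod -modd_mul srefl_Hroot // moddN. Qed.

Lemma rep_xi_avg i : rep_xi i * torus_avg (Hroot_mod i) = torus_avg (Hroot_mod i) * rep_xi i.
Proof.
have okh := Hroot_ok d i; rewrite -{2}(torus_avgN okh) -srefl_mod_Hroot.
by apply: conj_torus_avg; apply: rep_xi_torus.
Qed.

Lemma rep_xi_half i : rep_xi i * torus_half (Hroot_mod i) = torus_half (Hroot_mod i) * rep_xi i.
Proof.
have okh := Hroot_ok d i; rewrite -{2}(torus_halfN okh) -srefl_mod_Hroot.
by apply: conj_torus_half; apply: rep_xi_torus.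
Qed.

Definition wprod_mod t : 'M['Z_d]_n := map_mx (fun z : int => z%:~R) (W t).

Lemma wprod_mod_nil : wprod_mod [::] = 1%:M.
Proof. by rewrite /wprod_mod wprod_nil; exact: (map_mx1 (intr : {rmorphism int -> 'Z_d})). Qed.

Lemma wprod_mod_cons i t : wprod_mod (i :: t) = srefl_mod i *m wprod_mod t.
Proof. by rewrite /wprod_mod wprod_cons; exact: (map_mxM (intr : {rmorphism int -> 'Z_d})). Qed.

Lemma wprod_mod_ok t c : ok c -> ok (wprod_mod t *m c).
Proof.
elim: t => [|i t IH] okc; first by rewrite wprod_mod_nil mul1mx.
by rewrite wprod_mod_cons -mulmxA srefl_mod_ok // IH.
Qed.

Lemma xprod_torus t c : ok c ->
  xprod rep_xi t * rep_torus c = rep_torus (wprod_mod t *m c) * xprod rep_xi t.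
Proof.
elim: t => [|i t IH] okc; first by rewrite wprod_mod_nil mul1mx xprod_nil mul1r mulr1.
by rewrite wprod_mod_cons -mulmxA xprod_cons -mulrA IH // !mulrA rep_xi_torus // wprod_mod_ok.
Qed.

Lemma wprod_mod_Hroot t (i j : I) :
  W t *m alpha i = alpha j \/ W t *m alpha i = - alpha j ->
  wprod_mod t *m Hroot_mod i = Hroot_mod j \/ wprod_mod t *m Hroot_mod i = - Hroot_mod j.
Proof.
move=> /(wprod_Hroot n_ge2); rewrite /wprod_mod /Hroot_mod -modd_mul => -[] ->; first by left.
by right; rewrite moddN.
Qed.

Lemma xprod_torus_avg t (i j : I) :
  W t *m alpha i = alpha j \/ W t *m alpha i = - alpha j ->
  xprod rep_xi t * torus_avg (Hroot_mod i) = torus_avg (Hroot_mod j) * xprod rep_xi t.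
Proof.
have okj := Hroot_ok d j; have oki := Hroot_ok d i.
move=> /wprod_mod_Hroot e; have -> : torus_avg (Hroot_mod j) = torus_avg (wprod_mod t *m Hroot_mod i).
  by case: e => ->; rewrite ?torus_avgN.
by apply: conj_torus_avg; apply: xprod_torus.
Qed.

Lemma xprod_torus_half t (i j : I) :
  W t *m alpha i = alpha j \/ W t *m alpha i = - alpha j ->
  xprod rep_xi t * torus_half (Hroot_mod i) = torus_half (Hroot_mod j) * xprod rep_xi t.
Proof.
have okj := Hroot_ok d j; have oki := Hroot_ok d i.
move=> /wprod_mod_Hroot e; have -> : torus_half (Hroot_mod j) = torus_half (wprod_mod t *m Hroot_mod i).
  by case: e => ->; rewrite ?torus_halfN.
by apply: conj_torus_half; apply: xprod_torus.
Qed.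

(** A reflection moves an exponent by a multiple of the root, because
    [Hroot] times a row vector is what the reflection subtracts; in type C the
    multiple is even. *)
Lemma srefl_mod_shift (i : I) c : exists k, srefl_mod i *m c = c + Hroot_mod i *+ k.
Proof.
pose cr := map_mx (fun z : int => z%:~R : 'Z_d) (coroot ty n i).
pose z : 'Z_d := (cr *m c) 0 0.
exists (- ((rscale ty i)%:~R * z) : 'Z_d)%R.
rewrite /srefl_mod srefl_rank1 // (map_mxB (intr : {rmorphism int -> 'Z_d})).
rewrite (map_mx1 (intr : {rmorphism int -> 'Z_d})) mulmxBl mul1mx; congr (_ + _).
rewrite (map_mxM (intr : {rmorphism int -> 'Z_d})) -mulmxA -/cr [cr *m c]mx11_scalar.
rewrite mul_mx_scalar sroot_Hroot (map_mxZ (intr : {rmorphism int -> 'Z_d})) scalerA -/z.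
apply/colP => j; rewrite mulmxnE mxE -mulr_natr natr_Zp mxE.
by rewrite mulrN [in RHS]mulrC [z * _]mulrC.
Qed.

(** The reflection changes a torus element by a power of the torus element of
    the root, and this power is absorbed by the projection. *)
Lemma avg_xi_torus_comm i c : ok c -> GRing.comm (torus_avg (Hroot_mod i) * rep_xi i) (rep_torus c).
Proof.
move=> okc; have okh := Hroot_ok d i; have [k ek] := srefl_mod_shift i c.
rewrite /GRing.comm -mulrA rep_xi_torus // ek rep_torusD ?torus_okMn //.
have ce : GRing.comm (torus_avg (Hroot_mod i)) (rep_torus c) by apply/commr_sym/torus_avg_comm/rep_torus_comm.
have ck : torus_avg (Hroot_mod i) * rep_torus (Hroot_mod i *+ k) = torus_avg (Hroot_mod i).
  by rewrite rep_torusMn // -[RHS](@torusX_mul_avg _ k okh); symmetry; apply/torus_avg_comm/commr_sym/commrX.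
rewrite (rep_torus_comm d_gt1 rhoP okc) ?torus_okMn // !mulrA ck.
by rewrite ce.
Qed.

End RepElts.

(** * Sums over all reflections in the group where the xi_i are involutions *)

Lemma diagonalizable_order (C : closedFieldType) m (A : 'M[C]_m) d :
  d%:R != 0 :> C -> A ^+ d = 1 -> diagonalizable A.
Proof.
case: m A => [|m] A dC e; first exact: diagonalizable0.
have [rs ers] := closed_field_poly_normal ('X^d - 1 : {poly C}).
have d0 : (0 < d)%N by case: (d) dC; rewrite ?eqxx.
have mon : ('X^d - 1 : {poly C}) \is monic by rewrite monicXnsubC.
rewrite (monicP mon) scale1r in ers.
apply: (@diagonalizable_of_roots _ _ _ rs).
  by rewrite -separable_prod_XsubC -ers separable_Xn_sub_1.
transitivity (horner_mx A (\prod_(r <- rs) ('X - r%:P))).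
  rewrite rmorph_prod; apply: eq_bigr => r _.
  by rewrite rmorphB /= horner_mx_X horner_mx_C.
by rewrite -ers rmorphB rmorphXn /= horner_mx_X rmorph1 e subrr.
Qed.

Section GroupRep.
Variables (C : numClosedFieldType) (ty : chevalley_type) (n d : nat).
Variables (m : nat) (rho : yoko ty n d (@QuadS C) -> 'M[C]_m).
Hypotheses (n_ge2 : (2 <= n)%N) (d_gt1 : (1 < d)%N) (d_even : ~~ odd d).
Hypothesis (rho_irr : irreducible_rep rho).

Local Notation I := 'I_(nroots ty n).
Local Notation W := (@wprod ty n).
Local Notation alpha := (sroot ty n).
Local Notation ok := (torus_ok ty (n := n) (d := d)).
Local Notation rep_xi := (rep_xi rho).
Local Notation rep_torus := (rep_torus rho).
Local Notation Hroot_mod := (@Hroot_mod ty n d).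

Let rhoP : is_rep rho. Proof. by case: rho_irr. Qed.
Let m_gt0 : (0 < m)%N. Proof. by case: rho_irr. Qed.
Let dC : d%:R != 0 :> C. Proof. by rewrite pnatr_eq0 -lt0n ltnW. Qed.

Lemma rep_xi_sq i : rep_xi i * rep_xi i = 1.
Proof.
rewrite -(rep_eval_morph rhoP).2 -(rep_eval_morph rhoP).1; apply: rep_eval_rel.
rewrite -expr2; exact: yoko_quad.
Qed.

Lemma comm_scalar (B : 'M[C]_m) : (forall i, GRing.comm B (rep_xi i)) ->
  (forall c, ok c -> GRing.comm B (rep_torus c)) -> exists om, B = om%:M.
Proof.
move=> cx ct; apply/is_scalar_mxP.
apply: (@schur_closed _ _ (fun A => exists f, A = rep_eval rho f)) => //.
  move=> U hU; case: rho_irr => _ _; apply=> a.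
  by rewrite -(cls_repr a); apply: hU; eexists.
by move=> _ [f ->]; apply: comm_rep_eval.
Qed.

(** The torus acts by commuting matrices of finite order. *)
Lemma torus_eigenvector : exists v : 'cV[C]_m, v != 0 /\
  forall c, ok c -> exists l, rep_torus c *m v = l *: v.
Proof.
pose As := [seq rep_torus c | c <- enum ('cV['Z_d]_n : finType) & ok c].
have [||P Pu hP] := @codiag_exists _ m As.
- move=> _ _ /mapP[c + ->] /mapP[c' + ->]; rewrite !mem_filter => /andP[okc _] /andP[okc' _].
  exact: (rep_torus_comm d_gt1 rhoP).
- move=> _ /mapP[c + ->]; rewrite mem_filter => /andP[okc _].
  by apply: (diagonalizable_order dC); apply: rep_torus_order.
pose k := Ordinal m_gt0.
exists (col k (invmx P)); split.
  apply: contraTneq Pu => e; rewrite -unitmx_inv unitmxE.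
  rewrite (expand_det_col _ k) big1 ?unitr0 // => j _.
  by have := congr1 (fun v : 'cV_m => v j 0) e; rewrite !mxE => ->; rewrite mul0r.
move=> c okc; have [|a sa] := hP (rep_torus c).
  by apply/mapP; exists c => //; rewrite mem_filter okc mem_enum.
exists (a 0 k).
have e : rep_torus c *m invmx P = invmx P *m diag_mx a.
  by apply: (can_inj (mulKmx Pu)); rewrite mulmxA sa mulmxK // mulKVmx.
rewrite colE mulmxA e -mulmxA scalemxAr; congr (_ *m _).
apply/colP => j; rewrite mul_diag_mx !mxE.
by case: eqP => [->|_]; rewrite ?mulr0.
Qed.

Section Longest.
Variable w0 : seq I.
Hypothesis w0_longest : is_longest w0.

Lemma rep_xi_word_inj s t : W s = W t -> xprod rep_xi s = xprod rep_xi t.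
Proof. exact: (xprod_wprod n_ge2 (rep_xi_braid rhoP) rep_xi_sq). Qed.

Lemma avg_xi_conj t (i j : I) :
  W t *m alpha i = alpha j \/ W t *m alpha i = - alpha j ->
  xprod rep_xi t * (torus_avg rho (Hroot_mod i) * rep_xi i) * xprod rep_xi (rev t) = torus_avg rho (Hroot_mod j) * rep_xi j.
Proof.
move=> e; rewrite mulrA (xprod_torus_avg n_ge2 d_gt1 dC rhoP e) // -!mulrA; congr (_ * _).
rewrite -[rep_xi i](xprod1 rep_xi) -!xprod_cat -[RHS](xprod1 rep_xi); apply: rep_xi_word_inj.
rewrite !wprod_cat !wprod1 mulmxA.
have -> := @root_refl _ _ n_ge2 t i [::] j; last by rewrite wprod_nil mul1mx.
by rewrite wprod_nil mul1mx mulmx1.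
Qed.

Lemma xprod_xiV t : xprod rep_xi t * xprod rep_xi (rev t) = 1.
Proof. exact: (xprodV n_ge2 (rep_xi_braid rhoP) rep_xi_sq). Qed.

Lemma half_conj t (i j : I) :
  W t *m alpha i = alpha j \/ W t *m alpha i = - alpha j ->
  xprod rep_xi t * torus_half rho (Hroot_mod i) * xprod rep_xi (rev t) = torus_half rho (Hroot_mod j).
Proof. by move=> e; rewrite (xprod_torus_half n_ge2 d_gt1 d_even rhoP e) // -mulrA xprod_xiV mulr1. Qed.

(** A sum over all reflections is central; its trace is computed letter by
    letter, because conjugation preserves traces. *)
Lemma Dsum_scalar (D : I -> 'M[C]_m) :
  (forall t (i j : I), W t *m alpha i = alpha j \/ W t *m alpha i = - alpha j ->
     xprod rep_xi t * D i * xprod rep_xi (rev t) = D j) ->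
  (forall i c, ok c -> GRing.comm (D i) (rep_torus c)) ->
  exists2 om, Dsum rep_xi D w0 = om%:M & om * m%:R = \sum_(i <- w0) \tr (D i).
Proof.
move=> Dc Dt; have [i|c okc|om e] := @comm_scalar (Dsum rep_xi D w0).
- exact: (commr_sym (Dsum_longest n_ge2 (rep_xi_braid rhoP) rep_xi_sq Dc i w0_longest)).
- have : forall s c, ok c -> GRing.comm (Dsum rep_xi D s) (rep_torus c).
    elim=> [|i s IH] {okc}c okc /=; first exact/commr_sym/commr0.
    apply/commr_sym/commrD; first exact/commr_sym/Dt.
    rewrite /GRing.comm.
    have key : rep_torus c * rep_xi i = rep_xi i * rep_torus (srefl_mod d i *m c).
      have := rep_xi_torus d_gt1 rhoP i (srefl_mod_ok i okc).
      rewrite mulmxA -(map_mxM (intr : {rmorphism int -> 'Z_d})) srefl_sq //.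
      by rewrite (map_mx1 (intr : {rmorphism int -> 'Z_d})) mul1mx.
    rewrite !mulrA key -(mulrA (rep_xi i)) -(IH _ (srefl_mod_ok i okc)) -!mulrA.
    by rewrite (rep_xi_torus d_gt1 rhoP i okc).
  exact.
exists om => //.
have : \tr (Dsum rep_xi D w0) = \sum_(i <- w0) \tr (D i).
  elim: w0 => [|i s IH]; first by rewrite big_nil mxtrace0.
  rewrite big_cons -IH /= mxtraceD; congr (_ + _).
  by rewrite -mulmxE mxtrace_mulC mulmxA [rep_xi i *m rep_xi i]rep_xi_sq mul1mx.
by rewrite e mxtrace_scalar mulr_natr.
Qed.


Lemma torus_mul_word u c : ok c -> rep_torus c * xprod rep_xi u = xprod rep_xi u * rep_torus (wprod_mod d (rev u) *m c).
Proof.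
move=> okc; rewrite xprod_torus ?wprod_mod_ok // mulmxA.
rewrite -(map_mxM (intr : {rmorphism int -> 'Z_d})) wprodV //.
by rewrite (map_mx1 (intr : {rmorphism int -> 'Z_d})) mul1mx.
Qed.

Lemma word_eigen (v : 'cV_m) : (forall c, ok c -> exists l, rep_torus c *m v = l *: v) ->
  forall u c, ok c -> exists l, rep_torus c *m (xprod rep_xi u *m v) = l *: (xprod rep_xi u *m v).
Proof.
move=> vE u c okc; have [l el] := vE _ (wprod_mod_ok (rev u) okc).
exists l; rewrite mulmxA [rep_torus c *m _]torus_mul_word // -mulmxA el.
by rewrite -scalemxAr.
Qed.

Lemma mul_xi_word i u (v : 'cV_m) : rep_xi i *m (xprod rep_xi u *m v) = xprod rep_xi (i :: u) *m v.
Proof. by rewrite mulmxA xprod_cons. Qed.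

(** On the translates of a torus eigenvector each [h_i] acts by a sign, so the
    central sum acts by the length of [w0] minus twice the number of negative
    signs. *)
Lemma half_class_nat : exists g : nat,
  \sum_(i <- w0) (m%:R - \tr (torus_half rho (Hroot_mod i))) = 2 * m%:R * g%:R.
Proof.
have [v [v0 vE]] := torus_eigenvector.
have [|i c okc|om eom etr] := @Dsum_scalar (fun i => torus_half rho (Hroot_mod i)).
- exact: half_conj.
- by apply/commr_sym/commrX/rep_torus_comm => //; apply: Hroot_ok.
have key s u : exists2 g : nat, (g <= size s)%N &
    Dsum rep_xi (fun i => torus_half rho (Hroot_mod i)) s *m (xprod rep_xi u *m v) =
    ((size s)%:R - g%:R *+ 2) *: (xprod rep_xi u *m v).
  elim: s u => [|i s IH] u; first by exists 0%N; rewrite //= mul0mx mul0rn subrr scale0r.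
  have [g gs eg] := IH (i :: u).
  have okh := Hroot_ok d i.
  have [l el] := word_eigen vE u okh.
  have hl k : rep_torus (Hroot_mod i) ^+ k *m (xprod rep_xi u *m v) = l ^+ k *: (xprod rep_xi u *m v).
    elim: k => [|k IHk]; first by rewrite !expr0 mul1mx scale1r.
    by rewrite !exprSr -mulmxE -mulmxA el -scalemxAr IHk scalerA mulrC.
  have nz : xprod rep_xi u *m v != 0.
    apply: contraNneq v0 => e0; have := congr1 (mulmx (xprod rep_xi (rev u))) e0.
    rewrite mulmx0 mulmxA [_ *m xprod rep_xi u](_ : _ = 1) ?mul1mx => [->//|].
    by have := xprod_xiV (rev u); rewrite revK.
  have hl2 : (l ^+ d./2) ^+ 2 = 1.
    have := hl (d./2 + d./2)%N; rewrite exprD [_ * _](torus_half_sq d_gt1 d_even rhoP okh).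
    rewrite mul1mx => e1; apply/eqP; rewrite -exprM muln2 -addnn -subr_eq0.
    have /eqP : (l ^+ (d./2 + d./2) - 1) *: (xprod rep_xi u *m v) = 0.
      by rewrite scalerBl -e1 scale1r subrr.
    by rewrite scaler_eq0 (negbTE nz) orbF.
  have e1 : Dsum rep_xi (fun i => torus_half rho (Hroot_mod i)) (i :: s) *m (xprod rep_xi u *m v) =
      (l ^+ d./2 + ((size s)%:R - g%:R *+ 2)) *: (xprod rep_xi u *m v).
    rewrite /= mulmxDl scalerDl -mulmxE -!(mulmxA (rep_xi i *m _)) mul_xi_word; congr (_ + _).
      exact: hl.
    rewrite -mulmxA eg -scalemxAr; congr (_ *: _).
    by rewrite mul_xi_word !xprod_cons mulrA rep_xi_sq mul1r.
  move/eqP: hl2; rewrite sqrf_eq1 => /orP[]/eqP hl2; rewrite hl2 in e1.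
    exists g; first exact: leq_trans gs _.
    by rewrite e1; congr (_ *: _); rewrite /= -natr1; ring.
  by exists g.+1 => //; rewrite e1; congr (_ *: _); rewrite /= -!natr1; ring.
have [g gs eg] := key w0 [::]; exists g.
rewrite eom xprod_nil mul1mx mul_scalar_mx in eg.
have {}eg : om = (size w0)%:R - g%:R *+ 2.
  apply/eqP; rewrite -subr_eq0.
  have /eqP : (om - ((size w0)%:R - g%:R *+ 2)) *: v = 0 by rewrite scalerBl eg subrr.
  by rewrite scaler_eq0 (negbTE v0) orbF.
rewrite sumrB -etr eg big_const_seq count_predT iter_addr addr0 -[m%:R *+ _]mulr_natr.
by ring.
Qed.

(** The lattice spanned by the translates of [v]; words of length at most that of
    [w0] suffice, which keeps it finitely generated. *)
Definition word_span (v u : 'cV[C]_m) : Prop :=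
  exists z : (size w0).-bseq I -> int, u = \sum_t (z t)%:~R *: (xprod rep_xi t *m v).

Lemma word_span_gen v u : word_span v (xprod rep_xi u *m v).
Proof.
have [t [rt' et xt]] := xprod_reduce n_ge2 (rep_xi_braid rhoP) rep_xi_sq u.
have le : (size t <= size w0)%N by apply: w0_longest.2.
exists (fun t' => if t' == Bseq le then 1 else 0).
rewrite (bigD1 (Bseq le)) //= eqxx scale1r -xt big1 ?addr0 // => t' /negbTE->.
by rewrite scale0r.
Qed.

Lemma word_spanD v u1 u2 : word_span v u1 -> word_span v u2 -> word_span v (u1 + u2).
Proof.
case=> z1 -> [z2 ->]; exists (fun t => z1 t + z2 t); rewrite -big_split /=.
by apply: eq_bigr => t _; rewrite rmorphD scalerDl.
Qed.

Lemma word_span0 v : word_span v 0.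
Proof. by exists (fun=> 0); rewrite big1 // => t _; rewrite scale0r. Qed.

Lemma word_spanZ v u (z : int) : word_span v u -> word_span v (z%:~R *: u).
Proof.
case=> z1 ->; exists (fun t => z * z1 t); rewrite scaler_sumr.
by apply: eq_bigr => t _; rewrite rmorphM scalerA.
Qed.

Lemma word_span_stable v (B : 'M[C]_m) :
  (forall u, word_span v (B *m (xprod rep_xi u *m v))) ->
  forall u, word_span v u -> word_span v (B *m u).
Proof.
move=> hB _ [z ->]; rewrite mulmx_sumr.
apply: (big_ind (word_span v)) => [|x y|t _].
- exact: word_span0.
- exact: word_spanD.
by rewrite -scalemxAr; apply: word_spanZ.
Qed.

Lemma avg_xi_trace_int (i : I) : exists y : int, \tr (torus_avg rho (Hroot_mod i) * rep_xi i) = y%:~R.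
Proof.
have okh := Hroot_ok d i.
have C2 : 2 != 0 :> C by rewrite pnatr_eq0.
have [|||||||P [e [h [x [Pu [se sh sx] hP]]]]] :=
  @codiag_triple _ C2 m (torus_avg rho (Hroot_mod i)) (torus_half rho (Hroot_mod i)) (rep_xi i).
- exact: torus_avg_idem.
- exact: torus_half_sq.
- exact: torus_half_avg.
- by apply/commr_sym/torus_avg_comm/commr_sym/commrX.
- exact: rep_xi_avg.
- exact: rep_xi_half.
- by apply: (diagonalizable_invol C2); exact: rep_xi_sq.
have := simdiagM sx sx; rewrite mulmxE rep_xi_sq => /(simdiag_inj Pu (simdiag1 P))/rowP ex.
exists (\sum_k (if e 0 k == 0 then 0 else if x 0 k == 1 then 1 else -1)).
rewrite (simdiag_tr Pu (simdiagM se sx)) rmorph_sum; apply: eq_bigr => k _; rewrite mxE.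
have := ex k; rewrite !mxE => /esym/eqP; rewrite -expr2 sqrf_eq1.
have [_ [->|[-> _]]] := hP k; first by rewrite mul0r eqxx.
rewrite oner_eq0 mul1r.
by case: eqP => [-> //|_ /= /eqP->]; rewrite rmorphN1.
Qed.

(** The operator [e_i] acts on a translate of [v] by 0 or 1, so the central sum
    is given by an integral matrix on the lattice [word_span]; its eigenvalue is
    rational because its multiple by the dimension is a sum of integers, the
    traces of the [e_i xi_i]. *)
Lemma avg_xi_class_int : exists z : int,
  \sum_(i <- w0) \tr (torus_avg rho (Hroot_mod i) * rep_xi i) = m%:R * z%:~R.
Proof.
have [v [v0 vE]] := torus_eigenvector.
have [|i c okc|om eom etr] := @Dsum_scalar (fun i => torus_avg rho (Hroot_mod i) * rep_xi i).
- exact: avg_xi_conj.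
- exact: avg_xi_torus_comm.
have stab_x i u : word_span v u -> word_span v (rep_xi i *m u).
  by apply: word_span_stable => u'; rewrite mul_xi_word; apply: word_span_gen.
have stab_e i u : word_span v u -> word_span v (torus_avg rho (Hroot_mod i) *m u).
  apply: word_span_stable => {}u.
  have okh := Hroot_ok d i; have [l el] := word_eigen vE u okh.
  have ee : l *: (torus_avg rho (Hroot_mod i) *m (xprod rep_xi u *m v)) = torus_avg rho (Hroot_mod i) *m (xprod rep_xi u *m v).
    rewrite scalemxAr -el mulmxA; congr (_ *m _).
    by rewrite -[RHS](torus_mul_avg d_gt1 rhoP okh); symmetry; apply: torus_avg_comm.
  have [l1|l1] := eqVneq l 1.
    by rewrite torus_avg_fix //; [exact: word_span_gen|rewrite el l1 scale1r].
  have /eqP : (l - 1) *: (torus_avg rho (Hroot_mod i) *m (xprod rep_xi u *m v)) = 0.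
    by rewrite scalerBl ee scale1r subrr.
  rewrite scaler_eq0 subr_eq0 (negbTE l1) => /eqP ->; exact: word_span0.
have stab_D s u : word_span v u ->
    word_span v (Dsum rep_xi (fun i => torus_avg rho (Hroot_mod i) * rep_xi i) s *m u).
  elim: s u => [|i s IH] u uv; first by rewrite mul0mx; apply: word_span0.
  rewrite /= mulmxDl -!mulmxE -!mulmxA; apply: word_spanD.
    exact/stab_e/stab_x.
  exact/stab_x/IH/stab_x.
pose T : finType := (size w0).-bseq I.
have /fin_all_exists[z zE] : forall t : T, exists z : T -> int,
    om *: (xprod rep_xi t *m v) = \sum_t' (z t')%:~R *: (xprod rep_xi t' *m v).
  move=> t; have [z ez] := stab_D w0 _ (word_span_gen v t).
  by exists z; rewrite -ez eom mul_scalar_mx.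
pose B : 'M[int]_#|T| := \matrix_(a, b) z (enum_val a) (enum_val b).
pose V : 'M[C]_(#|T|, m) := \matrix_a (xprod rep_xi (enum_val a : T) *m v)^T.
have V0 : V != 0.
  apply: contraNneq v0 => /(congr1 (row (enum_rank (nil_bseq (size w0) I : T)))).
  rewrite rowK enum_rankK row0 /= xprod_nil mul1mx => /(congr1 trmx).
  by rewrite trmxK trmx0 => ->.
have BV : map_mx intr B *m V = om *: V.
  apply/row_matrixP => a; rewrite row_mul linearZ /= rowK -linearZ /= zE.
  rewrite mulmx_sum_row linear_sum /= [LHS](reindex enum_rank) /=; last first.
    by apply: onW_bij; apply: enum_rank_bij.
  apply: eq_bigr => t _; rewrite rowK enum_rankK !mxE enum_rankK.
  by rewrite linearZ.
have /fin_all_exists[y yE] : forall i : I, exists y : int,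
    \tr (torus_avg rho (Hroot_mod i) * rep_xi i) = y%:~R by exact: avg_xi_trace_int.
have em : om * m%:R = (\sum_(i <- w0) y i)%:~R.
  rewrite etr rmorph_sum.
  by apply: eq_bigr => i _; rewrite yE.
have [z' ez'] := rat_eigen_int m_gt0 em V0 BV.
by exists z'; rewrite -etr ez' mulrC.
Qed.

End Longest.
End GroupRep.

(** * Eigenvalues forced by the quadratic relations *)

Section QuadEigen.
Variables (F : fieldType) (m : nat) (E H M : 'M[F]_m).
Hypotheses (F2 : 2 != 0 :> F).
Hypotheses (EE : E * E = E) (HH : H * H = 1) (HE : H * E = E) (EH : E * H = H * E).
Hypotheses (ME : M * E = E * M) (MH : M * H = H * M).

Section Yoko.
Variables (u v i_ : F).
Hypotheses (vv : v ^+ 2 = u) (ii : i_ ^+ 2 = -1).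
Hypotheses (u0 : u != 0) (u1 : u != 1) (uN1 : u != -1).
Hypothesis MM : M * M = u *: H + (1 - u) *: (E * M).

Lemma Y_quad_roots_uniq : uniq [:: 1; - u; v; - v; i_ * v; - (i_ * v)].
Proof.
have v0 : v != 0 by apply: contraNneq u0 => e; rewrite -vv e expr0n.
(* Most of the roots are told apart by their squares 1, u ^ 2, u and - u. *)
have sq (a b : F) : a ^+ 2 != b ^+ 2 -> (a == b) = false.
  by move=> ne; apply/negbTE; apply: contraNneq ne => ->.
have opp (a : F) : a != 0 -> (a == - a) = false.
  by move=> a0; rewrite -subr_eq0 opprK -mulr2n -mulr_natl mulf_eq0 (negbTE F2) (negbTE a0).
have i0 : i_ * v != 0.
  apply: contraNneq u0 => e; have : (i_ * v) ^+ 2 = 0 by rewrite e expr0n.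
  by rewrite exprMn ii vv mulN1r => /eqP; rewrite oppr_eq0 => /eqP->.
have uu1 : u ^+ 2 != u.
  by rewrite -subr_eq0 expr2 -[X in _ - X]mulr1 -mulrBr mulf_eq0 subr_eq0 negb_or u0.
have uuN : u ^+ 2 != - u.
  rewrite -subr_eq0 opprK expr2 -[X in _ + X]mulr1 -mulrDr mulf_eq0 addr_eq0.
  by rewrite negb_or u0.
have uN : u != - u by rewrite opp.
rewrite /= !inE !negb_or !andbT.
rewrite [- v == i_ * v]sq; last by rewrite sqrrN exprMn ii vv mulN1r.
rewrite [- v == - (i_ * v)]sq; last by rewrite !sqrrN exprMn ii vv mulN1r.
rewrite [v == i_ * v]sq; last by rewrite exprMn ii vv mulN1r.
rewrite [v == - (i_ * v)]sq; last by rewrite sqrrN exprMn ii vv mulN1r.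
rewrite [v == - v]opp // [i_ * v == _]opp //.
rewrite [- u == v]sq; last by rewrite sqrrN vv.
rewrite [- u == - v]sq; last by rewrite !sqrrN vv.
rewrite [- u == i_ * v]sq; last by rewrite sqrrN exprMn ii vv mulN1r.
rewrite [- u == - (i_ * v)]sq; last by rewrite !sqrrN exprMn ii vv mulN1r.
rewrite [1 == v]sq; last by rewrite expr1n vv eq_sym.
rewrite [1 == - v]sq; last by rewrite sqrrN expr1n vv eq_sym.
rewrite [1 == i_ * v]sq; last by rewrite expr1n exprMn ii vv mulN1r eq_sym eqr_oppLR.
rewrite [1 == - (i_ * v)]sq; last by rewrite sqrrN expr1n exprMn ii vv mulN1r eq_sym eqr_oppLR.
by rewrite eq_sym eqr_oppLR uN1.
Qed.

(** On the image of [E] the relation reads [M^2 = u + (1 - u) M], which gives the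
    first two factors; on the kernel of [E] it reads [M^2 = u H] with
    [H^2 = 1], which gives the last two. *)
Lemma Y_quad_annihilated :
  (M - 1%:M) * (M + u%:M) * ((M * M - u%:M) * (M * M + u%:M)) = 0.
Proof.
have sc (B : 'M[F]_m) : u%:M * B = u *: B by rewrite -mulmxE mul_scalar_mx.
have scr (B : 'M[F]_m) : B * u%:M = u *: B by rewrite -mulmxE mul_mx_scalar.
have Zl c (A B : 'M[F]_m) : (c *: A) * B = c *: (A * B) by rewrite -!mulmxE scalemxAl.
have Zr c (A B : 'M[F]_m) : A * (c *: B) = c *: (A * B) by rewrite -!mulmxE scalemxAr.
have MMc : M * M * E = E * (M * M) by rewrite -mulrA ME mulrA ME -mulrA.
have EME : E * M * E = E * M by rewrite -mulrA ME mulrA EE.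
have A1 : (M - 1%:M) * (M + u%:M) * E = 0.
  have -> : (M - 1%:M) * (M + u%:M) = M * M + u *: M - M - u%:M.
    by rewrite mulrBl mulrDr scr [1%:M * _]mul1mx opprD addrA.
  rewrite !mulrBl mulrDl Zl sc MM mulrDl !Zl HE EME ME.
  by apply/matrixP => a b; rewrite !mxE; ring.
have MMf : M * M * (1 - E) = u *: (H * (1 - E)).
  have z : E * M * (1 - E) = 0 by rewrite mulrBr mulr1 EME subrr.
  by rewrite MM mulrDl !Zl z scaler0 addr0.
have A2 : (M * M - u%:M) * (M * M + u%:M) * (1 - E) = 0.
  have e : (M * M + u%:M) * (1 - E) = u *: (H * (1 - E) + (1 - E)).
    by rewrite mulrDl MMf sc -scalerDr.
  rewrite -mulrA e Zr mulrBl sc mulrDr MMf.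
  have -> : M * M * (H * (1 - E)) = u *: (1 - E).
    have -> : M * M * (H * (1 - E)) = H * (M * M * (1 - E)).
      by rewrite !mulrA -(mulrA M M H) MH mulrA MH.
    by rewrite MMf Zr mulrA HH mul1r.
  by rewrite [u *: (H * _ + _)]scalerDr [u *: (1 - E) + _]addrC subrr scaler0.
rewrite -[LHS]mulr1 -[X in _ * X](subrK E) mulrDr -mulrA A2 mulr0 add0r.
set B := (M * M - _) * _; have cB : B * E = E * B.
  rewrite /B; apply: commr_sym; apply: commrM.
    by apply: commrB; [exact/commr_sym|rewrite /GRing.comm sc scr].
  by apply: commrD; [exact/commr_sym|rewrite /GRing.comm sc scr].
by rewrite -mulrA cB mulrA A1 mul0r.
Qed.

Lemma Y_quad_diagonalizable : diagonalizable M.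
Proof.
move: E H M EE HH HE EH ME MH MM Y_quad_annihilated; case: m => [|k] E' H' M' _ _ _ _ _ _ _ ann.
  exact: diagonalizable0.
apply: (diagonalizable_of_roots Y_quad_roots_uniq).
have f2 c : (M' - c%:M) * (M' - (- c)%:M) = M' * M' - (c ^+ 2)%:M.
  rewrite raddfN /= opprK mulrDr !mulrBl [_ * c%:M]mul_mx_scalar [c%:M * M']mul_scalar_mx.
  by rewrite addrA subrK [c%:M * c%:M]mul_scalar_mx scale_scalar_mx -expr2.
rewrite !big_cons big_nil mulr1 ![(_ - v%:M) * _]mulrA f2.
have scN c : (- c)%:M = - c%:M :> 'M[F]_k.+1 by rewrite raddfN.
by rewrite f2 exprMn ii vv mulN1r !scN !opprK mulrA.
Qed.

Lemma Y_quad_eigen : exists P (e x : 'rV[F]_m), [/\ P \in unitmx,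
  [/\ simdiag P E e & simdiag P M x] &
  forall k, e 0 k = 1 /\ (x 0 k = 1 \/ x 0 k = - u) \/
            e 0 k = 0 /\ exists z, (z \in [:: 1; -1; i_; - i_]) && (x 0 k == z * v)].
Proof.
have [P [e [h [x [Pu [se sh sx] hP]]]]] := codiag_triple F2 EE HH HE EH ME MH Y_quad_diagonalizable.
exists P, e, x; split=> // k.
have := simdiagM sx sx; rewrite mulmxE MM.
move=> /(simdiag_inj Pu (simdiagD (simdiagZ u sh) (simdiagZ (1 - u) (simdiagM se sx))))/rowP/(_ k).
rewrite !mxE => exk.
have [hk [ek|[ek hk1]]] := hP k; last first.
  left; split=> //; move: exk; rewrite ek hk1 mulr1 mul1r => exk.
  have /eqP : (x 0 k - 1) * (x 0 k + u) = 0.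
    rewrite mulrDr mulrBl -exk; ring.
  by rewrite mulf_eq0 subr_eq0 addr_eq0 => /orP[]/eqP ->; [left|right].
right; split=> //; move: exk; rewrite ek mul0r mulr0 addr0 => exk.
have {exk} : (x 0 k) ^+ 2 = u * h 0 k by rewrite expr2 exk.
case: hk => -> exk.
  have /eqP : (x 0 k - v) * (x 0 k + v) = 0 by rewrite -subr_sqr exk vv mulr1 subrr.
  rewrite mulf_eq0 subr_eq0 addr_eq0 => /orP[]/eqP ->.
    by exists 1; rewrite !inE mul1r !eqxx.
  by exists (-1); rewrite !inE mulN1r !eqxx orbT.
have /eqP : (x 0 k - i_ * v) * (x 0 k + i_ * v) = 0.
  by rewrite -subr_sqr exk exprMn ii vv; ring.
rewrite mulf_eq0 subr_eq0 addr_eq0 => /orP[]/eqP ->.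
  by exists i_; rewrite !inE !eqxx !orbT.
by exists (- i_); rewrite !inE mulNr !eqxx !orbT.
Qed.

End Yoko.

Section Zgen.
Variables (u w : F).
Hypotheses (ww : w ^+ 2 = 1 - 2 * u).
Hypotheses (u0 : u != 0) (w0 : w != 0).
Hypothesis MM : M * M = u *: H + (1 - u) *: 1%:M.

Lemma Z_quad_diagonalizable : diagonalizable M.
Proof.
have w1 : w ^+ 2 != 1.
  by rewrite ww -subr_eq0 addrC addKr oppr_eq0 mulf_neq0.
have uq : uniq [:: 1; -1; w; - w].
  have opp (a : F) : a != 0 -> (a == - a) = false.
    by move=> a0; rewrite -subr_eq0 opprK -mulr2n -mulr_natl mulf_eq0 (negbTE F2) (negbTE a0).
  move: w1; rewrite sqrf_eq1 negb_or => /andP[w1 wN1].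
  rewrite /= !inE !negb_or (opp 1) ?oner_eq0 // (opp w) // (inj_eq oppr_inj).
  rewrite (eq_sym 1 w) w1 (eq_sym 1) eqr_oppLR wN1 (eq_sym (-1)) wN1.
  by [].
move: E H M EE HH HE EH ME MH MM; case: m => [|k] E' H' M' _ HH' _ _ _ _ MM'.
  exact: diagonalizable0.
apply: (diagonalizable_of_roots uq).
have f2 c : (M' - c%:M) * (M' - (- c)%:M) = M' * M' - (c ^+ 2)%:M.
  rewrite raddfN /= opprK mulrDr !mulrBl [_ * c%:M]mul_mx_scalar [c%:M * M']mul_scalar_mx.
  by rewrite addrA subrK [c%:M * c%:M]mul_scalar_mx scale_scalar_mx -expr2.
rewrite !big_cons big_nil mulr1 f2 mulrA f2 expr1n ww MM'.
have -> : u *: H' + (1 - u) *: 1%:M - 1%:M = u *: (H' - 1).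
  by apply/matrixP => a b; rewrite !mxE; ring.
have -> : u *: H' + (1 - u) *: 1%:M - (1 - 2 * u)%:M = u *: (H' + 1).
  by apply/matrixP => a b; rewrite !mxE; case: (a == b) => /=; ring.
rewrite -!mulmxE -scalemxAl -scalemxAr mulmxE mulrBl mul1r mulrDr HH' mulr1.
by rewrite [1 + H']addrC subrr !scaler0.
Qed.

Lemma Z_quad_eigen : exists P (e h x : 'rV[F]_m), [/\ P \in unitmx,
  [/\ simdiag P E e, simdiag P H h & simdiag P M x] &
  forall k, (h 0 k = 1 /\ (e 0 k = 0 \/ e 0 k = 1) /\ (x 0 k = 1 \/ x 0 k = -1)) \/
            (h 0 k = -1 /\ e 0 k = 0 /\ (x 0 k = w \/ x 0 k = - w))].
Proof.
have [P [e [h [x [Pu [se sh sx] hP]]]]] := codiag_triple F2 EE HH HE EH ME MH Z_quad_diagonalizable.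
exists P, e, h, x; split=> // k.
have := simdiagM sx sx; rewrite mulmxE MM.
move=> /(simdiag_inj Pu (simdiagD (simdiagZ u sh) (simdiagZ (1 - u) (simdiag1 P))))/rowP/(_ k).
rewrite !mxE mulr1 => exk.
have {exk} : (x 0 k) ^+ 2 = u * h 0 k + (1 - u) by rewrite expr2 exk.
have [hk ek] := hP k; case: hk => hk; rewrite hk => exk; [left|right]; split=> //.
  split; first by case: ek => [->|[-> _]]; [left|right].
  have /eqP : (x 0 k) ^+ 2 = 1 by rewrite exk; ring.
  by rewrite sqrf_eq1 => /orP[]/eqP ->; [left|right].
split.
  case: ek => // -[_]; rewrite hk => /eqP; rewrite eq_sym -subr_eq0 opprK -mulr2n.
  by rewrite (negbTE F2).
have /eqP : (x 0 k - w) * (x 0 k + w) = 0 by rewrite -subr_sqr exk ww; ring.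
by rewrite mulf_eq0 subr_eq0 addr_eq0 => /orP[]/eqP ->; [left|right].
Qed.
End Zgen.
End QuadEigen.

(** The scalar [z] divided by [y ^ (2 N)] is a root of [X ^ m - c ^ 2], which
    splits over the constants.  Dividing [M] by a square root of [z], which is
    then a constant times [y ^ N], gives an involution, and an involution has an
    integral trace. *)
Lemma central_trace (C : closedFieldType) (K : fieldType) (cst : {rmorphism C -> K})
    m (M : 'M[K]_m) (z y : K) (c : C) (N : nat) :
  2 != 0 :> K -> (0 < m)%N -> M *m M = z%:M -> c != 0 -> y != 0 ->
  \det M = cst c * y ^+ (m * N) ->
  exists k : C, \tr M = cst k * y ^+ N.
Proof.
move=> K2 m0 MM c0 y0 dM.
have zm : z ^+ m = cst (c ^+ 2) * (y ^+ (2 * N)) ^+ m.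
  have -> : (y ^+ (2 * N)) ^+ m = (y ^+ (m * N)) ^+ 2 by rewrite -!exprM; congr (_ ^+ _); lia.
  by rewrite -[LHS](det_scalar m z) -MM det_mulmx dM rmorphXn -expr2 exprMn.
have [rs ers] := closed_field_poly_normal ('X^m - (c ^+ 2)%:P : {poly C}).
have mon : ('X^m - (c ^+ 2)%:P : {poly C}) \is monic by rewrite monicXnsubC.
rewrite (monicP mon) scale1r in ers.
have yN : y ^+ (2 * N) != 0 by rewrite expf_neq0.
have : root (map_poly cst ('X^m - (c ^+ 2)%:P)) (z / y ^+ (2 * N)).
  rewrite rmorphB /= map_polyXn map_polyC /root !hornerE expr_div_n zm.
  by rewrite mulfK ?expf_neq0 // subrr.
rewrite ers rmorph_prod /root horner_prod prodf_seq_eq0 => /hasP[r rrs /=].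
rewrite rmorphB /= map_polyX map_polyC !hornerE subr_eq0 => /eqP er.
have r0 : r != 0.
  apply: contraNneq c0 => r0; have : root ('X^m - (c ^+ 2)%:P) r by rewrite ers root_prod_XsubC.
  by rewrite r0 /root !hornerE expr0n eqn0Ngt m0 sub0r oppr_eq0 sqrf_eq0.
have [|s es] := closed_rootP ('X^2 - r%:P) _; first by rewrite size_XnsubC.
have {}es : s ^+ 2 = r by move: es; rewrite /root !hornerE subr_eq0 => /eqP.
have s0 : s != 0 by apply: contraNneq r0 => s0; rewrite -es s0 expr0n.
(* t is a square root of the scalar z. *)
pose t := cst s * y ^+ N.
have t0 : t != 0 by rewrite mulf_neq0 ?fmorph_eq0 ?expf_neq0.
have ez : z = t ^+ 2.
  rewrite exprMn -exprM -rmorphXn es mulnC; apply/eqP.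
  by rewrite -[_ == _](inj_eq (mulIf (invr_neq0 yN))) mulfK // er.
have [|a ea] := @invol_tr _ K2 _ (t^-1 *: M).
  rewrite -scalemxAl -scalemxAr MM scalerA ez scale_scalar_mx -expr2 -exprMn.
  by rewrite mulVf // expr1n.
exists (s * a%:~R); rewrite rmorphM rmorph_int.
move: ea; rewrite linearZ /= => /(canRL (mulKf (invr_neq0 t0))) ->.
by rewrite invrK /t; ring.
Qed.

(** * Constants, integral elements and specializations *)

Section Constants.
Variables (C : fieldType) (K : fieldExtType {fraction {poly C}}).

HB.instance Definition _ := GRing.RMorphism.copy (@polyK C K)
  (in_alg K \o (@tofrac {poly C} : {rmorphism _ -> _})).

Definition cstK : C -> K := (@polyK C K) \o polyC.
HB.instance Definition _ := GRing.RMorphism.on cstK.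

Lemma polyK_eq0 p : (@polyK C K p == 0) = (p == 0).
Proof. by rewrite -[LHS]/(in_alg K (tofrac p) == 0) fmorph_eq0 tofrac_eq0. Qed.

Lemma uK_neq_cst c : uK K != cstK c.
Proof.
rewrite -subr_eq0 -[_ - _](rmorphB (@polyK C K)) polyK_eq0.
by rewrite polyXsubC_eq0.
Qed.


(** Elements of [K] integral over [C[u]].  They are integral over [C[u, 1/u]] as
    well, so all the specializations are additive and multiplicative on
    them. *)
Definition Int (x : K) : Prop := integralOver (@polyK C K) x.

Lemma Int_poly p : Int (polyK K p). Proof. exact: integral_id. Qed.
Lemma Int_cst c : Int (cstK c). Proof. exact: Int_poly. Qed.
Lemma Int_nat k : Int k%:R. Proof. by rewrite -(rmorph_nat cstK); apply: Int_cst. Qed.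
Lemma IntD x y : Int x -> Int y -> Int (x + y). Proof. exact: integral_add. Qed.
Lemma IntN x : Int x -> Int (- x). Proof. exact: integral_opp. Qed.
Lemma IntM x y : Int x -> Int y -> Int (x * y). Proof. exact: integral_mul. Qed.
Lemma IntX x k : Int x -> Int (x ^+ k).
Proof.
by move=> xI; elim: k => [|k IH]; rewrite ?expr0 ?exprS; [exact: (Int_nat 1)|exact: IntM].
Qed.
Lemma Int_sum J (r : seq J) (G : J -> K) :
  (forall j, Int (G j)) -> Int (\sum_(j <- r) G j).
Proof. by move=> h; apply: big_ind => //; [exact: (Int_nat 0)|exact: IntD]. Qed.

Lemma Int_sqrt x p : x ^+ 2 = polyK K p -> Int x.
Proof.
move=> e; exists ('X^2 - p%:P); first by rewrite monicXnsubC.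
by rewrite rmorphB /= map_polyXn map_polyC /root !hornerE e subrr.
Qed.

Section Theta.
Variables (S : K -> Prop) (a : C) (theta : K -> C).
Hypothesis S_poly : forall p, S (polyK K p).
Hypothesis theta_spec : specialization S a theta.

Lemma Int_closure x : Int x -> integral_closure S x.
Proof.
case=> p mp rp; exists (map_poly (@polyK C K) p); split=> //; first exact: monic_map.
by move=> i; rewrite coef_map; apply: S_poly.
Qed.

Lemma thetaD x y : Int x -> Int y -> theta (x + y) = theta x + theta y.
Proof. by case: theta_spec => h _ _ xI yI; apply: h; apply: Int_closure. Qed.

Lemma thetaM x y : Int x -> Int y -> theta (x * y) = theta x * theta y.
Proof. by case: theta_spec => _ h _ xI yI; apply: h; apply: Int_closure. Qed.

Lemma theta_poly p : theta (polyK K p) = p.[a].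
Proof. by case: theta_spec. Qed.

Lemma theta_cst c : theta (cstK c) = c.
Proof. by rewrite theta_poly hornerC. Qed.

Lemma theta_nat k : theta k%:R = k%:R.
Proof. by rewrite -(rmorph_nat cstK) theta_cst. Qed.

Lemma theta_int (z : int) : theta z%:~R = z%:~R.
Proof. by rewrite -(rmorph_int cstK) theta_cst. Qed.

Lemma thetaX x k : Int x -> theta (x ^+ k) = theta x ^+ k.
Proof.
move=> xI; elim: k => [|k IH]; first by rewrite !expr0 (theta_nat 1).
by rewrite !exprS thetaM // ?IH //; apply: IntX.
Qed.

Lemma theta_sum J (r : seq J) (G : J -> K) :
  (forall j, Int (G j)) -> theta (\sum_(j <- r) G j) = \sum_(j <- r) theta (G j).
Proof.
move=> h; elim: r => [|j r IH]; first by rewrite !big_nil (theta_nat 0).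
by rewrite !big_cons thetaD // ?IH //; apply: Int_sum.
Qed.

End Theta.
End Constants.

Lemma laurent_poly (C : fieldType) (K : fieldExtType {fraction {poly C}}) p :
  laurent_ring (polyK K p).
Proof. by exists p, 0%N; rewrite expr0 divr1. Qed.

Lemma poly_ring_poly (C : fieldType) (K : fieldExtType {fraction {poly C}}) p :
  poly_ring (polyK K p).
Proof. by exists p. Qed.

Lemma torus_xi_word ty n d (c : 'cV['Z_d]_n) j (i : 'I_(nroots ty n)) :
  exists s : seq (letter ty n d), forall F : fieldType,
    tmonom (tor (F := F)) c ^+ j * xi i = fword F s.
Proof.
have [s es] := tmonom_word ty c; exists (flatten (nseq j s) ++ [:: inr i]) => F.
by rewrite fword_cat fword_exp es; congr (_ * _); rewrite /fword big_seq1.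
Qed.

Lemma torus_word ty n d (c : 'cV['Z_d]_n) j :
  exists s : seq (letter ty n d), forall F : fieldType,
    tmonom (tor (F := F)) c ^+ j = fword F s.
Proof.
have [s es] := tmonom_word ty c; exists (flatten (nseq j s)) => F.
by rewrite fword_exp es.
Qed.

Section Dspec.
Variables (C : numFieldType) (K : fieldExtType {fraction {poly C}}).
Variables (ty : chevalley_type) (n d : nat) (Q : quadratic K) (Q0 : quadratic C).
Variables (S : K -> Prop) (a : C) (theta : K -> C).
Hypothesis S_poly : forall p, S (polyK K p).
Hypothesis theta_spec : specialization S a theta.
Variables (m m0 : nat) (rho : yoko ty n d Q -> 'M[K]_m) (rho0 : yoko ty n d Q0 -> 'M[C]_m0).
Hypotheses (rhoP : is_rep rho) (rho0P : is_rep rho0).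
Hypothesis spec : dspec theta (fun x => \tr (rho x)) (fun x => \tr (rho0 x)).

Lemma dspec_word s : \tr (rep_eval rho0 (fword C s)) = theta (\tr (rep_eval rho (fword K s))).
Proof. exact: spec. Qed.

Lemma dspec_dim : m0 = m.
Proof.
have := dspec_word [::]; rewrite /fword !big_nil (rep_eval_morph rhoP).1 (rep_eval_morph rho0P).1.
by rewrite !mxtrace1 (theta_nat theta_spec) => /eqP; rewrite eqr_nat => /eqP.
Qed.

Lemma dspec_torus c j : \tr (rep_torus rho0 c ^+ j) = theta (\tr (rep_torus rho c ^+ j)).
Proof.
have [s es] := torus_word ty c j; have := dspec_word s.
by rewrite -!es (monoid_morph_exp (rep_eval_morph rhoP)) (monoid_morph_exp (rep_eval_morph rho0P)).
Qed.

Lemma dspec_torus_xi c j i :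
  \tr (rep_torus rho0 c ^+ j * rep_xi rho0 i) = theta (\tr (rep_torus rho c ^+ j * rep_xi rho i)).
Proof.
have [s es] := torus_xi_word c j i; have := dspec_word s.
rewrite -!es (rep_eval_morph rhoP).2 (rep_eval_morph rho0P).2.
by rewrite (monoid_morph_exp (rep_eval_morph rhoP)) (monoid_morph_exp (rep_eval_morph rho0P)).
Qed.

Lemma dspec_xiword s : \tr (rep_eval rho0 (xiword s)) = theta (\tr (rep_eval rho (xiword s))).
Proof.
have e (F : fieldType) : xiword s = fword F (map inr s) :> freealg_on F (letter ty n d).
  by rewrite /fword big_map.
by rewrite !e dspec_word.
Qed.

(** A specialization of characters is known on words only; this writes
    [e_i xi_i] in terms of words. *)
Lemma tr_avg_xi (F : fieldType) (Q' : quadratic F) k (r : yoko ty n d Q' -> 'M[F]_k) c i :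
  \tr (torus_avg r c * rep_xi r i) = (d%:R)^-1 * \sum_(1 <= j < d.+1) \tr (rep_torus r c ^+ j * rep_xi r i).
Proof. by rewrite /torus_avg -mulmxE -scalemxAl mxtraceZ mulmx_suml linear_sum. Qed.

Lemma dspec_avg_xi c i : (forall j, Int (\tr (rep_torus rho c ^+ j * rep_xi rho i))) ->
  \tr (torus_avg rho0 c * rep_xi rho0 i) = theta (\tr (torus_avg rho c * rep_xi rho i)).
Proof.
move=> hI; rewrite !tr_avg_xi.
rewrite -(rmorph_nat (@cstK C K)) -fmorphV (thetaM S_poly theta_spec); last 2 first.
- exact: Int_cst.
- exact: Int_sum.
rewrite (theta_cst theta_spec) (theta_sum S_poly theta_spec) //; congr (_ * _).
by apply: eq_bigr => j _; apply: dspec_torus_xi.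
Qed.

End Dspec.

(** * Determinants and traces of the generators over K *)

Section KRep.
Variables (C : numClosedFieldType) (K : fieldExtType {fraction {poly C}}).
Variables (ty : chevalley_type) (n d : nat).
Hypotheses (n_ge2 : (2 <= n)%N) (d_gt1 : (1 < d)%N) (d_even : ~~ odd d).
Local Notation I := 'I_(nroots ty n).
Local Notation Hroot_mod := (@Hroot_mod ty n d).
Local Notation u := (uK K).
Local Notation cst := (@cstK C K).

Lemma natK_neq0 k : (0 < k)%N -> k%:R != 0 :> K.
Proof. by move=> k0; rewrite -(rmorph_nat cst) fmorph_eq0 pnatr_eq0 -lt0n. Qed.

Lemma uK_neq0 : u != 0. Proof. by rewrite -(rmorph0 cst) uK_neq_cst. Qed.

(** Multiplication of [xi_i] by a power of the torus element of the root preserves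
    all the relations used to compute its eigenvalues.  So the words that make
    up [e_i xi_i] have integral traces too. *)
Lemma torus_xi_rels (F : fieldType) (Q : quadratic F) m (rho : yoko ty n d Q -> 'M[F]_m)
    (i : I) j :
  is_rep rho -> d%:R != 0 :> F ->
  let M := rep_torus rho (Hroot_mod i) ^+ j * rep_xi rho i in
  [/\ M * M = rep_xi rho i * rep_xi rho i, torus_avg rho (Hroot_mod i) * M = torus_avg rho (Hroot_mod i) * rep_xi rho i,
      M * torus_avg rho (Hroot_mod i) = torus_avg rho (Hroot_mod i) * M & M * torus_half rho (Hroot_mod i) = torus_half rho (Hroot_mod i) * M].
Proof.
move=> rhoP dF M; have okh := Hroot_ok d i.
have ct : GRing.comm (torus_avg rho (Hroot_mod i)) (rep_torus rho (Hroot_mod i) ^+ j).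
  by apply/commr_sym/torus_avg_comm/commr_sym/commrX.
have cx : rep_xi rho i * rep_torus rho (Hroot_mod i) ^+ j = rep_torus rho (- Hroot_mod i) ^+ j * rep_xi rho i.
  elim: j {M ct} => [|j IH]; first by rewrite !expr0 mulr1 mul1r.
  by rewrite exprSr mulrA IH -mulrA rep_xi_torus // srefl_mod_Hroot // mulrA -exprSr.
have inv : rep_torus rho (Hroot_mod i) ^+ j * rep_torus rho (- Hroot_mod i) ^+ j = 1.
  have cc : GRing.comm (rep_torus rho (Hroot_mod i)) (rep_torus rho (- Hroot_mod i)).
    by apply: rep_torus_comm => //; apply: torus_okN.
  by rewrite -exprMn_comm // cc rep_torusN // expr1n.
split.
- by rewrite /M mulrA -(mulrA _ (rep_xi rho i)) cx mulrA inv mul1r.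
- by rewrite /M mulrA ct torusX_mul_avg.
- by rewrite /M mulrA ct -!mulrA rep_xi_avg.
rewrite /M -mulrA rep_xi_half // !mulrA; congr (_ * _).
by rewrite /torus_half -!exprD addnC.
Qed.

Lemma rep_xi_sq_quad (Q : quadratic K) m (rho : yoko ty n d Q -> 'M[K]_m) i : is_rep rho ->
  rep_xi rho i * rep_xi rho i = rep_eval rho (quad_rhs d Q i).
Proof.
by move=> rhoP; rewrite -(rep_eval_morph rhoP).2 -expr2; apply: rep_eval_rel; apply: yoko_quad.
Qed.

Section Y.
Variables (v : K) (vv : v ^+ 2 = u).
Variables (m : nat) (rho : yoko ty n d (QuadY u) -> 'M[K]_m).
Hypothesis (rhoP : is_rep rho).
Variables (S : K -> Prop) (theta : K -> C).
Hypothesis S_poly : forall p, S (polyK K p).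
Hypothesis theta_spec : specialization S 1 theta.

Let dK : d%:R != 0 :> K. Proof. by rewrite natK_neq0 // ltnW. Qed.
Let K2 : 2 != 0 :> K. Proof. exact: natK_neq0. Qed.

Lemma Int_v : Int v. Proof. exact: (Int_sqrt vv). Qed.

(** The eigenvalues are a constant times [v ^ p] with [p = 0] or [2] on the image
    of [e_i] and [p = 1] on its kernel; in all cases the eigenvalue of
    [e_i xi_i] specializes to [1 - p] at [u = 1]. *)
Lemma Y_eigenvalues (i : I) j :
  let M := rep_torus rho (Hroot_mod i) ^+ j * rep_xi rho i in
  exists P (e x : 'rV[K]_m), [/\ P \in unitmx,
    [/\ simdiag P (torus_avg rho (Hroot_mod i)) e & simdiag P M x] &
    forall k, exists p (c : C), [/\ c != 0, x 0 k = cst c * v ^+ p,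
      Int (e 0 k * x 0 k) & theta (e 0 k * x 0 k) = 1 - p%:R]].
Proof.
move=> M; have okh := Hroot_ok d i.
have [MM EM ME MH] := @torus_xi_rels _ _ _ rho i j rhoP dK.
have i2 : cst 'i ^+ 2 = -1 by rewrite -rmorphXn /= sqrCi rmorphN1.
have [|||||||P [e [x [Pu [se sx] h]]]] := @Y_quad_eigen _ _ (torus_avg rho (Hroot_mod i))
   (torus_half rho (Hroot_mod i)) M K2 _ _ _ _ ME MH u v (cst 'i) vv i2 uK_neq0.
- exact: torus_avg_idem.
- exact: torus_half_sq.
- exact: torus_half_avg.
- by apply/commr_sym/torus_avg_comm/commr_sym/commrX.
- by rewrite -(rmorph1 cst) uK_neq_cst.
- by rewrite -(rmorphN1 cst) uK_neq_cst.
- rewrite MM EM rep_xi_sq_quad //= rep_evalD // !rep_evalZ // (rep_eval_morph rhoP).2 rep_eval_ee //.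
  by rewrite rep_eval_hh.
(* The exponents 0, 2 and 1 belong to the eigenvalues 1, - u and z * v. *)
exists P, e, x; split => // k; case: (h k) => [[-> [->|->]]|[-> [z /andP[zin /eqP ->]]]].
- exists 0%N, 1; rewrite expr0 rmorph1 !mulr1 subr0 oner_eq0; split=> //.
    exact: (Int_nat K 1).
  exact: (theta_nat theta_spec 1).
- exists 2%N, (-1); rewrite vv rmorphN1 mulN1r mul1r oppr_eq0 oner_eq0; split=> //.
    exact/IntN/Int_poly.
  rewrite -[- u](rmorphN (@polyK C K)) (theta_poly theta_spec) !hornerE.
  by rewrite mulr2n opprD addrA subrr sub0r.
have [c [c0 ec]] : exists c : C, c != 0 /\ z = cst c.
  move: zin; rewrite !inE => /or4P[]/eqP->.
  - by exists 1; rewrite oner_eq0 rmorph1.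
  - by exists (-1); rewrite oppr_eq0 oner_eq0 rmorphN1.
  - by exists 'i; rewrite neq0Ci.
  - by exists (- 'i); rewrite oppr_eq0 neq0Ci rmorphN.
exists 1%N, c; rewrite mul0r subrr expr1 ec; split=> //; first exact: (Int_nat K 0).
exact: (theta_nat theta_spec 0).
Qed.

Lemma Y_Int_word (i : I) j : Int (\tr (rep_torus rho (Hroot_mod i) ^+ j * rep_xi rho i)).
Proof.
have [P [e [x [Pu [_ sx] h]]]] := Y_eigenvalues i j.
rewrite (simdiag_tr Pu sx); apply: Int_sum => k.
have [p [c [_ -> _ _]]] := h k.
by apply: IntM; [exact: Int_cst|exact/IntX/Int_v].
Qed.

Lemma Y_root (i : I) : exists p (c : C), [/\ c != 0,
  \det (rep_xi rho i) = cst c * v ^+ p &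
  theta (\tr (torus_avg rho (Hroot_mod i) * rep_xi rho i)) = m%:R - p%:R].
Proof.
have [P [e [x [Pu [se sx] h]]]] := Y_eigenvalues i 0.
rewrite expr0 mul1r in sx.
have /fin_all_exists[p /fin_all_exists[c hc]] := h.
exists (\sum_k p k)%N, (\prod_k c k); split.
- by apply/prodf_neq0 => k _; have [] := hc k.
- rewrite (simdiag_det Pu sx) rmorph_prod -prodrXr -big_split /=.
  by apply: eq_bigr => k _; have [_ ->] := hc k.
rewrite (simdiag_tr Pu (simdiagM se sx)) (theta_sum S_poly theta_spec); last first.
  by move=> k; rewrite mxE; have [] := hc k.
rewrite (eq_bigr (fun k => 1 - (p k)%:R)) => [|k _]; last first.
  by rewrite mxE; have [] := hc k.
by rewrite sumrB -natr_sum sumr_const card_ord.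
Qed.
End Y.

Section Z.
Variables (w : K) (ww : w ^+ 2 = 1 - 2 * u).
Variables (m : nat) (rho : yoko ty n d (QuadZ u) -> 'M[K]_m).
Hypothesis (rhoP : is_rep rho).

Let dK : d%:R != 0 :> K. Proof. by rewrite natK_neq0 // ltnW. Qed.
Let K2 : 2 != 0 :> K. Proof. exact: natK_neq0. Qed.

(** The element [u] is not the constant [1/2]. *)
Lemma w_neq0 : w != 0.
Proof.
apply: contraNneq (uK_neq_cst K (2^-1 : C)) => w0.
move/eqP: ww; rewrite w0 expr0n /= eq_sym subr_eq0 => /eqP e.
rewrite fmorphV rmorph_nat; apply/eqP/(mulfI K2).
by rewrite -e mulfV.
Qed.

Lemma Int_w : Int w.
Proof.
apply: (@Int_sqrt _ _ _ (1 - 2 * 'X)).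
by rewrite ww rmorphB rmorph1 rmorphM rmorph_nat.
Qed.

Lemma Z_eigenvalues (i : I) j :
  let M := rep_torus rho (Hroot_mod i) ^+ j * rep_xi rho i in
  exists P (e h x : 'rV[K]_m), [/\ P \in unitmx,
    [/\ simdiag P (torus_avg rho (Hroot_mod i)) e, simdiag P (torus_half rho (Hroot_mod i)) h & simdiag P M x] &
    forall k, (h 0 k = 1 /\ (e 0 k = 0 \/ e 0 k = 1) /\ (x 0 k = 1 \/ x 0 k = -1)) \/
            (h 0 k = -1 /\ e 0 k = 0 /\ (x 0 k = w \/ x 0 k = - w))].
Proof.
move=> M; have okh := Hroot_ok d i.
have [MM EM ME MH] := @torus_xi_rels _ _ _ rho i j rhoP dK.
apply: (@Z_quad_eigen _ _ (torus_avg rho (Hroot_mod i)) (torus_half rho (Hroot_mod i)) M K2 _ _ _ _ ME MH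
  u w ww uK_neq0 w_neq0).
- exact: torus_avg_idem.
- exact: torus_half_sq.
- exact: torus_half_avg.
- by apply/commr_sym/torus_avg_comm/commr_sym/commrX.
by rewrite MM rep_xi_sq_quad //= rep_evalD // !rep_evalZ // (rep_eval_morph rhoP).1 rep_eval_hh.
Qed.

Lemma Z_Int_word (i : I) j : Int (\tr (rep_torus rho (Hroot_mod i) ^+ j * rep_xi rho i)).
Proof.
have [P [e [h [x [Pu [_ _ sx] H]]]]] := Z_eigenvalues i j.
rewrite (simdiag_tr Pu sx); apply: Int_sum => k.
case: (H k) => [[_ [_ [->|->]]]|[_ [_ [->|->]]]].
- exact: (Int_nat K 1).
- exact/IntN/(Int_nat K 1).
- exact: Int_w.
- exact/IntN/Int_w.
Qed.

Lemma Z_root (i : I) : exists (p : nat) (c : C) (y : int), [/\ c != 0,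
  \det (rep_xi rho i) = cst c * w ^+ p,
  \tr (torus_half rho (Hroot_mod i)) = cst (m%:R - 2 * p%:R) &
  \tr (torus_avg rho (Hroot_mod i) * rep_xi rho i) = y%:~R].
Proof.
have [P [e [h [x [Pu [se sh sx] H]]]]] := Z_eigenvalues i 0.
rewrite expr0 mul1r in sx.
have {H} : forall k, exists (p : nat) (c : C) (y : int), [/\ c != 0,
   x 0 k = cst c * w ^+ p, h 0 k = cst (1 - 2 * p%:R) & e 0 k * x 0 k = y%:~R].
  move=> k; case: (H k) => [[-> [e01 x1]]|[-> [-> xw]]].
    exists 0%N; rewrite expr0 mulr0 subr0 rmorph1.
    have [c [c0 ec]] : exists c : int, c%:~R != 0 :> C /\ x 0 k = c%:~R.
      case: x1 => ->; first by exists 1; rewrite oner_eq0.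
      by exists (-1); rewrite rmorphN1 oppr_eq0 oner_eq0.
    exists c%:~R, (if e 0 k == 0 then 0 else c); split=> //.
      by rewrite rmorph_int mulr1.
    by case: e01 => ->; rewrite ?eqxx ?mul0r // oner_eq0 mul1r.
  exists 1%N; case: xw => ->.
    exists 1, 0; rewrite oner_eq0 rmorph1 mul1r expr1 mul0r; split=> //.
    by rewrite mulr1 -{1}[1](rmorph1 cst) -rmorphN; congr cst; ring.
  exists (-1), 0; rewrite oppr_eq0 oner_eq0 rmorphN1 mulN1r expr1 mul0r; split=> //.
  by rewrite mulr1 -{1}[1](rmorph1 cst) -rmorphN; congr cst; ring.
move=> /fin_all_exists[p /fin_all_exists[c /fin_all_exists[y hc]]].
exists (\sum_k p k)%N, (\prod_k c k), (\sum_k y k); split.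
- by apply/prodf_neq0 => k _; have [] := hc k.
- rewrite (simdiag_det Pu sx) rmorph_prod -prodrXr -big_split /=.
  by apply: eq_bigr => k _; have [_ ->] := hc k.
- rewrite (simdiag_tr Pu sh) (eq_bigr (fun k => cst (1 - 2 * (p k)%:R))) => [|k _]; last first.
    by have [] := hc k.
  rewrite -rmorph_sum; congr cst.
  by rewrite sumrB -mulr_sumr -natr_sum sumr_const card_ord.
rewrite (simdiag_tr Pu (simdiagM se sx)) rmorph_sum; apply: eq_bigr => k _.
by rewrite mxE; have [] := hc k.
Qed.
End Z.

(** The square of [T_{w0}] commutes with the [xi_i] by [longest_sq_central], and
    with the torus because the longest element is an involution. *)
Lemma split_xiword_sq (Q : quadratic K) m (rho : yoko ty n d Q -> 'M[K]_m) (w0 : seq I) :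
  split_alg (yoko_rel (ty := ty) (n := n) (d := d) Q) -> irreducible_rep rho ->
  is_longest w0 ->
  exists z, rep_eval rho (xiword w0) *m rep_eval rho (xiword w0) = z%:M.
Proof.
move=> spl irr lg; have rhoP : is_rep rho by case: irr.
apply/is_scalar_mxP; apply: (spl _ rho irr) => f.
rewrite -(cls_repr f) rep_eval_xiword //.
set X := xprod _ _.
suff h : forall g, GRing.comm (X * X) (rep_eval rho g) by exact: h.
apply: (comm_rep_eval rhoP) => [i|c okc].
  exact: (commr_sym (longest_sq_central n_ge2 (rep_xi_braid rhoP) i lg)).
rewrite /GRing.comm /X -mulrA xprod_torus // mulrA xprod_torus ?wprod_mod_ok //.
rewrite mulmxA -(map_mxM (intr : {rmorphism int -> 'Z_d})) longest_invol //.
by rewrite (map_mx1 (intr : {rmorphism int -> 'Z_d})) mul1mx mulrA.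
Qed.

Lemma det_xprod (Q : quadratic K) m (rho : yoko ty n d Q -> 'M[K]_m) (s : seq I)
    (c : I -> C) (y : K) (p : I -> nat) :
  (forall i, \det (rep_xi rho i) = cst (c i) * y ^+ p i) ->
  \det (xprod (rep_xi rho) s) = cst (\prod_(i <- s) c i) * y ^+ (\sum_(i <- s) p i)%N.
Proof.
move=> h; elim: s => [|i s IH].
  by rewrite xprod_nil det1 !big_nil rmorph1 mulr1.
rewrite xprod_cons det_mulmx IH h !big_cons rmorphM exprD; ring.
Qed.
End KRep.

(** * The value at the longest element *)

(** The quotient is an integer, and it is nonnegative. *)
Lemma sum_nat_divisible (C : numFieldType) J (r : seq J) (p : J -> nat) (m : nat) (z : int) :
  (0 < m)%N -> \sum_(j <- r) (p j)%:R = m%:R * z%:~R :> C ->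
  exists2 N : nat, (\sum_(j <- r) p j = m * N)%N & z%:~R = N%:R :> C.
Proof.
move=> m0; rewrite -natr_sum => e.
have z0 : 0 <= z.
  rewrite -(ler0z C) -(pmulr_rge0 _ (_ : 0 < m%:R :> C)) ?ltr0n // -e.
  exact: ler0n.
exists `|z|%N; last by rewrite -[in LHS](gez0_abs z0).
by apply/eqP; rewrite -(eqr_nat C) natrM e -[in X in X == _](gez0_abs z0).
Qed.

(** The formula at an arbitrary constant [b] in place of the inverse of [q], with
    the values of [tau1] at [w] and of [phib] at [v] left open. *)
Theorem character_formula (C : numClosedFieldType) (K : fieldExtType {fraction {poly C}})
  (ty : chevalley_type) (n d : nat)
  (n_ge2 : (2 <= n)%N) (d_gt1 : (1 < d)%N) (d_even : ~~ odd d)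
  (v w : K) (v_sqr : v ^+ 2 = uK K) (w_sqr : w ^+ 2 = 1 - 2 * uK K)
  (Y_split : split_alg (yoko_rel (ty := ty) (n := n) (d := d) (QuadY (uK K))))
  (Z_split : split_alg (yoko_rel (ty := ty) (n := n) (d := d) (QuadZ (uK K))))
  (b : C) (phib phi1 tau1 tau0 : K -> C)
  (phib_spec : specialization (@laurent_ring _ K) b phib)
  (phi1_spec : specialization (@laurent_ring _ K) 1 phi1)
  (tau1_spec : specialization (@poly_ring _ K) 1 tau1)
  (tau0_spec : specialization (@poly_ring _ K) 0 tau0)
  (phi1_v : phi1 v = 1) (tau0_w : tau0 w = 1)
  (w0 : seq 'I_(nroots ty n)) (w0_longest : is_longest w0)
  (chi0 : yoko ty n d (@QuadS C) -> C) (chi0_irr : irr_char chi0)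
  (chi' : yoko ty n d (QuadZ (uK K)) -> K) (chi'_irr : irr_char chi')
  (psi : yoko ty n d (@QuadN C) -> C) (psi_irr : irr_char psi)
  (chi : yoko ty n d (QuadY (uK K)) -> K) (chi_irr : irr_char chi)
  (chib : yoko ty n d (QuadY b) -> C)
  (chi'_chi0 : dspec tau0 chi' chi0) (chi'_psi : dspec tau1 chi' psi)
  (chi_psi : dspec phi1 chi psi) (chi_chib : dspec phib chi chib) :
  exists N G : nat,
    [/\ fexp chi0 w0 = N%:R, gexp chi0 w0 = G%:R &
        chib (cls _ (xiword w0)) =
          chi0 (cls _ (xiword w0)) * (tau1 w) ^+ G * (phib v) ^+ N].
Proof.
have LP := @laurent_poly C K; have PP := @poly_ring_poly C K.
case: chi0_irr => m0 [rho0 [irr0 e0]]; case: chi'_irr => m' [rho' [irr' e']].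
case: psi_irr => mpsi [rhopsi [irrpsi epsi]]; case: chi_irr => m [rho [irr e]].
have P0 : is_rep rho0 by case: irr0.
have P' : is_rep rho' by case: irr'.
have Ppsi : is_rep rhopsi by case: irrpsi.
have P : is_rep rho by case: irr.
have s_'0 : dspec tau0 (fun x => \tr (rho' x)) (fun x => \tr (rho0 x)).
  by move=> s; rewrite -e0 -e'; apply: chi'_chi0.
have s_'psi : dspec tau1 (fun x => \tr (rho' x)) (fun x => \tr (rhopsi x)).
  by move=> s; rewrite -epsi -e'; apply: chi'_psi.
have s_psi : dspec phi1 (fun x => \tr (rho x)) (fun x => \tr (rhopsi x)).
  by move=> s; rewrite -epsi -e; apply: chi_psi.
have em0 := dspec_dim tau0_spec P' P0 s_'0.
have empsi := dspec_dim tau1_spec P' Ppsi s_'psi.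
have em := dspec_dim phi1_spec P Ppsi s_psi.
have m_gt0 : (0 < m)%N by case: irr.
have {}em0 : m0 = m by rewrite em0 -empsi em.
have m'm : m' = m by rewrite -empsi em.
subst m0 m' mpsi.
have /fin_all_exists[p /fin_all_exists[c hY]] := Y_root n_ge2 d_gt1 d_even v_sqr P LP phi1_spec.
have /fin_all_exists[g /fin_all_exists[c' /fin_all_exists[y hZ]]] := Z_root n_ge2 d_gt1 d_even w_sqr P'.
have ex i : \tr (torus_avg rho0 (Hroot_mod d i) * rep_xi rho0 i) = m%:R - (p i)%:R.
  have [_ _ <-] := hY i; have [_ _ _ ey] := hZ i.
  have I' := Z_Int_word n_ge2 d_gt1 d_even w_sqr P' i.
  have IY := Y_Int_word n_ge2 d_gt1 d_even v_sqr P phi1_spec i.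
  rewrite -(dspec_avg_xi LP phi1_spec P Ppsi s_psi IY).
  rewrite (dspec_avg_xi PP tau0_spec P' P0 s_'0 I') (dspec_avg_xi PP tau1_spec P' Ppsi s_'psi I').
  by rewrite ey (theta_int tau0_spec) (theta_int tau1_spec).
have h i : \tr (torus_half rho0 (Hroot_mod d i)) = m%:R - 2 * (g i)%:R.
  have [_ _ eh _] := hZ i.
  by rewrite /torus_half (dspec_torus P' P0 s_'0) -/(torus_half _ _) eh (theta_cst tau0_spec).
have mC : m%:R != 0 :> C by rewrite pnatr_eq0 -lt0n.
have C2 : 2 != 0 :> C by rewrite pnatr_eq0.
have [z ez] := avg_xi_class_int n_ge2 d_gt1 d_even irr0 w0_longest.
have [G eG] := half_class_nat n_ge2 d_gt1 d_even irr0 w0_longest.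
have epz : \sum_(i <- w0) (p i)%:R = m%:R * ((size w0)%:Z - z)%:~R :> C.
  rewrite rmorphB /= mulrBr -ez [X in _ - X](eq_bigr (fun i => m%:R - (p i)%:R)) => [|i _]; last exact: ex.
  rewrite sumrB big_const_seq count_predT iter_addr addr0 opprB -[m%:R *+ _]mulr_natr.
  by rewrite [RHS]addrC subrK.
have [N eN ezN] := sum_nat_divisible m_gt0 epz.
have egG : (\sum_(i <- w0) g i = m * G)%N.
  apply/eqP; rewrite -(eqr_nat C) natrM natr_sum.
  rewrite -(inj_eq (mulfI C2)) mulrA -eG mulr_sumr; apply/eqP.
  by apply: eq_bigr => i _; rewrite h opprB addrC subrK.
have one0 : chi0 1 = m%:R by rewrite e0 P0.2.1 mxtrace1.
exists N, G; split.
- rewrite /fexp (eq_bigr (fun i => (p i)%:R / m%:R)) => [|i _].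
    by rewrite -mulr_suml epz -ezN mulrAC mulfV // mul1r.
  rewrite one0 e0 -/(rep_eval rho0 _) (rep_eval_morph P0).2 rep_eval_ee // ex.
  by rewrite mulrBl mulfV // opprB addrC subrK.
- rewrite /gexp (eq_bigr (fun i => (g i)%:R / m%:R)) => [|i _].
    by rewrite -mulr_suml -natr_sum egG natrM mulrAC mulfV // mul1r.
  rewrite one0 e0 -/(rep_eval rho0 _) rep_eval_hh // h opprB addrC subrK.
  by rewrite -mulf_div mulfV // mul1r.
have [zY eY] := split_xiword_sq n_ge2 d_gt1 Y_split irr w0_longest.
have [zZ eZ] := split_xiword_sq n_ge2 d_gt1 Z_split irr' w0_longest.
have K2 : 2 != 0 :> K := natK_neq0 K (isT : (0 < 2)%N).
have v0 : v != 0 by apply: contraNneq (uK_neq0 K) => v0; rewrite -v_sqr v0 expr0n.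
have w_0 := w_neq0 w_sqr.
have cY0 : \prod_(i <- w0) c i != 0 by rewrite prodf_seq_neq0; apply/allP => i _; have [] := hY i.
have cZ0 : \prod_(i <- w0) c' i != 0 by rewrite prodf_seq_neq0; apply/allP => i _; have [] := hZ i.
have detY : \det (rep_eval rho (xiword w0)) = cstK K (\prod_(i <- w0) c i) * v ^+ (m * N).
  by rewrite rep_eval_xiword // (det_xprod w0 (fun i => let: And3 _ q _ := hY i in q)) eN.
have detZ : \det (rep_eval rho' (xiword w0)) = cstK K (\prod_(i <- w0) c' i) * w ^+ (m * G).
  by rewrite rep_eval_xiword // (det_xprod w0 (fun i => let: And4 _ q _ _ := hZ i in q)) egG.
have [kY ekY] := central_trace K2 m_gt0 eY cY0 v0 detY.
have [kZ ekZ] := central_trace K2 m_gt0 eZ cZ0 w_0 detZ.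
have IvN := IntX N (Int_v v_sqr); have IwG := IntX G (Int_w w_sqr).
have psi_Y : \tr (rep_eval rhopsi (xiword w0)) = kY.
  rewrite (dspec_xiword s_psi) ekY (thetaM LP phi1_spec) //; last exact: Int_cst.
  rewrite (theta_cst phi1_spec) (thetaX LP phi1_spec) ?phi1_v ?expr1n ?mulr1 //.
  exact: Int_v.
have psi_Z : \tr (rep_eval rhopsi (xiword w0)) = kZ * tau1 w ^+ G.
  rewrite (dspec_xiword s_'psi) ekZ (thetaM PP tau1_spec) //; last exact: Int_cst.
  by rewrite (theta_cst tau1_spec) (thetaX PP tau1_spec) //; exact: Int_w.
have chi0_Z : \tr (rep_eval rho0 (xiword w0)) = kZ.
  rewrite (dspec_xiword s_'0) ekZ (thetaM PP tau0_spec) //; last exact: Int_cst.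
  rewrite (theta_cst tau0_spec) (thetaX PP tau0_spec) ?tau0_w ?expr1n ?mulr1 //.
  exact: Int_w.
have -> : chi0 (cls _ (xiword w0)) = kZ by rewrite e0.
rewrite -psi_Z psi_Y.
have xw (F : fieldType) : xiword w0 = fword F (map inr w0) :> freealg_on F (letter ty n d).
  by rewrite /fword big_map.
rewrite xw chi_chib e -xw -/(rep_eval rho _) ekY (thetaM LP phib_spec) //; last exact: Int_cst.
by rewrite (theta_cst phib_spec) (thetaX LP phib_spec) //; exact: Int_v.
Qed.

Theorem corollary5p28 (R : realType) (ty : chevalley_type) (n q : nat)
  (n_ge2 : (2 <= n)%N) (q_odd : odd q)
  (q_pp : exists p k : nat, [/\ prime p, (0 < k)%N & q = (p ^ k)%N])
  (K : splittingFieldType {fraction {poly R[i]}})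
  (K_galois : galois 1 {:K})
  (v w : K) (v_sqr : v ^+ 2 = uK K) (w_sqr : w ^+ 2 = 1 - 2 * uK K)
  (Y_split : split_alg (yoko_rel (ty := ty) (n := n) (d := q.-1) (QuadY (uK K))))
  (Z_split : split_alg (yoko_rel (ty := ty) (n := n) (d := q.-1) (QuadZ (uK K))))
  (phiq phi1 tau1 tau0 : K -> R[i])
  (phiq_spec : specialization (@laurent_ring _ K) (q%:R)^-1 phiq)
  (phi1_spec : specialization (@laurent_ring _ K) 1 phi1)
  (tau1_spec : specialization (@poly_ring _ K) 1 tau1)
  (tau0_spec : specialization (@poly_ring _ K) 0 tau0)
  (phiq_v : phiq v = (Num.sqrt (q%:R)^-1)%:C%C)
  (phi1_v : phi1 v = 1)
  (tau1_w : tau1 w = - 'i%C)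
  (tau0_w : tau0 w = 1)
  (w0 : seq 'I_(nroots ty n)) (w0_longest : longest_word w0)
  (chi0 : yoko ty n q.-1 (@QuadS R[i]) -> R[i]) (chi0_irr : irr_char chi0)
  (chi' : yoko ty n q.-1 (QuadZ (uK K)) -> K) (chi'_irr : irr_char chi')
  (psi : yoko ty n q.-1 (@QuadN R[i]) -> R[i]) (psi_irr : irr_char psi)
  (chi : yoko ty n q.-1 (QuadY (uK K)) -> K) (chi_irr : irr_char chi)
  (chiq : yoko ty n q.-1 (QuadY (q%:R)^-1) -> R[i]) (chiq_irr : irr_char chiq)
  (chi'_chi0 : dspec tau0 chi' chi0)
  (chi'_psi : dspec tau1 chi' psi)
  (chi_psi : dspec phi1 chi psi)
  (chi_chiq : dspec phiq chi chiq) :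
  exists (f : R) (g : int),
    [/\ f%:C%C = fexp chi0 w0,
        g%:~R = gexp chi0 w0 &
        chiq (cls _ (xiword w0)) =
          chi0 (cls _ (xiword w0)) * (- 'i%C) ^ g
            * (Num.sqrt (q%:R `^ (- f)))%:C%C].
Proof.
have q_ge2 : (2 <= q)%N.
  by case: q_pp => p [k [p_pr k_gt0 ->]]; rewrite (leq_trans (prime_gt1 p_pr)) // -{1}[p]expn1 leq_exp2l ?prime_gt1.
have d_gt1 : (1 < q.-1)%N by move: q_odd q_ge2; case: (q) => [|[|[|q']]].
have d_even : ~~ odd q.-1 by move: q_odd; case: (q) => [|q'].
have [N [G [eN eG eT]]] := character_formula n_ge2 d_gt1 d_even v_sqr w_sqr
  Y_split Z_split phiq_spec phi1_spec tau1_spec tau0_spec phi1_v tau0_w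
  (longest_wordP n_ge2 w0_longest) chi0_irr chi'_irr psi_irr chi_irr
  chi'_chi0 chi'_psi chi_psi chi_chiq.
exists N%:R, G%:Z; split.
- by rewrite eN rmorph_nat.
- by rewrite eG.
rewrite eT tau1_w phiq_v -rmorphXn /=; congr (_ * _%:C%C).
rewrite powRN powR_mulrn ?ler0n // -exprVn.
elim: N {eN eT} => [|N IH]; first by rewrite !expr0 sqrtr1.
by rewrite !exprS sqrtrM ?IH // invr_ge0 ler0n.
Qed.
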